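(* Suppose $p\ll n^{2/3}$, and that the random design and bounded support assumptions in the context hold. Let $\hat\theta_p=\hat\theta_p(y,X)\in\Theta$ be any estimator. For each $i\le p$ the following hold. (a) For both the oracle posterior $\mathbb P_{\theta_0}$ and the EB posterior $\mathbb P_{\hat\theta_p}$, $$\mathrm{D_{TV}}\big(\mathbb P_{\theta_0}(\beta_i),\mathbb Q_{\theta_0}(\beta_i)\big)=O_{P,X}\Big(\sqrt{\tfrac pn}\Big),\qquad \mathrm{D_{TV}}\big(\mathbb P_{\hat\theta_p}(\beta_i),\mathbb Q_{\hat\theta_p}(\beta_i)\big)=O_{P,X}\Big(\sqrt{\tfrac pn}\Big).$$ In particular, $$\mathbb E_{\mathbb P_{\theta_0}}[\beta_i]=u_i+O_{P,X}\Big(\sqrt{\tfrac pn}\Big),\quad \mathrm{Var}_{\mathbb P_{\theta_0}}[\beta_i]=\tau_i^2+O_{P,X}\Big(\sqrt{\tfrac pn}\Big),$$ $$\mathbb E_{\mathbb P_{\hat\theta_p}}[\beta_i]=\hat u_i+O_{P,X}\Big(\sqrt{\tfrac pn}\Big),\quad \mathrm{Var}_{\mathbb P_{\hat\theta_p}}[\beta_i]=\hat\tau_i^2+O_{P,X}\Big(\sqrt{\tfrac pn}\Big).$$ (b) $$\mathrm{D_{TV}}\big(\mathbb P_{\theta_0}(\beta_i),\mathbb Q_{\hat\theta_p}(\beta_i)\big)=O_{P,X}\Big(\sqrt{\tfrac pn}+\big(\tfrac p{\sqrt n}+1\big)\|\hat\theta_p-\theta_0\|\Big).$$ In particular, $$\mathbb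 E_{\mathbb P_{\theta_0}}[\beta_i]=\hat u_i+O_P\Big(\sqrt{\tfrac pn}+\big(\tfrac p{\sqrt n}+1\big)\|\hat\theta_p-\theta_0\|\Big),\quad \mathrm{Var}_{\mathbb P_{\theta_0}}[\beta_i]=\hat\tau_i^2+O_P\Big(\sqrt{\tfrac pn}+\big(\tfrac p{\sqrt n}+1\big)\|\hat\theta_p-\theta_0\|\Big).$$
   Context: Asymptotics: $p\to\infty$ with $n=n(p)\to\infty$; $k$ and $\sigma^2>0$ are fixed; $a\ll b$ means $a=o(b)$. Random design: $X\in\mathbb R^{n\times p}$ has i.i.d. entries distributed as $n^{-1/2}P$, where $P$ has mean $0$, variance $1$ and sub-Gaussian norm at most a constant (smallest $K$ with $\mathbb E e^{t(Z-\mathbb EZ)}\le e^{K^2t^2/2}$ for all $t$). Prior family: $\{\mu_\theta\}_{\theta\in\Theta}$, $\Theta\subset\mathbb R^k$ compact, $\theta_0$ in the interior of $\Theta$, are probability measures on $\mathbb R$ with $\frac{d\mu_\theta}{d\nu}(b)=e^{\ell(\theta;b)}$ for a non-degenerate base measure $\nu$; the family is identifiable with common support, and $\ell(\theta;b)$ is three times differentiable in $\theta$; Bartlett's identities $\mathbb E\nabla\ell(\theta;B_\theta)=0$ and $\mathbb E[\nabla^2\ell(\theta;B_\theta)]=-\mathbb E[\nabla\ell(\theta;B_\theta)\nabla\ell(\theta;B_\theta)^\top]$ hold for $B_\theta\sim\mu_\theta$, and $\mathrm{Var}[\nabla\ell(\theta;B_\theta)]$ is positive definite for all $\theta\in\Theta$.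 Bounded support: the common support is bounded and $\ell(\theta;b)$ is continuous in both $\theta$ and $b$; as part of this assumption the first three $\theta$-derivatives of $\ell$ are understood to be bounded uniformly over $\theta\in\Theta$ and $b$ in the support. Data: $\beta_i^\star$ i.i.d. $\mu_{\theta_0}$ (independent of $X$), $y\mid X,\beta^\star\sim N(X\beta^\star,\sigma^2I_n)$. Posteriors: $\mathbb P_\theta$ is the probability measure on $\mathbb R^p$ with $d\mathbb P_\theta(\beta)\propto\exp(-\frac1{2\sigma^2}\|y-X\beta\|^2)\prod_{i=1}^pd\mu_\theta(\beta_i)$. $\mathbb P_{\theta_0}$ is the oracle posterior and $\mathbb P_{\hat\theta_p}$ (plugging in $\theta=\hat\theta_p(y,X)$) the EB posterior. $\mathbb Q_\theta:=\arg\min_{\mathbb Q=\prod_{i=1}^pQ_i}\mathrm{D_{KL}}(\mathbb Q\mid\mathbb P_\theta)$ is the minimizer over product measures whose factors have the same support as $\mu_\theta$, with $\mathrm{D_{KL}}(\mathbb Q\mid\mathbb P)=\mathbb E_{\mathbb Q}\log\frac{d\mathbb Q}{d\mathbb P}$ (uniquely determined with probability tending to one under the random design assumption). $\mathbb P_\theta(\beta_i),\mathbb Q_\theta(\beta_i)$ denote the laws of the $i$th coordinate. $u_i,\tau_i^2$ are the mean and variance of $\beta_i$ under $\mathbb Q_{\theta_0}$; $\hat u_i,\hat\tau_i^2$ are the mean and variance of $\beta_i$ under $\mathbb Q_{\hat\theta_p}$. $\mathrm{D_{TV}}(\mathbb P,\mathbb Q)=\sup_E|\mathbb P(E)-\mathbb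 Q(E)|$. $O_{P,X}(c_p)$ denotes a quantity bounded in absolute value by $K_p(X)c_p$, where $K_p(X)$ depends only on $X$ and is $O_P(1)$; the bounds are for each $i$. *)

(* Defs.v *)
From HB Require Import structures.
From mathcomp Require Import all_boot all_order all_algebra.
From mathcomp Require Import all_classical all_reals all_analysis.
From mathcomp Require Import measurable_realfun.

Set Implicit Arguments.
Unset Strict Implicit.
Unset Printing Implicit Defensive.

Import Order.TTheory GRing.Theory Num.Theory.
Import numFieldNormedType.Exports.

Local Open Scope classical_set_scope.
Local Open Scope ring_scope.

Section product_on_tuples.
Context d (T : measurableType d) (R : realType).

Definition tcons n (z : T * n.-tuple T) : n.+1.-tuple T := [tuple of z.1 :: z.2].

Let measurable_tcons n : measurable_fun [set: T * n.-tuple T] (@tcons n).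
Proof. exact: measurable_cons. Qed.

HB.instance Definition _ n :=
  isMeasurableFun.Build _ _ _ _ (@tcons n) (@measurable_tcons n).

(* The law of n independent variables with respective laws Q 0, ..., Q (n - 1). *)
Fixpoint prod_prob n : ('I_n -> probability T R) -> probability (n.-tuple T) R :=
  match n with
  | 0 => fun _ => \d_([tuple] : 0.-tuple T)
  | m.+1 => fun Q =>
      distribution (Q ord0 \x prod_prob (fun i => Q (lift ord0 i)))%E (@tcons m)
  end.

Definition iid_prob n (Q : probability T R) : probability (n.-tuple T) R :=
  prod_prob (fun _ : 'I_n => Q).

Definition tcoord n (i : 'I_n) (b : n.-tuple T) : T := tnth b i.

Let measurable_tcoord n (i : 'I_n) : measurable_fun [set: n.-tuple T] (tcoord i).
Proof. exact: measurable_tnth. Qed.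

HB.instance Definition _ n i :=
  isMeasurableFun.Build _ _ _ _ (@tcoord n i) (@measurable_tcoord n i).

Definition marginal n (P : probability (n.-tuple T) R) (i : 'I_n) :
  probability T R := distribution P (tcoord i).

End product_on_tuples.

Definition l2norm (R : realType) m n (A : 'M[R]_(m, n)) : R :=
  Num.sqrt (\sum_i \sum_j A i j ^+ 2).

(* A design is a random tuple of rows: the library has a measurable structure
   on tuples, but none on matrices. *)
Definition design_mx (R : realType) n p (X : n.-tuple (p.-tuple R)) :
  'M[R]_(n, p) := \matrix_(k, j) tnth (tnth X k) j.

Definition tuple_col (R : realType) n (v : n.-tuple R) : 'cV[R]_n :=
  \col_k tnth v k.

Section probability_on_the_line.
Context {R : realType}.
Implicit Types P Q : probability R R.
Local Open Scope ereal_scope.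

(* The topological support. *)
Definition msupport P : set R :=
  [set x | forall U : set R, open U -> U x -> 0 < P U].

(* +oo when no K is admissible. *)
Definition subgaussian_norm P : \bar R :=
  ereal_inf [set K%:E | K in [set K : R | (0 <= K)%R /\
    forall t : R, 'E_P[fun z => expR (t * (z - fine 'E_P[@idfun R]))%R]
                  <= (expR (K ^+ 2 * t ^+ 2 / 2))%:E]].

Definition rescale (n : nat) (z : R) : R := ((Num.sqrt n%:R)^-1 * z)%R.

Let measurable_rescale n : measurable_fun [set: R] (rescale n).
Proof. exact: measurable_funM. Qed.

HB.instance Definition _ n :=
  isMeasurableFun.Build _ _ _ _ (rescale n) (measurable_rescale n).

(* The law of n^(-1/2) Z for Z distributed as P. *)
Definition scaled_law n P : probability R R := distribution P (rescale n).

(* normal_prob lives on measurableTypeR R, an alias of R with the same measurable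
   sets, hence the pushforward by the identity. *)
Definition of_measurableTypeR : measurableTypeR R -> R := idfun.

Let measurable_of_measurableTypeR : measurable_fun setT of_measurableTypeR.
Proof. exact: measurable_id. Qed.

HB.instance Definition _ := isMeasurableFun.Build _ _ _ _
  of_measurableTypeR measurable_of_measurableTypeR.

(* N(m, s ^ 2): normal_prob takes the standard deviation as its argument. *)
Definition normal_law (m s : R) : probability R R :=
  distribution (normal_prob m s) of_measurableTypeR.

End probability_on_the_line.

Definition coord_mean (R : realType) p (P : probability (p.-tuple R) R)
  (i : 'I_p) : R := fine ('E_P[tcoord i : p.-tuple R -> R])%E.

Definition coord_var (R : realType) p (P : probability (p.-tuple R) R)
  (i : 'I_p) : R := fine ('V_P[tcoord i : p.-tuple R -> R])%E.

Section divergences.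
Context d (T : measurableType d) (R : realType).
Implicit Types P Q : probability T R.
Local Open Scope ereal_scope.

Definition dKL Q P : \bar R :=
  if pselect (Q `<< P) then
    \int[Q]_x lne (Radon_Nikodym (charge_of_finite_measure Q) P x)
  else +oo.

Definition dTV P Q : R :=
  sup [set `|fine (P E) - fine (Q E)|%R | E in measurable].

End divergences.

Section posterior.
Context (R : realType) (n p : nat) (sigma : R).
Variables (y : n.-tuple R) (X : n.-tuple (p.-tuple R)).

Definition likelihood (b : p.-tuple R) : R :=
  expR (- (2 * sigma ^+ 2)^-1 *
        l2norm (tuple_col y - design_mx X *m tuple_col b) ^+ 2).

Lemma measurable_likelihood : measurable_fun setT likelihood.
Proof.
apply: measurableT_comp => //; apply: measurable_funM => //.
apply: measurable_funX => //.
apply: (@measurableT_comp _ _ _ _ _ _ (@Num.sqrt R)).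
  by apply: continuous_measurable_fun; exact: sqrt_continuous.
apply: measurable_sum => k; apply: measurable_sum => j.
apply: measurable_funX => //.
apply: (eq_measurable_fun (fun b : p.-tuple R =>
  tnth y k - \sum_(l < p) tnth (tnth X k) l * tcoord l b)).
  by move=> b _; rewrite !mxE; congr (_ - _); apply: eq_bigr => l _; rewrite !mxE.
apply: measurable_funB => //; apply: measurable_sum => l.
by apply: measurable_funM => //; exact: measurable_funPT.
Qed.

Variable mu : probability R R.

Definition weighted_prior (A : set (p.-tuple R)) : \bar R :=
  (\int[iid_prob p mu]_(b in A) (likelihood b)%:E)%E.

Let weighted_prior0 : weighted_prior set0 = 0%E.
Proof. by rewrite /weighted_prior integral_set0. Qed.

Let weighted_prior_ge0 A : (0 <= weighted_prior A)%E.
Proof. by apply: integral_ge0 => b _; rewrite lee_fin expR_ge0. Qed.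

Let weighted_prior_sigma_additive : semi_sigma_additive weighted_prior.
Proof.
move=> F mF tF mUF; rewrite /weighted_prior ge0_integral_bigcup//.
- by apply: is_cvg_ereal_nneg_natsum_cond => m _ _; exact: weighted_prior_ge0.
- by apply: measurable_funTS; apply/measurable_EFinP; exact: measurable_likelihood.
- by move=> b _; rewrite lee_fin expR_ge0.
Qed.

HB.instance Definition _ := isMeasure.Build _ _ _ weighted_prior
  weighted_prior0 weighted_prior_ge0 weighted_prior_sigma_additive.

(* The total mass of weighted_prior is in ]0, 1], so the second argument of
   mnormalize, its value on a measure of mass 0 or +oo, plays no role. *)
Definition posterior : probability (p.-tuple R) R :=
  mnormalize weighted_prior (iid_prob p mu).

Definition mf_admissible (Q : 'I_p -> probability R R) : Prop :=
  forall i, msupport (Q i) = msupport mu.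

(* The factors of the minimizers of D_KL( . | posterior) over product measures. *)
Definition mf_argmin : set ('I_p -> probability R R) :=
  [set Q | mf_admissible Q /\ forall Q', mf_admissible Q' ->
     (dKL (prod_prob Q) posterior <= dKL (prod_prob Q') posterior)%E].

End posterior.

Section prior_family.
Context (R : realType) (k : nat).
Implicit Types (f : 'rV[R]_k -> R) (t : 'rV[R]_k).

Definition partial (i : 'I_k) f t : R := 'D_(delta_mx 0 i) f t.

Definition differentiable3 f t : Prop :=
  [/\ differentiable f t,
      forall i, differentiable (partial i f) t &
      forall i j, differentiable (partial j (partial i f)) t].

Variables (Theta : set 'rV[R]_k) (theta0 : 'rV[R]_k).
Variables (nu : {measure set R -> \bar R}) (S : set R).
Variables (l : 'rV[R]_k -> R -> R) (mu : 'rV[R]_k -> probability R R).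

(* The log-density l t b only matters for b in the common support S; the
   restriction makes the following functions vanish off S. *)
Definition score t (i : 'I_k) : R -> R :=
  (fun b => partial i (l^~ b) t) \_ S.

Definition score2 t (i j : 'I_k) : R -> R :=
  (fun b => partial j (partial i (l^~ b)) t) \_ S.

Definition score_cov t : 'M[R]_k :=
  \matrix_(i, j) fine (covariance (mu t) (score t i) (score t j)).

Record prior_family : Prop := {
  Theta_compact : compact Theta ;
  theta0_interior : interior Theta theta0 ;
  nu_nondegenerate : forall x : R, nu (~` [set x]) != 0%E ;
  prior_density : forall t, Theta t -> forall A, measurable A ->
    mu t A = (\int[nu]_(b in A `&` S) (expR (l t b))%:E)%E ;
  prior_support : forall t, Theta t -> msupport (mu t) = S ;
  prior_identifiable : forall t t', Theta t -> Theta t' ->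
    (forall A, measurable A -> mu t A = mu t' A) -> t = t' ;
  (* Theta need not be open, hence differentiability around its points. *)
  l_smooth : forall t b, Theta t -> S b ->
    \forall t' \near t, differentiable3 (l^~ b) t' ;
  bartlett1 : forall t i, Theta t -> ('E_(mu t)[score t i] = 0)%E ;
  bartlett2 : forall t i j, Theta t ->
    ('E_(mu t)[score2 t i j] = - 'E_(mu t)[score t i * score t j])%E ;
  score_cov_posdef : forall t, Theta t -> forall v : 'rV[R]_k, v != 0 ->
    0 < (v *m score_cov t *m v^T) 0 0
}.

Record bounded_support : Prop := {
  support_bounded : bounded_set S ;
  l_continuous : {within Theta `*` S, continuous (fun z => l z.1 z.2)} ;
  l_derivatives_bounded : exists C : R, forall t b, Theta t -> S b ->
    forall i j m : 'I_k,
    [/\ `|partial i (l^~ b) t| <= C,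
        `|partial j (partial i (l^~ b)) t| <= C &
        `|partial m (partial j (partial i (l^~ b))) t| <= C]
}.

End prior_family.

Section triangular_array.
Context (R : realType) (n : nat -> nat).
Context (d : nat -> measure_display) (Om : forall p, measurableType (d p)).
Variable Pr : forall p, probability (Om p) R.
Variable X : forall p, {RV (Pr p) >-> (n p).-tuple (p.-tuple R)}.

Definition random_design (Z : nat -> probability R R) : Prop :=
  [/\ forall p, ('E_(Z p)[@idfun R] = 0)%E,
      forall p, ('V_(Z p)[@idfun R] = 1)%E,
      exists C : R, forall p, (subgaussian_norm (Z p) <= C%:E)%E &
      forall p A, measurable A ->
        Pr p (X p @^-1` A) =
        iid_prob (n p) (iid_prob p (scaled_law (n p) (Z p))) A].

Definition gaussian_response p (X0 : (n p).-tuple (p.-tuple R))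
    (b : p.-tuple R) (sigma : R) : probability ((n p).-tuple R) R :=
  prod_prob (fun k => normal_law ((design_mx X0 *m tuple_col b) k 0) sigma).

(* The last clause says that gaussian_response is the conditional law of y given
   (X, beta). *)
Definition data_model (beta : forall p, {RV (Pr p) >-> p.-tuple R})
    (y : forall p, {RV (Pr p) >-> (n p).-tuple R})
    (mu0 : probability R R) (sigma : R) : Prop :=
  [/\ forall p A, measurable A -> Pr p (beta p @^-1` A) = iid_prob p mu0 A,
      forall p A B, measurable A -> measurable B ->
        Pr p (X p @^-1` A `&` beta p @^-1` B) =
        (Pr p (X p @^-1` A) * Pr p (beta p @^-1` B))%E &
      forall p (A : set ((n p).-tuple (p.-tuple R) * p.-tuple R)) B,
        measurable A -> measurable B ->
        Pr p ((fun w => (X p w, beta p w)) @^-1` A `&` y p @^-1` B) =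
        (\int[Pr p]_(w in (fun w => (X p w, beta p w)) @^-1` A)
           gaussian_response (X p w) (beta p w) sigma B)%E].

(* Z = O_P(c), for each i <= p: the statement is equivalent to tightness along
   every sequence of indices (i_p). Z p i w is the set of the possible values of the
   quantity, all to be bounded, because a minimizer defining it need not be unique
   for every (y, X). The quantity need not be measurable either, whence the event A
   inside {|Z| <= M c}. *)
Definition OP (Z : forall p, 'I_p -> Om p -> set R)
    (c : forall p, 'I_p -> Om p -> R) : Prop :=
  forall e : R, 0 < e -> exists M : R, \forall p \near \oo, forall i : 'I_p,
  exists A : set (Om p), [/\ measurable A, ((1 - e)%:E <= Pr p A)%E &
    forall w z, A w -> Z p i w z -> `|z| <= M * c p i w].

(* Z = O_{P,X}(c). *)
Definition OPX (Z : forall p, 'I_p -> Om p -> set R)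
    (c : forall p, 'I_p -> Om p -> R) : Prop :=
  exists K : forall p, 'I_p -> (n p).-tuple (p.-tuple R) -> R,
    OP (fun p i w => [set K p i (X p w)]) (fun _ _ _ => 1) /\
    \forall p \near \oo, forall (i : 'I_p) w z,
      Z p i w z -> `|z| <= K p i (X p w) * c p i w.

End triangular_array.

(* Main.v *)
From HB Require Import structures.
Require Import Defs.
From mathcomp Require Import all_boot all_order all_algebra.
From mathcomp Require Import all_classical all_reals all_analysis.
From mathcomp Require Import measurable_realfun ring lra.

Set Implicit Arguments.
Unset Strict Implicit.
Unset Printing Implicit Defensive.

Import Order.TTheory GRing.Theory Num.Theory.
Import numFieldNormedType.Exports.

Local Open Scope classical_set_scope.
Local Open Scope ring_scope.

(** Fix the design and the data, and rescale the coordinates so that the support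
    lies in [[-1, 1]]. The log-likelihood is a quadratic polynomial in the
    coordinates, so the posterior is a Gibbs measure over the product prior: its
    pair interaction [A] is a multiple of [- W], where [W] is the off-diagonal part
    of the Gram matrix of the design, and its one-body terms absorb the data and the
    diagonal ([posterior_gibbs]). Given the other coordinates, coordinate [i] has
    the prior law tilted exponentially at the field [m i b = \sum_j A i j * b j]
    ([gibbs_conditional]). Its marginal is therefore the average of these tilts over
    the posterior law of [m i]. When a single factor [Q i] of a product law varies,
    the divergence to the posterior is, up to a constant, the relative entropy of
    [Q i] with respect to the tilt at the mean [s i] of the field under [Q]; so the
    [i]th factor of a minimizer is exactly that tilt ([mean_field_stationary]).
    Tilts are Lipschitz in the field ([tilt_lipschitz]), and everything reduces to
    the posterior mean of [|m i - s i|] ([field_fluctuation]).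

    Let [zeta j] be the residual of coordinate [j], that is, its difference with its
    conditional mean, [u] the vector of means under [Q], and [v = m - s]. Linearizing
    the conditional means at [s] gives [v = G (zeta + r + err)], where
    [G = A (1 - D A)^-1] with [D] diagonal, [r] is the Taylor remainder and [err] is
    the defect of [u] in the fixed-point equation. A linear statistic of the
    residuals with coefficients [g] has fourth moment of order [|g|^4]
    ([residual_moment4]): each residual is orthogonal to what does not depend on its
    coordinate, and switching that coordinate off changes the statistic little. So
    [(G zeta) i] is of the order of the norm of row [i] of [A]. The remainder is
    bounded both by [|v j|] and by [|v j|^2], up to constants; as the operator norm
    of [G] is small, [|r|^2] is dominated by [\sum_j (G zeta) j ^ 4], of bounded mean
    as soon as the fourth powers of the norms of the rows of [A] have a bounded sum.
    Cauchy-Schwarz then bounds [(G r) i] by the norm of row [i] too.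

    All these norms depend on the design only. The squared Frobenius norm of [W^2]
    dominates both the fourth power of the operator norm of [W] and the sum of the
    fourth powers of the norms of its rows. Its mean, computed by adding the rows of
    the design one at a time, is at most [6 p^3 / n^2 + c p^4 / n^3]
    ([gram_frobenius_mean]), and this is where [p << n^(2/3)] enters. The squared
    norm of row [i] of [W] has mean at most [p / n], which is the rate. On the rare
    event where [W^2] is large the trivial bound is used, the rate being paid for by
    the random constant, tight all the same ([gap_cst_tight]).

    When the posterior and the minimizer use the same parameter, [err = 0]. For the
    minimizer at the estimated parameter and the oracle posterior, each [err j] is at
    most a multiple of the distance between the parameters
    ([prior_tilt_lipschitz]). The [p] defects together contribute
    [|W i| * sqrt p] times this distance, and the final comparison of the two tilts
    contributes the distance itself. *)

(** * Bounded functions and product laws *)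

(** Bounded measurable functions are integrable under every probability measure,
    which spares the integrability conditions as long as the prior is tilted by
    bounded functions. *)
Definition bmeas d (T : measurableType d) (R : realType) (f : T -> R) : Prop :=
  measurable_fun setT f /\ exists C, forall x, `|f x| <= C.

Definition Ex d (T : measurableType d) (R : realType) (P : probability T R)
  (f : T -> R) : R := \int[P]_x f x.

Section bounded_functions.
Context d (T : measurableType d) (R : realType).
Implicit Types (f g : T -> R) (P : probability T R).

Lemma bmeas_cst c : bmeas (fun _ : T => c : R).
Proof. by split; [exact: measurable_cst|exists `|c|]. Qed.

Lemma bmeasD f g : bmeas f -> bmeas g -> bmeas (fun x => f x + g x).
Proof.
move=> [mf [C fC]] [mg [D gD]]; split; first exact: measurable_funD.
by exists (C + D) => x; rewrite (le_trans (ler_normD _ _))// lerD.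
Qed.

Lemma bmeasM f g : bmeas f -> bmeas g -> bmeas (fun x => f x * g x).
Proof.
move=> [mf [C fC]] [mg [D gD]]; split; first exact: measurable_funM.
by exists (C * D) => x; rewrite normrM ler_pM.
Qed.

Lemma bmeasN f : bmeas f -> bmeas (fun x => - f x).
Proof.
move=> [mf [C fC]]; split; first exact: measurableT_comp.
by exists C => x; rewrite normrN.
Qed.

Lemma bmeasB f g : bmeas f -> bmeas g -> bmeas (fun x => f x - g x).
Proof. by move=> bf bg; apply: bmeasD => //; exact: bmeasN. Qed.

Lemma bmeas_sum (I : Type) (s : seq I) (F : I -> T -> R) :
  (forall i, bmeas (F i)) -> bmeas (fun x => \sum_(i <- s) F i x).
Proof.
move=> bF; elim: s => [|i s IH].
  by under eq_fun do rewrite big_nil; exact: bmeas_cst.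
by under eq_fun do rewrite big_cons; exact: bmeasD.
Qed.

Lemma bmeasX f n : bmeas f -> bmeas (fun x => f x ^+ n).
Proof.
move=> bf; elim: n => [|n IH].
  by under eq_fun do rewrite expr0; exact: bmeas_cst.
by under eq_fun do rewrite exprS; exact: bmeasM.
Qed.

Lemma bmeas_norm f : bmeas f -> bmeas (fun x => `|f x|).
Proof.
move=> [mf [C fC]]; split; first exact: measurableT_comp.
by exists C => x; rewrite normr_id.
Qed.

Lemma bmeas_expR f : bmeas f -> bmeas (fun x => expR (f x)).
Proof.
move=> [mf [C fC]]; split; first exact: measurableT_comp.
exists (expR C) => x; rewrite ger0_norm ?expR_ge0// ler_expR.
by rewrite (le_trans (ler_norm _)).
Qed.

Lemma bmeas_comp d' (U : measurableType d') (h : U -> T) f :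
  measurable_fun setT h -> bmeas f -> bmeas (fun u => f (h u)).
Proof.
move=> mh [mf [C fC]]; split; last by exists C.
exact: (measurableT_comp mf mh).
Qed.

Lemma bmeas_indic (A : set T) : measurable A -> bmeas (\1_A : T -> R).
Proof.
move=> mA; split; first exact: measurable_indic.
exists 1 => x; rewrite indicE; case: (_ \in _); rewrite ?normr1 ?normr0//.
Qed.

Lemma bmeas_integrable P f : bmeas f -> P.-integrable setT (EFin \o f).
Proof.
move=> [mf [C fC]]; apply: measurable_bounded_integrable => //.
  by rewrite (le_lt_trans (probability_le1 _ _))// ltry.
by exists C; split; [exact: num_real|move=> M CM x _; exact: le_trans (fC x) (ltW CM)].
Qed.

Lemma Ex_cst P c : Ex P (fun _ => c) = c.
Proof. by rewrite /Ex Rintegral_cst//= probability_setT/= mulr1. Qed.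

Lemma ExD P f g : bmeas f -> bmeas g ->
  Ex P (fun x => f x + g x) = Ex P f + Ex P g.
Proof. by move=> bf bg; apply: RintegralD => //; exact: bmeas_integrable. Qed.

Lemma ExB P f g : bmeas f -> bmeas g ->
  Ex P (fun x => f x - g x) = Ex P f - Ex P g.
Proof. by move=> bf bg; apply: RintegralB => //; exact: bmeas_integrable. Qed.

Lemma ExZ P c f : bmeas f -> Ex P (fun x => c * f x) = c * Ex P f.
Proof. by move=> bf; apply: RintegralZl => //; exact: bmeas_integrable. Qed.

Lemma Ex_sum P (I : Type) (s : seq I) (F : I -> T -> R) :
  (forall i, bmeas (F i)) ->
  Ex P (fun x => \sum_(i <- s) F i x) = \sum_(i <- s) Ex P (F i).
Proof.
move=> bF; elim: s => [|i s IH].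
  by under eq_fun do rewrite big_nil; rewrite Ex_cst big_nil.
under eq_fun do rewrite big_cons.
by rewrite big_cons ExD// ?IH//; exact: bmeas_sum.
Qed.

Lemma le_Ex P f g : bmeas f -> bmeas g -> (forall x, f x <= g x) ->
  Ex P f <= Ex P g.
Proof. by move=> bf bg fg; apply: le_Rintegral => //; exact: bmeas_integrable. Qed.

Lemma Ex_ge0 P f : (forall x, 0 <= f x) -> 0 <= Ex P f.
Proof. by move=> f0; apply: Rintegral_ge0. Qed.

Lemma Ex_le_cst P f c : bmeas f -> (forall x, f x <= c) -> Ex P f <= c.
Proof. by move=> bf fc; rewrite -(Ex_cst P c) le_Ex//; exact: bmeas_cst. Qed.

Lemma le_norm_Ex P f : bmeas f -> `|Ex P f| <= Ex P (fun x => `|f x|).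
Proof. by move=> bf; apply: le_normr_Rintegral => //; exact: bmeas_integrable. Qed.

Lemma norm_Ex_le P f c : bmeas f -> (forall x, `|f x| <= c) -> `|Ex P f| <= c.
Proof.
move=> bf fc; rewrite (le_trans (le_norm_Ex P bf))//.
by apply: Ex_le_cst => //; exact: bmeas_norm.
Qed.

Lemma Ex_gt0 P f c : bmeas f -> 0 < c -> (forall x, c <= f x) -> 0 < Ex P f.
Proof.
move=> bf c0 cf; apply: (lt_le_trans c0).
by rewrite -(Ex_cst P c) le_Ex//; exact: bmeas_cst.
Qed.

Lemma EFin_Ex P f : bmeas f -> (Ex P f)%:E = (\int[P]_x (f x)%:E)%E.
Proof.
move=> bf; rewrite /Ex /Rintegral fineK//.
exact: (integrable_fin_num _ (bmeas_integrable P bf)).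
Qed.

Lemma Ex_indic P A : measurable A -> Ex P (\1_A : T -> R) = fine (P A).
Proof. by move=> mA; rewrite /Ex /Rintegral integral_indic// setIT. Qed.

End bounded_functions.

Definition upd (T : Type) n (b : n.-tuple T) (i : 'I_n) (x : T) : n.-tuple T :=
  [tuple if j == i then x else tnth b j | j < n].

Lemma tnth_upd (T : Type) n (b : n.-tuple T) i x j :
  tnth (upd b i x) j = if j == i then x else tnth b j.
Proof. by rewrite tnth_mktuple. Qed.

Lemma upd_cons0 (T : Type) n (z x : T) (b : n.-tuple T) :
  upd [tuple of z :: b] ord0 x = [tuple of x :: b].
Proof.
apply: eq_from_tnth => j; rewrite tnth_upd.
case: (unliftP ord0 j) => [j' ->|->]; last by rewrite eqxx.
by rewrite eq_sym (negbTE (neq_lift _ _)) !tnthS.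
Qed.

Lemma upd_consS (T : Type) n (z x : T) (b : n.-tuple T) i :
  upd [tuple of z :: b] (lift ord0 i) x = [tuple of z :: upd b i x].
Proof.
apply: eq_from_tnth => j; rewrite tnth_upd.
case: (unliftP ord0 j) => [j' ->|->].
  by rewrite (inj_eq lift_inj) !tnthS tnth_upd.
by rewrite (negbTE (neq_lift _ _)).
Qed.

Section product_laws.
Context d (T : measurableType d) (R : realType).
Local Open Scope ereal_scope.

Lemma measurable_upd n (i : 'I_n) :
  measurable_fun setT (fun z : n.-tuple T * T => upd z.1 i z.2).
Proof.
apply/measurable_fun_tnthP => j /=.
have [<-|ji] := eqVneq j i.
  rewrite (_ : _ \o _ = snd)//.
  by apply/funext => z /=; rewrite tnth_upd eqxx.
rewrite (_ : _ \o _ = (fun b => tnth b j) \o fst).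
  by apply: measurableT_comp => //; exact: measurable_tnth.
by apply/funext => z /=; rewrite tnth_upd (negbTE ji).
Qed.

Lemma measurable_upd1 n (i : 'I_n) (b : n.-tuple T) :
  measurable_fun setT (upd b i).
Proof.
exact: (measurableT_comp (measurable_upd i) (measurable_pair1 b)).
Qed.

Lemma measurable_tcons' n : measurable_fun setT (@tcons _ T n).
Proof. exact: measurable_cons. Qed.

Lemma ge0_integral_prod_probS n (Q : 'I_n.+1 -> probability T R)
    (F : n.+1.-tuple T -> \bar R) :
  measurable_fun setT F -> (forall b, 0 <= F b) ->
  \int[prod_prob Q]_b F b =
  \int[Q ord0]_z \int[prod_prob (fun i => Q (lift ord0 i))]_b F (tcons (z, b)).
Proof.
move=> mF F0 /=.
rewrite ge0_integral_pushforward//=.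
rewrite fubini_tonelli1//=.
by apply: measurableT_comp => //; exact: measurable_tcons'.
Qed.

(** The coordinates being independent, one of them can be redrawn from its law.
    That [Q'] may differ from [Q] at [i] also covers the replacement of one factor
    of a product law. *)
Lemma ge0_resample n (Q Q' : 'I_n -> probability T R) (i : 'I_n)
    (F : n.-tuple T -> \bar R) :
  (forall j, j != i -> Q j = Q' j) ->
  measurable_fun setT F -> (forall b, 0 <= F b) ->
  \int[prod_prob Q]_b F b = \int[prod_prob Q']_b \int[Q i]_x F (upd b i x).
Proof.
elim: n => [|n IH] in Q Q' i F *; first by case: i.
move=> QQ' mF F0.
have mG j : measurable_fun setT (fun b : n.+1.-tuple T => \int[Q j]_x F (upd b j x)).
  apply: (@measurable_fun_fubini_tonelli_F _ _ _ _ _ (Q j)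
            (fun z => F (upd z.1 j z.2))) => //.
  by apply: measurableT_comp => //; exact: measurable_upd.
rewrite ge0_integral_prod_probS//.
rewrite [RHS]ge0_integral_prod_probS//; last by move=> b; exact: integral_ge0.
have mc z : measurable_fun setT (fun b : n.-tuple T => F (tcons (z, b))).
  apply: measurableT_comp => //.
  exact: (measurableT_comp (@measurable_tcons' n) (measurable_pair1 z)).
case: (unliftP ord0 i) => [j ->|->] in QQ' *.
- rewrite -QQ' ?neq_lift//; apply: eq_integral => z _.
  rewrite (IH _ (fun k => Q' (lift ord0 k)) j)//; last first.
    by move=> k kj; apply: QQ'; rewrite (inj_eq lift_inj).
  by apply: eq_integral => b _; apply: eq_integral => x _; rewrite /tcons upd_consS.
- rewrite (_ : (fun k => Q' (lift ord0 k)) = (fun k => Q (lift ord0 k))); last first.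
    by apply/funext => k; rewrite QQ'// eq_sym neq_lift.
  under [RHS]eq_integral => z _.
    under eq_integral => b _.
      under eq_integral => x _.
        rewrite /tcons/= upd_cons0 -/(tcons (x, b)).
        over.
      over.
    over.
  rewrite integral_cst//= probability_setT mule1.
  rewrite (@fubini_tonelli _ _ _ _ _ (Q ord0) (prod_prob (fun k => Q (lift ord0 k)))
    (fun z => F (tcons z)))//.
  by apply: measurableT_comp => //; exact: measurable_tcons'.
Qed.

Lemma prod_prob_coord n (Q : 'I_n -> probability T R) i (F : T -> \bar R) :
  measurable_fun setT F -> (forall b, 0 <= F b) ->
  \int[prod_prob Q]_b F (tnth b i) = \int[Q i]_x F x.
Proof.
move=> mF F0; rewrite (@ge0_resample _ Q Q i)//; last first.
  by apply: measurableT_comp => //; exact: measurable_tnth.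
under eq_integral.
  move=> b _; under eq_integral do rewrite tnth_upd eqxx.
  over.
by rewrite integral_cst//= probability_setT mule1.
Qed.

Lemma marginal_prod_prob n (Q : 'I_n -> probability T R) i A :
  measurable A -> marginal (prod_prob Q) i A = Q i A.
Proof.
move=> mA; rewrite /marginal /distribution /pushforward.
have m1 : measurable (tcoord i @^-1` A).
  by rewrite -[X in measurable X]setTI; exact: measurable_tnth.
transitivity (\int[Q i]_x (\1_A x)%:E); last by rewrite integral_indic// setIT.
rewrite -(prod_prob_coord Q i)//; last first.
  by apply/measurable_EFinP; exact: measurable_indic.
transitivity (\int[prod_prob Q]_b (\1_(tcoord i @^-1` A) b)%:E) => //.
by rewrite integral_indic// setIT.
Qed.

Lemma prod_prob_density n (Q : 'I_n -> probability T R)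
    (mu : 'I_n -> probability T R) (f : 'I_n -> T -> R) :
  (forall i, measurable_fun setT (f i)) -> (forall i x, (0 <= f i x)%R) ->
  (forall i (F : T -> \bar R), measurable_fun setT F -> (forall x, 0 <= F x) ->
     \int[Q i]_x F x = \int[mu i]_x ((f i x)%:E * F x)) ->
  forall F : n.-tuple T -> \bar R, measurable_fun setT F -> (forall b, 0 <= F b) ->
  \int[prod_prob Q]_b F b =
  \int[prod_prob mu]_b ((\prod_(i < n) f i (tnth b i))%:E * F b).
Proof.
elim: n => [|n IH] in Q mu f *.
  move=> _ _ _ F mF F0 /=; rewrite !integral_dirac//=.
    by rewrite big_ord0 mul1e.
  by apply: emeasurable_funM => //; under eq_fun do rewrite big_ord0; exact: measurable_cst.
move=> mf f0 fQ F mF F0.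
have mc z : measurable_fun setT (fun b : n.-tuple T => F (tcons (z, b))).
  apply: measurableT_comp => //.
  exact: (measurableT_comp (@measurable_tcons' n) (measurable_pair1 z)).
have mp m (g : 'I_m -> T -> R) : (forall i, measurable_fun setT (g i)) ->
    measurable_fun setT (fun b : m.-tuple T => (\prod_(i < m) g i (tnth b i))%:E).
  move=> mg; apply/measurable_EFinP; apply: measurable_prod => i _.
  by apply: measurableT_comp => //; exact: measurable_tnth.
rewrite ge0_integral_prod_probS// [RHS]ge0_integral_prod_probS//; last 2 first.
- by apply: emeasurable_funM => //; exact: mp.
- by move=> b; rewrite mule_ge0// lee_fin prodr_ge0.
rewrite fQ//; last 2 first.
- apply: (@measurable_fun_fubini_tonelli_F _ _ _ _ _ _
            (fun z => F (tcons z))) => //.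
  by apply: measurableT_comp => //; exact: measurable_tcons'.
- by move=> x; exact: integral_ge0.
apply: eq_integral => z _.
rewrite (IH _ (fun i => mu (lift ord0 i)) (fun i => f (lift ord0 i)))//;
  last by move=> i; exact: fQ.
rewrite -ge0_integralZl ?lee_fin//; last 2 first.
- by apply: emeasurable_funM => //; exact: (mp _ (fun i => f (lift ord0 i))).
- by move=> b _; rewrite mule_ge0// lee_fin prodr_ge0.
apply: eq_integral => b _.
rewrite big_ord_recl muleA -EFinM; congr ((_ * _)%:E * _).
by apply: eq_bigr => i _; rewrite /tcons tnthS.
Qed.

End product_laws.

Section product_expectation.
Context d (T : measurableType d) (R : realType).

Lemma bmeas_upd n (i : 'I_n) (b : n.-tuple T) (F : n.-tuple T -> R) :
  bmeas F -> bmeas (fun x => F (upd b i x)).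
Proof. by move=> bF; apply: bmeas_comp => //; exact: measurable_upd1. Qed.

Lemma bmeas_tnth n (i : 'I_n) (F : T -> R) :
  bmeas F -> bmeas (fun b : n.-tuple T => F (tnth b i)).
Proof. by move=> bF; apply: bmeas_comp => //; exact: measurable_tnth. Qed.

Lemma bmeas_Ex_upd n (i : 'I_n) (P : probability T R) (F : n.-tuple T -> R) :
  bmeas F -> bmeas (fun b => Ex P (fun x => F (upd b i x))).
Proof.
move=> bF; have [mF [C FC]] := bF; split; last first.
  by exists C => b; apply: norm_Ex_le => //; exact: bmeas_upd.
(* Tonelli's theorem gives measurability for the non-negative function F + C *)
suff mC : measurable_fun setT (fun b => Ex P (fun x => F (upd b i x)) + C).
  rewrite (_ : (fun _ => _) = (fun b => Ex P (fun x => F (upd b i x)) + C - C)).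
    by apply: measurable_funB => //; exact: measurable_cst.
  by apply/funext => b; rewrite addrK.
apply/measurable_EFinP.
rewrite (_ : _ \o _ = fun b => (\int[P]_x (F (upd b i x) + C)%:E)%E); last first.
  apply/funext => b /=; rewrite -[in LHS](Ex_cst P C) -ExD//.
  - by rewrite EFin_Ex//; apply: bmeasD; [exact: bmeas_upd|exact: bmeas_cst].
  - exact: bmeas_upd.
  - exact: bmeas_cst.
apply: (@measurable_fun_fubini_tonelli_F _ _ _ _ _ P
          (fun z => (F (upd z.1 i z.2) + C)%:E)) => //.
  apply/measurable_EFinP; apply: measurable_funD => //.
  by apply: measurableT_comp => //; exact: measurable_upd.
by move=> z; rewrite lee_fin -lerBlDr sub0r lerNnormlW.
Qed.

Lemma Ex_resample n (Q Q' : 'I_n -> probability T R) (i : 'I_n)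
    (F : n.-tuple T -> R) :
  (forall j, j != i -> Q j = Q' j) -> bmeas F ->
  Ex (prod_prob Q) F = Ex (prod_prob Q') (fun b => Ex (Q i) (fun x => F (upd b i x))).
Proof.
move=> QQ' bF; have [mF [C FC]] := bF.
have bC : bmeas (fun b => F b + C) by apply: bmeasD => //; exact: bmeas_cst.
apply: (addIr C); rewrite -[in LHS](Ex_cst (prod_prob Q) C) -ExD//; last first.
  exact: bmeas_cst.
rewrite -[in RHS](Ex_cst (prod_prob Q') C) -ExD; [|exact: bmeas_Ex_upd|exact: bmeas_cst].
apply: EFin_inj; rewrite EFin_Ex// (ge0_resample QQ')//; last 2 first.
- by apply/measurable_EFinP; exact: (proj1 bC).
- by move=> b; rewrite lee_fin -lerBlDr sub0r lerNnormlW.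
rewrite EFin_Ex; last by apply: bmeasD; [exact: bmeas_Ex_upd|exact: bmeas_cst].
apply: eq_integral => b _; rewrite -EFin_Ex; last exact: (bmeas_upd i b bC).
congr EFin; rewrite ExD; [by rewrite Ex_cst|exact: bmeas_upd|exact: bmeas_cst].
Qed.

Lemma Ex_prod_coord n (Q : 'I_n -> probability T R) i (F : T -> R) :
  bmeas F -> Ex (prod_prob Q) (fun b => F (tnth b i)) = Ex (Q i) F.
Proof.
move=> bF; rewrite (@Ex_resample _ Q Q i)//; last exact: bmeas_tnth.
under eq_fun do under eq_fun do rewrite tnth_upd eqxx.
by rewrite Ex_cst.
Qed.

End product_expectation.

(** * Exponential tilts *)
Section exponential_bounds.
Context (R : realType).
Implicit Types t : R.

Lemma expRB1x_ge0 t : 0 <= expR t - 1 - t.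
Proof. by have := expR_ge1Dx t; lra. Qed.

Lemma expRB1x_le t : `|t| <= 1 / 2 -> expR t - 1 - t <= 2 * t ^+ 2.
Proof.
rewrite ler_norml => /andP[t1 t2].
have h : expR t * (1 - t) <= 1.
  have := expR_ge1Dx (- t); rewrite expRN => h.
  have e0 := expR_gt0 t.
  by rewrite -[X in _ <= X](mulfV (lt0r_neq0 e0)) ler_pM2l.
by have := expR_gt0 t; nra.
Qed.

Lemma expRB1_le t : `|t| <= 1 / 2 -> `|expR t - 1| <= 2 * `|t|.
Proof.
move=> ht; have h1 := expRB1x_ge0 t; have h2 := expRB1x_le ht.
have := ler_normD t (expR t - 1 - t).
rewrite (_ : t + _ = expR t - 1); last by ring.
rewrite (ger0_norm h1).
rewrite -(real_normK (num_real t)) in h2.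
by have := normr_ge0 t; nra.
Qed.

End exponential_bounds.

(** The expectations under an exponentially tilted law, as ratios: tilted laws are
    compared through bounded test functions only, mostly as functions of the field
    [m], while [phi] stays fixed. *)
Definition tilt d (T : measurableType d) (R : realType) (mu : probability T R)
  (kap phi : T -> R) (m : R) (f : T -> R) : R :=
  Ex mu (fun x => f x * expR (m * kap x + phi x)) /
  Ex mu (fun x => expR (m * kap x + phi x)).

Section tilts.
Context d (T : measurableType d) (R : realType) (mu : probability T R).
Variables (kap phi : T -> R).
Hypothesis bkap : bmeas kap.
Hypothesis kap1 : forall x, `|kap x| <= 1.
Hypothesis bphi : bmeas phi.
Implicit Types (f g : T -> R) (m : R).
Local Notation tau := (tilt mu kap phi).

Lemma bmeas_weight m : bmeas (fun x => expR (m * kap x + phi x)).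
Proof. by apply/bmeas_expR/bmeasD => //; apply: bmeasM => //; exact: bmeas_cst. Qed.

Lemma Ex_weight_gt0 m : 0 < Ex mu (fun x => expR (m * kap x + phi x)).
Proof.
have [_ [C hC]] : bmeas (fun x => m * kap x + phi x).
  by apply: bmeasD => //; apply: bmeasM => //; exact: bmeas_cst.
apply: (@Ex_gt0 _ _ _ _ _ (expR (- C))); rewrite ?expR_gt0//; first exact: bmeas_weight.
by move=> x; rewrite ler_expR lerNnormlW.
Qed.

Let bw m f : bmeas f -> bmeas (fun x => f x * expR (m * kap x + phi x)).
Proof. by move=> bf; apply: bmeasM => //; exact: bmeas_weight. Qed.

Lemma tiltD m f g : bmeas f -> bmeas g ->
  tau m (fun x => f x + g x) = tau m f + tau m g.
Proof.
move=> bf bg; rewrite /tilt -mulrDl -ExD//; [|exact: bw..].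
by congr (Ex _ _ / _); apply/funext => x; rewrite mulrDl.
Qed.

Lemma tiltZ m c f : bmeas f -> tau m (fun x => c * f x) = c * tau m f.
Proof.
move=> bf; rewrite /tilt mulrA -ExZ//; last exact: bw.
by congr (Ex _ _ / _); apply/funext => x; rewrite mulrA.
Qed.

Lemma tilt_cst m c : tau m (fun _ => c) = c.
Proof.
rewrite /tilt ExZ; last exact: bmeas_weight.
by rewrite mulfK// lt0r_neq0// Ex_weight_gt0.
Qed.

Lemma tiltB m f g : bmeas f -> bmeas g ->
  tau m (fun x => f x - g x) = tau m f - tau m g.
Proof.
move=> bf bg; rewrite -[- tau m g]mulN1r -tiltZ// -tiltD//; last first.
  by apply: bmeasM => //; exact: bmeas_cst.
by congr tilt; apply/funext => x; rewrite mulN1r.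
Qed.

Lemma tilt_norm_le m f F : bmeas f -> (forall x, `|f x| <= F) -> `|tau m f| <= F.
Proof.
move=> bf fF; rewrite /tilt normrM normfV (ger0_norm (ltW (Ex_weight_gt0 m))).
rewrite ler_pdivrMr ?Ex_weight_gt0//.
rewrite (le_trans (le_norm_Ex _ (bw m bf)))//.
rewrite -ExZ; last exact: bmeas_weight.
apply: le_Ex; [exact/bmeas_norm/bw|apply: bmeasM; [exact: bmeas_cst|exact: bmeas_weight]|].
by move=> x; rewrite normrM (ger0_norm (expR_ge0 _)) ler_wpM2r ?expR_ge0.
Qed.

Let be m : bmeas (fun x => expR (m * kap x)).
Proof. by apply: bmeas_expR; apply: bmeasM => //; exact: bmeas_cst. Qed.

(** The tilt at [x] has a density proportional to [exp ((x - y) kap)] with respect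
    to the tilt at [y]; written as a product, this needs no division. *)
Lemma tilt_shift x y f : bmeas f ->
  tau x f * tau y (fun t => expR ((x - y) * kap t)) =
  tau y (fun t => f t * expR ((x - y) * kap t)).
Proof.
move=> bf; have e t : expR ((x - y) * kap t) * expR (y * kap t + phi t) =
    expR (x * kap t + phi t).
  by rewrite -expRD; congr expR; ring.
rewrite /tilt (_ : (fun t => expR ((x - y) * kap t) * _) =
  (fun t => expR (x * kap t + phi t))); last exact/funext.
rewrite [in RHS](_ : (fun t => f t * _ * _) =
  (fun t => f t * expR (x * kap t + phi t))); last by apply/funext => t; rewrite -mulrA e.
by field; rewrite !lt0r_neq0// Ex_weight_gt0.
Qed.

Section centered.
Variables (x y : R) (f : T -> R) (F : R).
Hypotheses (bf : bmeas f) (fF : forall t, `|f t| <= F).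
Let g t := f t - tau y f.
Let bg : bmeas g. Proof. by apply: bmeasB => //; exact: bmeas_cst. Qed.
Let gF t : `|g t| <= 2 * F.
Proof.
rewrite (le_trans (ler_normB _ _))// (_ : 2 * F = F + F) ?lerD//; last by ring.
exact: tilt_norm_le.
Qed.

Let tg : tau y g = 0.
Proof. by rewrite tiltB ?tilt_cst ?subrr//; exact: bmeas_cst. Qed.

Let txg : tau x g = tau x f - tau y f.
Proof. by rewrite tiltB ?tilt_cst//; exact: bmeas_cst. Qed.

Let dk t : `|(x - y) * kap t| <= `|x - y|.
Proof. by rewrite normrM ler_piMr. Qed.

Let be1 : bmeas (fun t => expR ((x - y) * kap t) - 1).
Proof. by apply: bmeasB => //; exact: bmeas_cst. Qed.

Let e1 : `|x - y| <= 1 / 2 -> forall t, `|expR ((x - y) * kap t) - 1| <= 2 * `|x - y|.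
Proof.
move=> h t; rewrite (le_trans (expRB1_le _))//; first exact: le_trans (dk t) h.
by rewrite ler_wpM2l.
Qed.

Let shift : tau x g =
  tau y (fun t => g t * (expR ((x - y) * kap t) - 1)) -
  tau x g * tau y (fun t => expR ((x - y) * kap t) - 1).
Proof.
rewrite [tau y (fun t => expR _ - 1)]tiltB//; last exact: bmeas_cst.
rewrite tilt_cst mulrBr tilt_shift// mulr1.
rewrite (_ : (fun t => g t * (_ - 1)) =
  (fun t => g t * expR ((x - y) * kap t) - g t)); last by apply/funext => t; ring.
rewrite [in RHS]tiltB; [|by apply: bmeasM; [exact: bg|exact: be]|exact: bg].
rewrite tg; ring.
Qed.

(** For [|x - y| <= 1 / 2], [tilt_shift] expresses the difference through
    [exp ((x - y) kap) - 1], which is at most [2 |x - y|]; for larger increments the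
    trivial bound suffices. *)
Lemma tilt_lipschitz : `|tau x f - tau y f| <= 8 * F * `|x - y|.
Proof.
have F0 : 0 <= F by rewrite (le_trans _ (tilt_norm_le 0 bf fF)).
have h1 : `|tau x g| <= 2 * F by apply: tilt_norm_le.
rewrite -txg; have [h|h] := leP `|x - y| (1 / 2); last by nra.
have h2 := e1 h.
rewrite shift (le_trans (ler_normB _ _))//.
have -> : 8 * F * `|x - y| = 2 * F * (2 * `|x - y|) + 2 * F * (2 * `|x - y|) by ring.
apply: lerD; last by rewrite normrM ler_pM//; apply: tilt_norm_le.
by apply: tilt_norm_le; [exact: bmeasM|move=> t; rewrite normrM ler_pM].
Qed.

End centered.

(** The variance of [kap] under the tilt at [y] is the derivative at [y] of the
    tilted mean of [kap]. *)
Definition tilt_var y := tau y (fun t => (kap t - tau y kap) * kap t).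

Let bc y : bmeas (fun t => kap t - tau y kap).
Proof. by apply: bmeasB => //; exact: bmeas_cst. Qed.

Lemma tilt_var_le y : `|tilt_var y| <= 2.
Proof.
apply: tilt_norm_le; first exact: bmeasM.
move=> t; rewrite normrM -[2]mulr1 ler_pM//.
by rewrite (le_trans (ler_normB _ _))// (_ : 2 = 1 + 1)// lerD//; exact: tilt_norm_le.
Qed.

(** The remainder of the first-order expansion is bounded twice: the quadratic bound
    is the sharp one for small increments, while the linear one lets a small operator
    norm absorb the remainder whatever the size of the increments. *)
Lemma tilt_mean_taylor1 x y :
  `|tau x kap - tau y kap - tilt_var y * (x - y)| <= 10 * `|x - y|.
Proof.
rewrite (le_trans (ler_normB _ _))//.
rewrite (_ : 10 * `|x - y| = 8 * 1 * `|x - y| + 2 * `|x - y|); last by ring.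
by rewrite lerD ?tilt_lipschitz// normrM ler_wpM2r// tilt_var_le.
Qed.

Lemma tilt_mean_taylor2 x y :
  `|tau x kap - tau y kap - tilt_var y * (x - y)| <= 20 * `|x - y| ^+ 2.
Proof.
have h1 := tilt_mean_taylor1 x y.
have [h|h] := leP `|x - y| (1 / 2); last by nra.
have dk t : `|(x - y) * kap t| <= `|x - y| by rewrite normrM ler_piMr.
pose g t := kap t - tau y kap.
have bg : bmeas g by exact: bc.
have txg : tau x g = tau x kap - tau y kap.
  by rewrite tiltB ?tilt_cst//; exact: bmeas_cst.
have tg : tau y g = 0 by rewrite tiltB ?tilt_cst ?subrr//; exact: bmeas_cst.
have gF t : `|g t| <= 2.
  by rewrite (le_trans (ler_normB _ _))// (_ : 2 = 1 + 1)// lerD//; exact: tilt_norm_le.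
have be2 : bmeas (fun t => expR ((x - y) * kap t) - 1 - (x - y) * kap t).
  apply: bmeasB; first by apply: bmeasB => //; exact: bmeas_cst.
  by apply: bmeasM => //; exact: bmeas_cst.
have shift : tau x g - tilt_var y * (x - y) =
  tau y (fun t => g t * (expR ((x - y) * kap t) - 1 - (x - y) * kap t)) -
  tau x g * tau y (fun t => expR ((x - y) * kap t) - 1).
  rewrite [tau y (fun t => expR _ - 1)]tiltB//; last exact: bmeas_cst.
  rewrite tilt_cst [tau x g * _]mulrBr tilt_shift// mulr1.
  rewrite (_ : (fun t => g t * (_ - _ - _)) = (fun t => g t * expR ((x - y) * kap t)
    - g t - (x - y) * (g t * kap t))); last by apply/funext => t; ring.
  rewrite [in RHS]tiltB; [|by apply: bmeasB => //; exact: bmeasM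
    |by apply: bmeasM; [exact: bmeas_cst|exact: bmeasM]].
  rewrite [in RHS]tiltB//; last exact: bmeasM.
  rewrite tiltZ; last exact: bmeasM.
  rewrite tg /tilt_var -/g; ring.
rewrite -txg shift (le_trans (ler_normB _ _))//.
have -> : 20 * `|x - y| ^+ 2 = 2 * (2 * `|x - y| ^+ 2) + 8 * 1 * `|x - y| * (2 * `|x - y|).
  by ring.
have be1 : bmeas (fun t => expR ((x - y) * kap t) - 1).
  by apply: bmeasB => //; exact: bmeas_cst.
apply: lerD.
  apply: tilt_norm_le; first exact: bmeasM.
  move=> t; rewrite normrM ler_pM// ger0_norm ?expRB1x_ge0//.
  rewrite (le_trans (expRB1x_le _))//; first exact: le_trans (dk t) h.
  rewrite ler_wpM2l// -(real_normK (num_real (_ * _))).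
  by rewrite lerXn2r// nnegrE.
rewrite normrM ler_pM//.
  by rewrite txg; exact: tilt_lipschitz.
apply: tilt_norm_le => // t; rewrite (le_trans (expRB1_le _))//.
  exact: le_trans (dk t) h.
by rewrite ler_wpM2l.
Qed.

Lemma measurable_tilt f : bmeas f -> measurable_fun setT (fun m : R => tau m f).
Proof.
move=> bf; have [_ [F fF]] := bf.
have F0 : 0 <= F by rewrite (le_trans _ (tilt_norm_le 0 bf fF)).
apply: continuous_measurable_fun => x; apply/cvgrPdist_le => e e0.
have FP : 0 < 8 * F + 1 by lra.
have eF : 0 < e / (8 * F + 1) by rewrite divr_gt0.
have near_x := @cvgr_dist_le _ _ _ (nbhs x) _ id x (@cvg_id _ _) _ eF.
near=> z; have : `|x - z| <= e / (8 * F + 1) by near: z; exact: near_x.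
rewrite ler_pdivlMr// mulrC => h.
rewrite (le_trans (tilt_lipschitz x z bf fF))// (le_trans _ h)// ler_wpM2r//.
by lra.
Unshelve. all: by end_near. Qed.

Lemma bmeas_tilt d' (U : measurableType d') (h : U -> R) f :
  bmeas f -> measurable_fun setT h -> bmeas (fun u => tau (h u) f).
Proof.
move=> bf mh; have [_ [F fF]] := bf; split; last first.
  by exists F => u; exact: tilt_norm_le.
exact: (measurableT_comp (measurable_tilt bf) mh).
Qed.

End tilts.

(** * Densities *)
Section density.
Context d (T : measurableType d) (R : realType).
Variables (mu : {sigma_finite_measure set T -> \bar R}) (P : probability T R).
Variable f : T -> R.
Hypotheses (mf : measurable_fun setT f) (f0 : forall x, 0 <= f x).
Hypothesis Pf : forall A, measurable A -> P A = (\int[mu]_(x in A) (f x)%:E)%E.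

Lemma density_dominates : P `<< mu.
Proof.
apply/null_content_dominatesP => A mA A0; rewrite Pf//.
by apply: null_set_integral => //; apply/measurable_EFinP; exact: measurable_funTS.
Qed.

Lemma ge0_integral_density (F : T -> \bar R) :
  measurable_fun setT F -> (forall x, 0 <= F x)%E ->
  (\int[P]_x F x = \int[mu]_x ((f x)%:E * F x))%E.
Proof.
move=> mF F0; have dom := density_dominates.
pose q := Radon_Nikodym_SigmaFinite.f P mu.
have q0 x : (0 <= q x)%E by exact: Radon_Nikodym_SigmaFinite.f_ge0.
have iq : mu.-integrable setT q by exact: Radon_Nikodym_SigmaFinite.f_integrable.
have mq : measurable_fun setT q by exact: measurable_int iq.
have mfE : measurable_fun setT (EFin \o f) by exact/measurable_EFinP.
rewrite -(Radon_Nikodym_SigmaFinite.change_of_variables dom)//.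
apply: ge0_ae_eq_integral => //.
- exact: emeasurable_funM.
- exact: emeasurable_funM.
- by move=> x _; rewrite mule_ge0.
- by move=> x _; rewrite mule_ge0// lee_fin.
- have : ae_eq mu setT q (EFin \o f).
    apply: integral_ae_eq => // E _ mE.
    by rewrite -Radon_Nikodym_SigmaFinite.f_integral//; exact: Pf.
  by apply: filterS => x qf Dx; rewrite [RHS]muleC; congr (_ * _)%E; exact: qf.
Qed.

End density.

Lemma Ex_density d (T : measurableType d) (R : realType) (mu P : probability T R)
    (f F : T -> R) :
  bmeas f -> (forall x, 0 <= f x) ->
  (forall A, measurable A -> P A = (\int[mu]_(x in A) (f x)%:E)%E) ->
  bmeas F -> Ex P F = Ex mu (fun x => F x * f x).
Proof.
move=> bf f0 Pf bF; have [mF [C FC]] := bF.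
have hC x : 0 <= F x + `|C|.
  by rewrite -lerBlDr sub0r lerNnormlW// (le_trans (FC x)) ?ler_norm.
have pos G : bmeas G -> (forall x, 0 <= G x) -> Ex P G = Ex mu (fun x => G x * f x).
  move=> bG G0; rewrite /Ex /Rintegral; congr fine.
  rewrite (ge0_integral_density (proj1 bf) f0 Pf)//.
  - by apply: eq_integral => x _; rewrite EFinM muleC.
  - by apply/measurable_EFinP; exact: (proj1 bG).
have bC := @bmeas_cst _ T R `|C|.
have := pos _ (bmeasD bF bC) hC; rewrite ExD// (pos _ bC)//.
rewrite (_ : (fun x => (F x + _) * _) = (fun x => F x * f x + `|C| * f x)); last first.
  by apply/funext => x; rewrite mulrDl.
by rewrite ExD; [move/addIr|exact: bmeasM|exact: bmeasM].
Qed.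

(** * A fourth moment bound by Stein's method *)
Section stein.
Context d (T : measurableType d) (R : realType) (P : probability T R) (n : nat).
Variables (g : 'I_n -> R) (zeta D h : 'I_n -> T -> R) (K : R).
Let N := \sum_i g i ^+ 2.
Let f x := \sum_i g i * zeta i x.
Hypotheses (bzeta : forall i, bmeas (zeta i)) (bD : forall i, bmeas (D i)).
Hypothesis zeta2 : forall i x, `|zeta i x| <= 2.
Hypothesis zeta_orth : forall i, Ex P (fun x => zeta i x * (f x - D i x) ^+ 3) = 0.
Hypothesis Dh : forall i x, `|D i x| <= h i x.
Hypothesis hN : forall x, \sum_i h i x ^+ 2 <= K * N.

Lemma sum_sqr_mul_le (a b : 'I_n -> R) :
  \sum_i a i ^+ 2 * b i ^+ 2 <= (\sum_i a i ^+ 2) * \sum_i b i ^+ 2.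
Proof.
rewrite big_distrl/= ler_sum// => i _; rewrite ler_wpM2l ?sqr_ge0//.
by rewrite (bigD1 i)//= lerDl sumr_ge0// => j _; exact: sqr_ge0.
Qed.

(** Here [D i] is the change of [f] when coordinate [i] is switched off. In
    [E f^4 = \sum_i g i * E (zeta i * f^3)] subtract from [f^3] the cube of [f - D i],
    orthogonal to [zeta i]: what is left is of order [f^2 |D i| + |D i|^3], and the
    square of [f^2 - c N] bounds [f^2 N] by a small multiple of [f^4] plus a
    multiple of [N^2]. *)
Lemma stein_moment4 :
  Ex P (fun x => f x ^+ 4) <= ((9 * (1 + K) / 2) ^+ 2 + 5 * (K + K ^+ 2)) * N ^+ 2.
Proof.
have bf : bmeas f.
  by apply: bmeas_sum => i; apply: bmeasM => //; exact: bmeas_cst.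
have N0 : 0 <= N by apply: sumr_ge0 => i _; exact: sqr_ge0.
pose J i x := g i * (zeta i x * (f x ^+ 3 - (f x - D i x) ^+ 3)).
have bJ i : bmeas (J i).
  apply: bmeasM; first exact: bmeas_cst.
  by apply: bmeasM => //; apply: bmeasB; apply: bmeasX => //; exact: bmeasB.
have E4 : Ex P (fun x => f x ^+ 4) = Ex P (fun x => \sum_i J i x).
  have b3 i : bmeas (fun x => zeta i x * f x ^+ 3).
    by apply: bmeasM => //; exact: bmeasX.
  have b3' i : bmeas (fun x => zeta i x * (f x - D i x) ^+ 3).
    by apply: bmeasM => //; apply: bmeasX; exact: bmeasB.
  transitivity (Ex P (fun x => \sum_i g i * (zeta i x * f x ^+ 3))).
    congr Ex; apply/funext => x; rewrite exprS {1}/f big_distrl/=.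
    by apply: eq_bigr => i _; rewrite mulrA.
  rewrite !Ex_sum//; last by move=> i; apply: bmeasM => //; exact: bmeas_cst.
  apply: eq_bigr => i _; rewrite (_ : J i =
    (fun x => g i * (zeta i x * f x ^+ 3 - zeta i x * (f x - D i x) ^+ 3))); last first.
    by apply/funext => x; rewrite /J mulrBr.
  by rewrite ExZ// ExZ ?ExB ?zeta_orth ?subr0//; exact: bmeasB.
have Jle x : \sum_i J i x <=
    1 / 2 * f x ^+ 4 + ((9 * (1 + K) / 2) ^+ 2 / 2 + 5 / 2 * (K + K ^+ 2)) * N ^+ 2.
  have h0 i : 0 <= h i x := le_trans (normr_ge0 _) (Dh i x).
  have S1 : \sum_i `|g i| * h i x <= (1 + K) / 2 * N.
    have -> : (1 + K) / 2 * N = 1 / 2 * N + 1 / 2 * (K * N) by field.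
    apply: (@le_trans _ _ (1 / 2 * N + 1 / 2 * \sum_i h i x ^+ 2)); last first.
      by rewrite lerD2l ler_wpM2l// divr_ge0.
    rewrite !big_distrr -big_split/= ler_sum// => i _.
    rewrite -[g i ^+ 2](real_normK (num_real _)).
    by have := sqr_ge0 (`|g i| - h i x); nra.
  have S3 : \sum_i `|g i| * h i x ^+ 3 <= 1 / 2 * (K + K ^+ 2) * N ^+ 2.
    apply: (@le_trans _ _ (1 / 2 * (\sum_i g i ^+ 2 * h i x ^+ 2) +
                           1 / 2 * \sum_i h i x ^+ 2 * h i x ^+ 2)).
      rewrite !big_distrr -big_split/= ler_sum// => i _.
      rewrite -[g i ^+ 2](real_normK (num_real _)).
      by have := mulr_ge0 (sqr_ge0 (h i x)) (sqr_ge0 (`|g i| - h i x)); nra.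
    have H0 : 0 <= \sum_i h i x ^+ 2 by apply: sumr_ge0 => i _; exact: sqr_ge0.
    have h1 := sum_sqr_mul_le g (h^~ x).
    have h2 := sum_sqr_mul_le (h^~ x) (h^~ x).
    have h3 := hN x.
    rewrite -/N in h1.
    have h4 : N * \sum_i h i x ^+ 2 <= N * (K * N) by rewrite ler_wpM2l.
    have h5 : (\sum_i h i x ^+ 2) * (\sum_i h i x ^+ 2) <= (K * N) * (K * N).
      by rewrite ler_pM.
    by nra.
  apply: (@le_trans _ _ (9 * f x ^+ 2 * (\sum_i `|g i| * h i x) +
                         5 * \sum_i `|g i| * h i x ^+ 3)).
    rewrite !big_distrr -big_split/= ler_sum// => i _.
    rewrite (le_trans (ler_norm _))// /J !normrM.
    have h1 := Dh i x; have h2 := zeta2 i x.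
    set D' := D i x in h1 *; set F := f x; set H := h i x in h1 *.
    have e3 : `|F ^+ 3 - (F - D') ^+ 3| <= 9 / 2 * (F ^+ 2 * H) + 5 / 2 * H ^+ 3.
      have -> : F ^+ 3 - (F - D') ^+ 3 = 3 * (F ^+ 2 * D') - 3 * (F * D' ^+ 2) + D' ^+ 3.
        by ring.
      have D0 := normr_ge0 D'.
      have a1 : `|F ^+ 2 * D'| <= F ^+ 2 * H.
        by rewrite normrM ger0_norm ?sqr_ge0// ler_wpM2l ?sqr_ge0.
      have a3 : `|D'| ^+ 3 <= H ^+ 3 by rewrite lerXn2r// nnegrE h0.
      have a2 : `|F * D' ^+ 2| <= 1 / 2 * (F ^+ 2 * H) + 1 / 2 * H ^+ 3.
        rewrite normrM normrX.
        have := mulr_ge0 D0 (sqr_ge0 (`|F| - `|D'|)).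
        have : F ^+ 2 * `|D'| <= F ^+ 2 * H by rewrite ler_wpM2l ?sqr_ge0.
        rewrite -[F ^+ 2](real_normK (num_real F)).
        by move: a3; nra.
      rewrite (le_trans (ler_normD _ _))// (le_trans (lerD (ler_normB _ _) (lexx _)))//.
      by rewrite !(normrM 3) ger0_norm// normrX; lra.
    have e4 : `|zeta i x| * `|F ^+ 3 - (F - D') ^+ 3| <=
        2 * (9 / 2 * (F ^+ 2 * H) + 5 / 2 * H ^+ 3) by rewrite ler_pM.
    rewrite (le_trans (ler_wpM2l (normr_ge0 _) e4))//.
    by lra.
  have S1' : 9 * f x ^+ 2 * (\sum_i `|g i| * h i x) <=
      9 * f x ^+ 2 * ((1 + K) / 2 * N).
    by rewrite ler_wpM2l// mulr_ge0// sqr_ge0.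
  have Y := sqr_ge0 (f x ^+ 2 - 9 * (1 + K) / 2 * N).
  rewrite (le_trans (lerD S1' (lexx _)))//.
  have -> : f x ^+ 4 = f x ^+ 2 ^+ 2 by rewrite -exprM.
  by move: S3 Y; set A := f x ^+ 2; set B := \sum_i _; nra.
have b4 : bmeas (fun x => f x ^+ 4) by exact: bmeasX.
have : Ex P (fun x => f x ^+ 4) <= 1 / 2 * Ex P (fun x => f x ^+ 4) +
    ((9 * (1 + K) / 2) ^+ 2 / 2 + 5 / 2 * (K + K ^+ 2)) * N ^+ 2.
  rewrite {1}E4 -ExZ// -[X in _ <= _ + X](Ex_cst P) -ExD; last 2 first.
  - by apply: bmeasM => //; exact: bmeas_cst.
  - exact: bmeas_cst.
  apply: le_Ex => //; first exact: bmeas_sum.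
  by apply: bmeasD; [apply: bmeasM => //; exact: bmeas_cst|exact: bmeas_cst].
by lra.
Qed.

End stein.

(** * Gibbs measures with pair interactions *)
Definition opnorm2_le (R : realType) p (A : 'M[R]_p) (e : R) : Prop :=
  forall x : 'I_p -> R,
    \sum_i (\sum_j A i j * x j) ^+ 2 <= e * \sum_j x j ^+ 2.

Definition row_norm2 (R : realType) p (A : 'M[R]_p) (i : 'I_p) : R :=
  \sum_j A i j ^+ 2.

Section sums.
Context (R : realType).

Lemma cauchy_schwarz_sum (I : finType) (a b : I -> R) :
  (\sum_i a i * b i) ^+ 2 <= (\sum_i a i ^+ 2) * \sum_i b i ^+ 2.
Proof.
have [B0|B0] := eqVneq (\sum_i b i ^+ 2) 0.
  have b0 i : b i = 0.
    apply/eqP; rewrite -sqrf_eq0; apply/eqP.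
    by move: B0 => /psumr_eq0P -> // j _; exact: sqr_ge0.
  by rewrite B0 mulr0 big1 ?expr0n// => i _; rewrite b0 mulr0.
have B : 0 < \sum_i b i ^+ 2.
  by rewrite lt_neqAle eq_sym B0 sumr_ge0// => i _; exact: sqr_ge0.
set S := \sum_i b i ^+ 2 in B *; set C := \sum_i a i * b i.
have : 0 <= \sum_i (a i * S - b i * C) ^+ 2 by apply: sumr_ge0 => i _; exact: sqr_ge0.
have -> : \sum_i (a i * S - b i * C) ^+ 2 =
    S ^+ 2 * (\sum_i a i ^+ 2) - 2 * S * C * C + C ^+ 2 * S.
  rewrite (eq_bigr (fun i => S ^+ 2 * a i ^+ 2 - 2 * S * C * (a i * b i) +
    C ^+ 2 * b i ^+ 2)); last by move=> i _; ring.
  by rewrite big_split sumrB -!big_distrr.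
move=> h; have : 0 <= S * (S * (\sum_i a i ^+ 2) - C ^+ 2).
  by rewrite (le_trans h)//; lra.
by rewrite pmulr_rge0// subr_ge0 mulrC.
Qed.

Lemma opnorm2_row p (A : 'M[R]_p) e i :
  opnorm2_le A e -> A^T = A -> row_norm2 A i <= e.
Proof.
move=> Ae symA; have := Ae (fun j => (j == i)%:R).
have -> : \sum_j ((j == i)%:R : R) ^+ 2 = 1.
  rewrite (bigD1 i)//= eqxx expr1n big1 ?addr0// => j /negbTE ->.
  by rewrite expr0n.
rewrite mulr1; apply: le_trans; rewrite /row_norm2 ler_sum// => k _.
rewrite (bigD1 i)//= eqxx mulr1 big1 ?addr0 => [|j /negbTE ->]; last by rewrite mulr0.
by rewrite -{1}symA mxE.
Qed.

End sums.

Section hamiltonian.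
Context (T : Type) (R : realType) (p : nat).
Variables (A : 'M[R]_p) (kap : T -> R) (phi : 'I_p -> T -> R) (h0 : R).
Implicit Type b : p.-tuple T.

Definition lfield (i : 'I_p) b : R := \sum_j A i j * kap (tnth b j).

Definition hamiltonian b : R := h0 + \sum_i phi i (tnth b i) +
  1 / 2 * \sum_i \sum_j A i j * (kap (tnth b i) * kap (tnth b j)).

Definition off_coord (U : Type) (i : 'I_p) (F : p.-tuple T -> U) : Prop :=
  forall b x, F (upd b i x) = F b.

Hypotheses (symA : A^T = A) (diagA : forall i, A i i = 0).

Let AC i j : A i j = A j i. Proof. by rewrite -{1}symA mxE. Qed.

Lemma lfield_off i : off_coord i (lfield i).
Proof.
move=> b x; apply: eq_bigr => j _; rewrite tnth_upd.
by case: eqP => // ->; rewrite diagA !mul0r.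
Qed.

Lemma lfield_cut_off k l :
  off_coord l (fun b => lfield k b - A k l * kap (tnth b l)).
Proof.
move=> b x; rewrite /lfield (bigD1 l)//= [in RHS](bigD1 l)//= tnth_upd eqxx.
rewrite addrAC subrr add0r [RHS]addrAC subrr add0r.
by apply: eq_bigr => j /negbTE jl; rewrite tnth_upd jl.
Qed.

Definition rest_energy (i : 'I_p) b : R :=
  hamiltonian b - lfield i b * kap (tnth b i) - phi i (tnth b i).

(** As [A] has no diagonal, coordinate [i] enters the energy through [phi i] and, by
    symmetry of [A], linearly in [kap] with the field as coefficient. *)
Lemma rest_energy_off i : off_coord i (rest_energy i).
Proof.
have restE b : rest_energy i b = h0 + \sum_(j | j != i) phi j (tnth b j) +
    1 / 2 * \sum_(k | k != i) \sum_(j | j != i)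
       A k j * (kap (tnth b k) * kap (tnth b j)).
  rewrite /rest_energy /hamiltonian (bigD1 i)//=.
  rewrite [\sum_k \sum_j _](bigD1 i)//=.
  rewrite [in X in X + _](_ : \sum_j A i j * (kap (tnth b i) * kap (tnth b j)) =
    lfield i b * kap (tnth b i)); last first.
    by rewrite /lfield big_distrl/=; apply: eq_bigr => j _; ring.
  have -> : \sum_(k | k != i) \sum_j A k j * (kap (tnth b k) * kap (tnth b j)) =
      lfield i b * kap (tnth b i) + \sum_(k | k != i) \sum_(j | j != i)
        A k j * (kap (tnth b k) * kap (tnth b j)).
    rewrite /lfield big_distrl/= [in RHS](bigD1 i)//= diagA !mul0r add0r.
    rewrite -big_split/=; apply: eq_bigr => k _.
    by rewrite (bigD1 i)//= (AC k i); congr (_ + _); ring.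
  by field.
move=> b x; rewrite !restE; congr (_ + _ + _ * _).
  by apply: eq_bigr => j /negbTE ji; rewrite tnth_upd ji.
apply: eq_bigr => k /negbTE ki; apply: eq_bigr => j /negbTE ji.
by rewrite !tnth_upd ki ji.
Qed.

Lemma hamiltonianE i b :
  hamiltonian b = lfield i b * kap (tnth b i) + phi i (tnth b i) + rest_energy i b.
Proof. by rewrite /rest_energy; ring. Qed.

Lemma hamiltonian_upd i b x :
  hamiltonian (upd b i x) = lfield i b * kap x + phi i x + rest_energy i b.
Proof.
by rewrite (hamiltonianE i) lfield_off rest_energy_off tnth_upd eqxx.
Qed.

End hamiltonian.

Section gibbs_measure.
Context d (T : measurableType d) (R : realType) (p : nat).
Variables (mu : probability T R) (A : 'M[R]_p) (kap : T -> R).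
Variables (phi : 'I_p -> T -> R) (h0 : R) (P : probability (p.-tuple T) R).
Hypotheses (bkap : bmeas kap) (kap1 : forall x, `|kap x| <= 1).
Hypothesis bphi : forall i, bmeas (phi i).
Hypotheses (symA : A^T = A) (diagA : forall i, A i i = 0).
Local Notation H := (hamiltonian A kap phi h0).
Local Notation m := (lfield A kap).
Local Notation tau i := (tilt mu kap (phi i)).
Hypothesis PH : forall B, measurable B ->
  P B = (\int[iid_prob p mu]_(b in B) (expR (H b))%:E)%E.

Lemma bmeas_lfield i : bmeas (m i).
Proof.
apply: bmeas_sum => j; apply: bmeasM; first exact: bmeas_cst.
exact: bmeas_tnth.
Qed.

Lemma bmeas_hamiltonian : bmeas H.
Proof.
apply: bmeasD.
  apply: bmeasD; first exact: bmeas_cst.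
  by apply: bmeas_sum => i; exact: bmeas_tnth.
apply: bmeasM; first exact: bmeas_cst.
apply: bmeas_sum => i; apply: bmeas_sum => j.
apply: bmeasM; first exact: bmeas_cst.
by apply: bmeasM; exact: bmeas_tnth.
Qed.

Let bH := bmeas_expR bmeas_hamiltonian.

Lemma Ex_gibbs F : bmeas F ->
  Ex P F = Ex (iid_prob p mu) (fun b => F b * expR (H b)).
Proof.
by apply: Ex_density => // b; exact: expR_ge0.
Qed.

(** As a function of coordinate [i] alone, the Gibbs weight is proportional to the
    weight of the tilt at the field [m i b], which does not involve that coordinate
    ([hamiltonian_upd]). Redrawing coordinate [i] thus averages [f] to its tilted
    mean. *)
Lemma gibbs_conditional i f G : bmeas f -> bmeas G -> off_coord i G ->
  Ex P (fun b => (f (tnth b i) - tau i (m i b) f) * G b) = 0.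
Proof.
move=> bf bG Goff.
have bt : bmeas (fun b => tau i (m i b) f).
  by apply: bmeas_tilt => //; exact: (proj1 (bmeas_lfield i)).
have bF : bmeas (fun b => (f (tnth b i) - tau i (m i b) f) * G b).
  by apply: bmeasM => //; apply: bmeasB => //; exact: bmeas_tnth.
rewrite Ex_gibbs// /iid_prob (@Ex_resample _ _ _ _ _ (fun=> mu) i)//; last exact: bmeasM.
rewrite -[RHS](Ex_cst (prod_prob (fun _ : 'I_p => mu)) 0); congr Ex; apply/funext => b.
pose w x := expR (m i b * kap x + phi i x).
have bw : bmeas w by exact: bmeas_weight.
rewrite (_ : (fun x => _) = (fun x => (G b * expR (rest_energy A kap phi h0 i b)) *
   (f x * w x - tau i (m i b) f * w x))); last first.
  apply/funext => x; rewrite hamiltonian_upd// expRD tnth_upd eqxx Goff.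
  by rewrite lfield_off// /w; ring.
have bc c : bmeas (fun x => c * w x) by apply: bmeasM => //; exact: bmeas_cst.
rewrite ExZ; last by apply: bmeasB => //; exact: bmeasM.
rewrite ExB//; last exact: bmeasM.
rewrite ExZ// /tilt divfK ?subrr ?mulr0// lt0r_neq0//.
exact: Ex_weight_gt0.
Qed.

Lemma gibbs_marginal i f : bmeas f ->
  Ex P (fun b => f (tnth b i)) = Ex P (fun b => tau i (m i b) f).
Proof.
move=> bf; have := @gibbs_conditional i f (fun _ => 1) bf (bmeas_cst _ _) (fun _ _ => erefl).
rewrite (_ : (fun b => _) = (fun b => f (tnth b i) - tau i (m i b) f)); last first.
  by apply/funext => b; rewrite mulr1.
rewrite ExB; [by move/eqP; rewrite subr_eq0 => /eqP|exact: bmeas_tnth|].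
by apply: bmeas_tilt => //; exact: (proj1 (bmeas_lfield i)).
Qed.

Section linear_statistics.
Hypothesis opA : opnorm2_le A 1.

Definition residual i (b : p.-tuple T) := kap (tnth b i) - tau i (m i b) kap.

Lemma bmeas_residual i : bmeas (residual i).
Proof.
apply: bmeasB; first exact: bmeas_tnth.
by apply: bmeas_tilt => //; exact: (proj1 (bmeas_lfield i)).
Qed.

Lemma residual_le i b : `|residual i b| <= 2.
Proof.
rewrite (le_trans (ler_normB _ _))// (_ : 2 = 1 + 1)// lerD//.
exact: tilt_norm_le.
Qed.

Let AC i j : A i j = A j i. Proof. by rewrite -{1}symA mxE. Qed.

Variable g : 'I_p -> R.
Let N := \sum_i g i ^+ 2.
Let V k b := tilt_var mu kap (phi k) (m k b).
(* the field at [k] with coordinate [l] switched off *)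
Let cut k l (b : p.-tuple T) := m k b - A k l * kap (tnth b l).
(* the resulting change of the linear statistic [\sum_k g k * residual k b] *)
Let D l b := g l * kap (tnth b l) -
  \sum_k g k * (tau k (m k b) kap - tau k (cut k l b) kap).
(* its bound by Taylor's formula: a term from coordinate [l] itself, the first-order
   effect on the conditional means of the others, and the remainder *)
Let h l b := `|g l| + `|\sum_k A l k * (V k b * g k)| + 20 * \sum_k `|g k| * A l k ^+ 2.

Let bcut k l : bmeas (cut k l).
Proof.
apply: bmeasB; first exact: bmeas_lfield.
by apply: bmeasM; [exact: bmeas_cst|exact: bmeas_tnth].
Qed.

Let btau k F : bmeas F -> bmeas (fun b : p.-tuple T => tau k (F b) kap).
Proof. by move=> bF; apply: bmeas_tilt => //; exact: (proj1 bF). Qed.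

Let bD l : bmeas (D l).
Proof.
apply: bmeasB.
  by apply: bmeasM; [exact: bmeas_cst|exact: bmeas_tnth].
apply: bmeas_sum => k; apply: bmeasM; first exact: bmeas_cst.
by apply: bmeasB; apply: btau; [exact: bmeas_lfield|exact: bcut].
Qed.

Let Dh l b : `|D l b| <= h l b.
Proof.
have -> : D l b = g l * kap (tnth b l) - kap (tnth b l) * (\sum_k A l k * (V k b * g k)) +
   \sum_k g k * (tau k (cut k l b) kap - tau k (m k b) kap - V k b * (cut k l b - m k b)).
  rewrite /D mulr_sumr -!addrA; congr (_ + _); rewrite -!sumrN -big_split/=.
  by apply: eq_bigr => k _; rewrite /cut (AC l k); ring.
rewrite (le_trans (ler_normD _ _))// lerD//.
  rewrite (le_trans (ler_normB _ _))// !normrM lerD//.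
    by rewrite ler_piMr.
  by rewrite ler_piMl.
rewrite (le_trans (ler_norm_sum _ _ _))// mulr_sumr ler_sum// => k _.
rewrite normrM mulrCA ler_wpM2l//.
rewrite (le_trans (tilt_mean_taylor2 _ _ _ _ _ _))// ler_wpM2l//.
rewrite /cut (_ : _ - _ - _ = - (A k l * kap (tnth b l))); last by ring.
rewrite normrN real_normK ?num_real// exprMn (AC l k) ler_piMr ?sqr_ge0//.
by rewrite -real_normK ?num_real// expr_le1.
Qed.

Let hN b : \sum_l h l b ^+ 2 <= 3 * (1 + 4 + 20 ^+ 2) * N.
Proof.
have A1 := opnorm2_row _ opA symA.
have h1 : \sum_l (\sum_k A l k * (V k b * g k)) ^+ 2 <= 4 * N.
  rewrite (le_trans (opA _))// mul1r /N mulr_sumr ler_sum// => k _.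
  rewrite exprMn ler_wpM2r ?sqr_ge0// (_ : 4 = 2 ^+ 2); last by ring.
  rewrite -(real_normK (num_real (V k b))) lerXn2r ?nnegrE//.
  exact: tilt_var_le.
have h2 : \sum_l (\sum_k `|g k| * A l k ^+ 2) ^+ 2 <= N.
  apply: (@le_trans _ _ (\sum_l \sum_k g k ^+ 2 * A l k ^+ 2)).
    apply: ler_sum => l _.
    rewrite (eq_bigr (fun k => (`|g k| * A l k) * A l k)); last by move=> k _; ring.
    rewrite (le_trans (cauchy_schwarz_sum _ _))//.
    rewrite (eq_bigr (fun k => g k ^+ 2 * A l k ^+ 2)); last first.
      by move=> k _; rewrite exprMn real_normK ?num_real.
    rewrite ler_piMr ?A1// sumr_ge0// => k _.
    by rewrite mulr_ge0// sqr_ge0.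
  rewrite exchange_big/= /N ler_sum// => k _; rewrite -mulr_sumr.
  rewrite ler_piMr ?sqr_ge0//.
  rewrite (eq_bigr (fun j => A k j ^+ 2)); first exact: A1.
  by move=> j _; rewrite AC.
apply: (@le_trans _ _ (\sum_l 3 * (g l ^+ 2 +
    (\sum_k A l k * (V k b * g k)) ^+ 2 +
    20 ^+ 2 * (\sum_k `|g k| * A l k ^+ 2) ^+ 2))).
  apply: ler_sum => l _; rewrite /h.
  rewrite -(real_normK (num_real (g l))) -[X in _ <= 3 * (_ + X + _)]real_normK ?num_real//.
  set x := `|g l|; set y := `|_|; set z := \sum_k _.
  by have := sqr_ge0 (x - y); have := sqr_ge0 (x - 20 * z); have := sqr_ge0 (y - 20 * z); nra.
by rewrite -mulr_sumr !big_split/= -mulr_sumr -/N; lra.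
Qed.

Definition stein_cst : R := let K := 3 * (1 + 4 + 20 ^+ 2) in
  (9 * (1 + K) / 2) ^+ 2 + 5 * (K + K ^+ 2).

(** The hypotheses of [stein_moment4] hold because the statistic with coordinate [l]
    switched off does not depend on that coordinate, so that it is orthogonal to the
    residual by [gibbs_conditional], and because the operator norm of [A] bounds the
    sum of the squared first-order effects. *)
Lemma residual_moment4 :
  Ex P (fun b => (\sum_i g i * residual i b) ^+ 4) <= stein_cst * N ^+ 2.
Proof.
apply: (@stein_moment4 _ _ _ P _ g residual D h) => //.
- exact: bmeas_residual.
- exact: residual_le.
move=> l; pose F b := \sum_i g i * residual i b - D l b.
have bF : bmeas F.
  apply: bmeasB; last exact: bD; apply: bmeas_sum => i.
  by apply: bmeasM; [exact: bmeas_cst|exact: bmeas_residual].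
have E b' : F b' =
    \sum_k g k * ((if k == l then 0 else kap (tnth b' k)) - tau k (cut k l b') kap).
  rewrite /F /D opprD opprK addrA addrAC -big_split/=.
  rewrite [LHS](_ : _ = \sum_k (g k * kap (tnth b' k) - g k * tau k (cut k l b') kap)
     - g l * kap (tnth b' l)); last first.
    by congr (_ - _); apply: eq_bigr => k _; rewrite /residual; ring.
  rewrite (bigD1 l)//= [in RHS](bigD1 l)//= eqxx addrAC; congr (_ + _); first by ring.
  by apply: eq_bigr => k /negbTE ->; ring.
have Foff : off_coord l F.
  move=> b x; rewrite !E; apply: eq_bigr => k _; rewrite /cut lfield_cut_off//.
  by rewrite tnth_upd; case: eqP.
have F3off : off_coord l (fun b => F b ^+ 3) by move=> b x; rewrite Foff.
exact: (gibbs_conditional bkap (bmeasX 3 bF) F3off).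
Qed.

End linear_statistics.

End gibbs_measure.

(** * The linearized mean-field equations *)
Section resolvent.
Context (R : realType) (p : nat) (A : 'M[R]_p) (D : 'I_p -> R) (e : R).
Hypotheses (symA : A^T = A) (D2 : forall i, `|D i| <= 2).
Hypotheses (opA : opnorm2_le A e) (e0 : 0 <= e) (e16 : 16 * e <= 1).

Let DA : 'M[R]_p := \matrix_(i, j) (D i * A i j).

(** [v = A q] and [q = D v + c] together give [v = G c]. *)
Definition resolvent : 'M[R]_p := A *m invmx (1%:M - DA).
Local Notation G := resolvent.

Let AC i j : A i j = A j i. Proof. by rewrite -{1}symA mxE. Qed.

Let rowDA (x : 'I_p -> R) :
  \sum_k (\sum_j x j * DA j k) ^+ 2 <= 4 * e * \sum_j x j ^+ 2.
Proof.
rewrite (eq_bigr (fun k => (\sum_j A k j * (x j * D j)) ^+ 2)); last first.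
  move=> k _; congr (_ ^+ _); apply: eq_bigr => j _.
  by rewrite mxE (AC k j); ring.
rewrite (le_trans (opA _))// -mulrA mulrCA ler_wpM2l// mulr_sumr ler_sum// => j _.
rewrite exprMn mulrC ler_wpM2r ?sqr_ge0// -(real_normK (num_real (D j))).
by rewrite (_ : 4 = 2 ^+ 2) ?lerXn2r ?nnegrE//; ring.
Qed.

Lemma resolvent_unit : 1%:M - DA \in unitmx.
Proof.
rewrite -row_free_unit; apply: inj_row_free => v.
rewrite mulmxBr mulmx1 => /eqP; rewrite subr_eq0 => /eqP vDA.
have := rowDA (v ord0).
rewrite (eq_bigr (fun k => v ord0 k ^+ 2)); last first.
  by move=> k _; rewrite [in RHS]vDA mxE.
set S := \sum_j _ => h.
have S0 : 0 <= S by apply: sumr_ge0 => j _; exact: sqr_ge0.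
have q : 0 <= S * (1 - 16 * e) by rewrite mulr_ge0// subr_ge0.
have {h S0 q} : S = 0 by apply/eqP; rewrite eq_le S0 andbT; lra.
move=> /psumr_eq0P vz; apply/rowP => j; rewrite mxE; apply/eqP.
by rewrite -sqrf_eq0; apply/eqP/vz => // k _; exact: sqr_ge0.
Qed.

Lemma resolvent_left i j : G i j = A i j + \sum_k G i k * (D k * A k j).
Proof.
have E : G = A + G *m DA.
  have GA : G *m (1%:M - DA) = A by rewrite /resolvent mulmxKV// resolvent_unit.
  by rewrite -[X in X + _]GA mulmxBr mulmx1 subrK.
rewrite {1}E mxE; congr (_ + _); rewrite mxE; apply: eq_bigr => k _.
by rewrite [DA _ _]mxE.
Qed.

Lemma resolvent_right i j : G i j = A i j + \sum_k A i k * (D k * G k j).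
Proof.
have E : G = A + A *m (DA *m invmx (1%:M - DA)).
  rewrite -[X in X + _]mulmx1 -mulmxDr /resolvent; congr (_ *m _).
  have := mulmxV resolvent_unit; rewrite mulmxBl mul1mx => E1.
  by apply/eqP; rewrite -subr_eq E1.
rewrite {1}E mxE; congr (_ + _); rewrite mxE; apply: eq_bigr => k _.
congr (_ * _); rewrite mxE [G k j]mxE mulr_sumr.
by apply: eq_bigr => l _; rewrite [DA _ _]mxE mulrA.
Qed.

Let sqrD (a b : R) : (a + b) ^+ 2 <= 2 * a ^+ 2 + 2 * b ^+ 2.
Proof. by have := sqr_ge0 (a - b); nra. Qed.

(** [G = A + G D A], and the operator norm of [D A] is at most [1 / 2]. *)
Lemma resolvent_row i : row_norm2 G i <= 4 * row_norm2 A i.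
Proof.
have := rowDA (G i); rewrite -/(row_norm2 G i) => h.
have : row_norm2 G i <= 2 * row_norm2 A i + 2 * (4 * e * row_norm2 G i).
  apply: (@le_trans _ _ (\sum_j (2 * A i j ^+ 2 + 2 * (\sum_k G i k * DA k j) ^+ 2))).
    apply: ler_sum => j _; rewrite resolvent_left.
    have -> : \sum_k G i k * (D k * A k j) = \sum_k G i k * DA k j.
      by apply: eq_bigr => k _; rewrite [DA _ _]mxE.
    exact: sqrD.
  by rewrite big_split/= -!mulr_sumr lerD2l ler_wpM2l.
have S0 : 0 <= row_norm2 G i by apply: sumr_ge0 => j _; exact: sqr_ge0.
have q : 0 <= row_norm2 G i * (1 - 16 * e) by rewrite mulr_ge0// subr_ge0.
by lra.
Qed.

Lemma resolvent_opnorm : opnorm2_le G (4 * e).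
Proof.
move=> x; pose y i := \sum_j G i j * x j.
have yE i : y i = (\sum_j A i j * x j) + \sum_k A i k * (D k * y k).
  rewrite /y (eq_bigr (fun j => A i j * x j + \sum_k A i k * (D k * G k j) * x j)); last first.
    by move=> j _; rewrite resolvent_right mulrDl mulr_suml.
  rewrite big_split/=; congr (_ + _); rewrite exchange_big/=.
  apply: eq_bigr => k _; rewrite !mulr_sumr.
  by apply: eq_bigr => j _; rewrite !mulrA.
have h1 := opA x; have h2 := opA (fun k => D k * y k).
have h3 : \sum_k (D k * y k) ^+ 2 <= 4 * \sum_k y k ^+ 2.
  rewrite mulr_sumr ler_sum// => j _.
  rewrite exprMn ler_wpM2r ?sqr_ge0// -(real_normK (num_real (D j))).
  by rewrite (_ : 4 = 2 ^+ 2) ?lerXn2r ?nnegrE//; ring.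
have h4 : \sum_k y k ^+ 2 <= 2 * (\sum_i (\sum_j A i j * x j) ^+ 2) +
     2 * \sum_i (\sum_k A i k * (D k * y k)) ^+ 2.
  rewrite !mulr_sumr -big_split ler_sum// => k _.
  by rewrite {1}yE; exact: sqrD.
have h5 : e * \sum_k (D k * y k) ^+ 2 <= e * (4 * \sum_k y k ^+ 2) by rewrite ler_wpM2l.
have S0 : 0 <= \sum_k y k ^+ 2 by apply: sumr_ge0 => j _; exact: sqr_ge0.
have q : 0 <= (\sum_k y k ^+ 2) * (1 - 16 * e) by rewrite mulr_ge0// subr_ge0.
rewrite -/y; set Y := \sum_k y k ^+ 2 in h3 h4 h5 S0 q *.
by lra.
Qed.

End resolvent.

Section mean_field.
Context d (T : measurableType d) (R : realType) (p : nat).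
Variables (mu : probability T R) (A : 'M[R]_p) (kap : T -> R).
Variables (phi : 'I_p -> T -> R) (h0 : R) (P : probability (p.-tuple T) R).
Hypotheses (bkap : bmeas kap) (kap1 : forall x, `|kap x| <= 1).
Hypothesis bphi : forall i, bmeas (phi i).
Hypotheses (symA : A^T = A) (diagA : forall i, A i i = 0).
Local Notation H := (hamiltonian A kap phi h0).
Local Notation m := (lfield A kap).
Local Notation tau i := (tilt mu kap (phi i)).
Hypothesis PH : forall B, measurable B ->
  P B = (\int[iid_prob p mu]_(b in B) (expR (H b))%:E)%E.
Variable e : R.
(* [5400 e <= 1], factored into small numerals *)
Hypotheses (e5 : 0 <= e) (e5400 : 5 * (2 * 540) * e <= 1) (opA : opnorm2_le A e).
Hypothesis rowA : \sum_i row_norm2 A i ^+ 2 <= 1.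
Variables (u : 'I_p -> R) (eps : R).
Let s i := \sum_j A i j * u j.
Hypothesis eps0 : 0 <= eps.
Hypothesis u_fixpoint : forall i, `|tau i (s i) kap - u i| <= eps.

Let V i := tilt_var mu kap (phi i) (s i).
Let G := resolvent A V.
Let zeta i b := residual mu A kap phi i b.
Let v i b := m i b - s i.
Let r i b := tau i (m i b) kap - tau i (s i) kap - V i * v i b.
Let err i := tau i (s i) kap - u i.
Let a i b := \sum_j G i j * zeta j b.

Let V2 i : `|V i| <= 2. Proof. exact: tilt_var_le. Qed.

Let e16 : 16 * e <= 1. Proof. by move: e5 e5400; lra. Qed.

(* [A] maps [kap - u] to [v], and [kap - u = V v + zeta + r + err] *)
Let vE i b : v i b = a i b + \sum_j G i j * r j b + \sum_j G i j * err j.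
Proof.
pose q j := kap (tnth b j) - u j.
have vq j : v j b = \sum_k A j k * q k.
  by rewrite /v /lfield /s -sumrB; apply: eq_bigr => k _; rewrite /q mulrBr.
have qE j : zeta j b + r j b + err j = q j - V j * v j b.
  rewrite /zeta /residual /r /err /q.
  by set t1 := tilt _ _ _ _ _; set t2 := tilt _ _ _ _ _; ring.
rewrite /a -!big_split/= vq.
rewrite [RHS](eq_bigr (fun j => G i j * q j - \sum_k G i j * (V j * A j k) * q k)); last first.
  move=> j _; rewrite -!mulrDr qE mulrBr vq; congr (_ - _).
  by rewrite !mulr_sumr; apply: eq_bigr => k _; rewrite !mulrA.
rewrite sumrB exchange_big/= -sumrB; apply: eq_bigr => k _.
rewrite -mulr_suml -mulrBl; congr (_ * _).
by rewrite /G (resolvent_left symA V2 opA e5 e16) addrK.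
Qed.

Let r1 i b : `|r i b| <= 10 * `|v i b|. Proof. exact: tilt_mean_taylor1. Qed.
Let r2 i b : `|r i b| <= 20 * `|v i b| ^+ 2. Proof. exact: tilt_mean_taylor2. Qed.

Let Gerr i := \sum_j G i j * err j.
Let Gr i b := \sum_j G i j * r j b.

(* When [|v| <= 3 |a|] the quadratic bound on [r] applies; otherwise [|v|] is at most
   [3 / 2 (|Gr| + |Gerr|)] and the linear one does. *)
Let r_le i b : `|r i b| <= 180 * a i b ^+ 2 + 15 * `|Gr i b| + 15 * `|Gerr i|.
Proof.
have h1 := r1 i b; have h2 := r2 i b.
have vle : `|v i b| <= `|a i b| + `|Gr i b| + `|Gerr i|.
  by rewrite vE (le_trans (ler_normD _ _))// lerD2r ler_normD.
rewrite -(real_normK (num_real (a i b))).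
have a0 := normr_ge0 (a i b); have b0 := normr_ge0 (Gr i b).
have c0 := normr_ge0 (Gerr i); have v0 := normr_ge0 (v i b).
have [hv|hv] := leP `|v i b| (3 * `|a i b|).
  have : `|v i b| ^+ 2 <= (3 * `|a i b|) ^+ 2 by rewrite lerXn2r// nnegrE mulr_ge0.
  by rewrite exprMn; lra.
have := sqr_ge0 `|a i b|; lra.
Qed.

Let err2 : \sum_j err j ^+ 2 <= p%:R * eps ^+ 2.
Proof.
rewrite (@le_trans _ _ (\sum_(j < p) eps ^+ 2))//.
  apply: ler_sum => j _; rewrite -(real_normK (num_real (err j))).
  by rewrite lerXn2r ?nnegrE//; exact: u_fixpoint.
by rewrite sumr_const card_ord mulr_natl.
Qed.

Let S b := \sum_i a i b ^+ 4.

(* As [675 * 4 e <= 1 / 2], the contribution of [Gr] is absorbed by the left side. *)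
Let r_norm b : \sum_i r i b ^+ 2 <= 6 * 180 ^+ 2 * S b + p%:R * eps ^+ 2.
Proof.
have G2 := resolvent_opnorm symA V2 opA e5 e16.
have h1 := G2 (r^~ b); have h2 := G2 err.
have h3 : \sum_i r i b ^+ 2 <= 3 * 180 ^+ 2 * S b +
    675 * (\sum_i Gr i b ^+ 2) + 675 * \sum_i Gerr i ^+ 2.
  rewrite /S !mulr_sumr -!big_split/= ler_sum// => i _.
  rewrite -(real_normK (num_real (r i b))).
  have h : `|r i b| ^+ 2 <= (180 * a i b ^+ 2 + 15 * `|Gr i b| + 15 * `|Gerr i|) ^+ 2.
    by rewrite lerXn2r ?nnegrE ?(le_trans (normr_ge0 _) (r_le i b))// r_le.
  rewrite (le_trans h)//.
  rewrite -(real_normK (num_real (Gr i b))) -(real_normK (num_real (Gerr i))).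
  have -> : a i b ^+ 4 = (a i b ^+ 2) ^+ 2 by rewrite -exprM.
  set x := a i b ^+ 2; set y := `|Gr i b|; set z := `|Gerr i|.
  have := sqr_ge0 (180 * x - 15 * y); have := sqr_ge0 (180 * x - 15 * z).
  by have := sqr_ge0 (15 * y - 15 * z); nra.
rewrite -/G in h1 h2; rewrite -/(Gr _ _) in h1.
have := err2.
set X := \sum_i r i b ^+ 2 in h1 h3 *; set Y := \sum_i Gr i b ^+ 2 in h3.
have h1' : Y <= 4 * e * X by exact: h1.
set Z := \sum_i Gerr i ^+ 2 in h3.
have h2' : Z <= 4 * e * \sum_j err j ^+ 2 by exact: h2.
have X0 : 0 <= X by apply: sumr_ge0 => i _; exact: sqr_ge0.
have W0 : 0 <= \sum_j err j ^+ 2 by apply: sumr_ge0 => i _; exact: sqr_ge0.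
have q1 := ler_wpM2r X0 e5400; have q2 := ler_wpM2r W0 e5400.
by move: h1' h2' h3 q1 q2; lra.
Qed.

Definition mean_field_cst : R :=
  6 + 16 * stein_cst R + 6 * 180 ^+ 2 * (16 * stein_cst R).

Lemma stein_cst_ge0 : 0 <= stein_cst R.
Proof. by rewrite /stein_cst addr_ge0// ?sqr_ge0// mulr_ge0// addr_ge0// ?sqr_ge0; lra. Qed.

(** The three terms of [v = G (zeta + r + err)] at [i] are all controlled by the norm
    of row [i] of [G], at most twice that of [A]: the first one by the fourth moment
    bound, the others by Cauchy-Schwarz, [\sum_j err j ^+ 2] being at most
    [p * eps ^+ 2] and [\sum_j r j ^+ 2] having a bounded mean up to the same
    quantity since [\sum_j row_norm2 A j ^+ 2 <= 1]. *)
Lemma field_fluctuation i : Ex P (fun b => `|m i b - s i|) <=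
  mean_field_cst * Num.sqrt (row_norm2 A i) * (1 + Num.sqrt p%:R * eps).
Proof.
have row0 j : 0 <= row_norm2 A j by apply: sumr_ge0 => k _; exact: sqr_ge0.
have opA1 : opnorm2_le A 1.
  move=> x; rewrite (le_trans (opA x))// ler_wpM2r//; last by move: e5 e5400; lra.
  by apply: sumr_ge0 => k _; exact: sqr_ge0.
have Grow j : row_norm2 G j <= 4 * row_norm2 A j.
  exact: (resolvent_row symA V2 opA e5 e16).
have C0 := stein_cst_ge0.
have ba j : bmeas (a j).
  apply: bmeas_sum => k; apply: bmeasM; first exact: bmeas_cst.
  exact: bmeas_residual.
have a4 j : Ex P (fun b => a j b ^+ 4) <= 16 * stein_cst R * row_norm2 A j ^+ 2.
  apply: le_trans (residual_moment4 bkap kap1 bphi symA diagA PH opA1 (G j)) _.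
  rewrite -/(row_norm2 G j) [16 * _]mulrC -mulrA ler_wpM2l//.
  rewrite (_ : 16 * _ = (4 * row_norm2 A j) ^+ 2); last by ring.
  rewrite lerXn2r ?nnegrE ?mulr_ge0//.
  by apply: sumr_ge0 => k _; exact: sqr_ge0.
have ES : Ex P S <= 16 * stein_cst R.
  rewrite /S Ex_sum; last by move=> j; exact: bmeasX.
  rewrite (le_trans (ler_sum _ (fun j _ => a4 j)))// -mulr_sumr ler_piMr// mulr_ge0//.
set rho := Num.sqrt (row_norm2 A i).
have rho0 : 0 <= rho by exact: sqrtr_ge0.
have rho2 : rho ^+ 2 = row_norm2 A i by rewrite sqr_sqrtr.
set om := Num.sqrt p%:R * eps.
have om0 : 0 <= om by rewrite mulr_ge0// sqrtr_ge0.
have om2 : om ^+ 2 = p%:R * eps ^+ 2 by rewrite exprMn sqr_sqrtr.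
have Gle (x : 'I_p -> R) Q : 0 <= Q -> \sum_j x j ^+ 2 <= Q + om ^+ 2 ->
    `|\sum_j G i j * x j| <= rho * (1 + Q + 2 * om).
  move=> Q0 xQ.
  rewrite -(ler_pXn2r (ltn0Sn 1)) ?nnegrE//; last first.
    by rewrite mulr_ge0// !addr_ge0// mulr_ge0.
  rewrite real_normK ?num_real// (le_trans (cauchy_schwarz_sum _ _))//.
  rewrite -/(row_norm2 G i) exprMn rho2.
  apply: (@le_trans _ _ (4 * row_norm2 A i * (Q + om ^+ 2))).
    by rewrite ler_pM// ?sumr_ge0// => k _; exact: sqr_ge0.
  rewrite -mulrA mulrCA ler_wpM2l//.
  have := sqr_ge0 (1 - Q); have := mulr_ge0 Q0 om0; nra.
have [rho00|rho_neq0] := eqVneq rho 0.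
  have A0 j : A i j = 0.
    have : row_norm2 A i = 0 by rewrite -rho2 rho00 expr0n.
    move=> /psumr_eq0P h; apply/eqP; rewrite -sqrf_eq0; apply/eqP/h => // k _.
    exact: sqr_ge0.
  rewrite rho00 mulr0 mul0r (_ : (fun b => _) = fun=> 0) ?Ex_cst//.
  apply/funext => b; rewrite /lfield /s -sumrB big1 ?normr0// => j _.
  by rewrite A0 !mul0r subrr.
have rhoP : 0 < rho by rewrite lt_neqAle eq_sym rho_neq0.
have pt b : `|m i b - s i| <= rho * (3 + 4 * om) + rho ^- 3 * a i b ^+ 4 +
    rho * (6 * 180 ^+ 2) * S b.
  have even4 x : 0 <= x ^+ 4 :> R by rewrite (_ : 4 = 2 * 2)%N// exprM sqr_ge0.
  have S0 : 0 <= S b by apply: sumr_ge0 => j _.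
  have h1 := Gle (r^~ b) (6 * 180 ^+ 2 * S b).
  have h2 := Gle err 0 (lexx _).
  rewrite om2 in h1 h2.
  have {}h1 : `|Gr i b| <= rho * (1 + 6 * 180 ^+ 2 * S b + 2 * om).
    by apply: h1 (r_norm b); rewrite mulr_ge0// mulr_ge0.
  have {}h2 : `|Gerr i| <= rho * (1 + 0 + 2 * om).
    by apply: h2; rewrite add0r; exact: err2.
  (* Young's inequality t <= 1 + t ^ 4 at the scale rho *)
  have h3 : `|a i b| <= rho + rho ^- 3 * a i b ^+ 4.
    have [la|la] := leP `|a i b| rho.
      by rewrite (le_trans la)// lerDl mulr_ge0// invr_ge0 exprn_ge0.
    apply: (@le_trans _ _ (rho ^- 3 * a i b ^+ 4)); last by rewrite lerDr.
    rewrite mulrC ler_pdivlMr ?exprn_gt0//.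
    have -> : a i b ^+ 4 = `|a i b| * `|a i b| ^+ 3.
      by rewrite -exprS -normrX ger0_norm.
    by rewrite ler_wpM2l// lerXn2r// ?nnegrE// ltW.
  have vle : `|v i b| <= `|a i b| + `|Gr i b| + `|Gerr i|.
    by rewrite vE (le_trans (ler_normD _ _))// lerD2r ler_normD.
  by rewrite -/(v i b); lra.
have bS : bmeas S by apply: bmeas_sum => j; exact: bmeasX.
have ba4 : bmeas (fun b => rho ^- 3 * a i b ^+ 4).
  by apply: bmeasM; [exact: bmeas_cst|exact: bmeasX].
have bS' : bmeas (fun b => rho * (6 * 180 ^+ 2) * S b).
  by apply: bmeasM => //; exact: bmeas_cst.
have bc := @bmeas_cst _ (p.-tuple T) R (rho * (3 + 4 * om)).
apply: le_trans (le_Ex _ _ _ pt) _.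
- by apply: bmeas_norm; apply: bmeasB; [exact: bmeas_lfield|exact: bmeas_cst].
- by apply: bmeasD => //; exact: bmeasD.
rewrite ExD//; last exact: bmeasD.
rewrite ExD// Ex_cst !ExZ//; last exact: bmeasX.
have h1 : rho ^- 3 * Ex P (fun b => a i b ^+ 4) <= 16 * stein_cst R * rho.
  rewrite mulrC ler_pdivrMr ?exprn_gt0//.
  have -> : 16 * stein_cst R * rho * rho ^+ 3 = 16 * stein_cst R * (rho ^+ 2) ^+ 2.
    by rewrite -!mulrA -exprS -exprM.
  by rewrite rho2.
have h2 : rho * (6 * 180 ^+ 2) * Ex P S <= rho * (6 * 180 ^+ 2) * (16 * stein_cst R).
  by rewrite ler_wpM2l// mulr_ge0// mulr_ge0.
rewrite /mean_field_cst; set C := 16 * stein_cst R in h1 h2 *.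
have C1 : 0 <= C by rewrite mulr_ge0.
have q := mulr_ge0 (mulr_ge0 C1 rho0) om0.
have q' := mulr_ge0 rho0 om0.
by lra.
Qed.

(** The law of coordinate [i] is an average of tilts at the field [m i]. *)
Lemma mean_field_approx i f : bmeas f -> (forall x, `|f x| <= 1) ->
  `|Ex P (fun b => f (tnth b i)) - tau i (s i) f| <=
  8 * mean_field_cst * Num.sqrt (row_norm2 A i) * (1 + Num.sqrt p%:R * eps).
Proof.
move=> bf f1; rewrite (gibbs_marginal bkap kap1 bphi symA diagA PH)//.
have bt : bmeas (fun b => tau i (m i b) f).
  by apply: bmeas_tilt => //; exact: (proj1 (bmeas_lfield A bkap i)).
rewrite -[X in _ - X](Ex_cst P) -ExB//; last exact: bmeas_cst.
have bm : bmeas (fun b => m i b - s i).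
  by apply: bmeasB; [exact: bmeas_lfield|exact: bmeas_cst].
rewrite (le_trans (le_norm_Ex _ _))//; first by apply: bmeasB => //; exact: bmeas_cst.
apply: (@le_trans _ _ (Ex P (fun b => 8 * `|m i b - s i|))).
  apply: le_Ex; first by apply/bmeas_norm/bmeasB => //; exact: bmeas_cst.
    by apply: bmeasM; [exact: bmeas_cst|exact: bmeas_norm].
  by move=> b; rewrite -[8]mulr1; exact: tilt_lipschitz.
rewrite ExZ; last exact: bmeas_norm.
by rewrite -!mulrA ler_wpM2l// !mulrA; exact: field_fluctuation.
Qed.

End mean_field.

(** * Relative entropy *)
Section tilted_law.
Context d (T : measurableType d) (R : realType) (mu : probability T R).
Variables (w : T -> R) (mw : measurable_fun setT w) (w0 : forall x, 0 <= w x).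
Local Open Scope ereal_scope.

(** The proofs are arguments so that the measure structure can be inferred. *)
Definition weighted_law_of of measurable_fun setT w & (forall x, 0 <= w x)%R :=
  fun A : set T => \int[mu]_(x in A) (w x)%:E.

Local Notation weighted_law := (weighted_law_of mw w0).

Let weighted_law0 : weighted_law set0 = 0.
Proof. by rewrite /weighted_law_of integral_set0. Qed.

Let weighted_law_ge0 A : 0 <= weighted_law A.
Proof. by apply: integral_ge0 => x _; rewrite lee_fin. Qed.

Let weighted_law_sigma_additive : semi_sigma_additive weighted_law.
Proof.
move=> F mF tF mUF; rewrite /weighted_law_of ge0_integral_bigcup//.
- by apply: is_cvg_ereal_nneg_natsum_cond => m _ _; exact: weighted_law_ge0.
- by apply: measurable_funTS; apply/measurable_EFinP.
- by move=> x _; rewrite lee_fin.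
Qed.

HB.instance Definition _ := isMeasure.Build _ _ _ weighted_law
  weighted_law0 weighted_law_ge0 weighted_law_sigma_additive.

End tilted_law.

Lemma mnormalize_density d (T : measurableType d) (R : realType)
    (m : {measure set T -> \bar R}) (mu P0 : probability T R) (w : T -> R) :
  measurable_fun setT w -> (forall x, 0 <= w x) ->
  (forall A, measurable A -> m A = (\int[mu]_(x in A) (w x)%:E)%E) ->
  forall z : R, 0 < z -> m setT = z%:E ->
  forall A, measurable A ->
    mnormalize m P0 A = (\int[mu]_(x in A) (w x / z)%:E)%E.
Proof.
move=> mw w0 mE z z0 mz A mA; rewrite /mnormalize mz eqe gt_eqF//= mE//.
under [RHS]eq_integral do rewrite EFinM.
rewrite ge0_integralZr//.
- by apply: measurable_funTS; exact/measurable_EFinP.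
- by move=> x _; rewrite lee_fin.
- by rewrite lee_fin invr_ge0 ltW.
Qed.

Lemma tilted_law_exists d (T : measurableType d) (R : realType)
    (mu : probability T R) (psi : T -> R) : bmeas psi ->
  exists Q : probability T R, forall A, measurable A ->
    Q A = (\int[mu]_(x in A) (expR (psi x) / Ex mu (expR \o psi))%:E)%E.
Proof.
move=> bpsi; have be := bmeas_expR bpsi; have [me _] := be.
have z0 : 0 < Ex mu (expR \o psi).
  have [_ [C hC]] := bpsi; apply: (@Ex_gt0 _ _ _ mu _ (expR (- C))); rewrite ?expR_gt0//.
  by move=> x; rewrite ler_expR lerNnormlW.
exists (mnormalize (weighted_law_of mu me (fun x => expR_ge0 _)) mu) => A mA.
apply: mnormalize_density => //=.
by rewrite EFin_Ex.
Qed.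

Section relative_entropy.
Context d (T : measurableType d) (R : realType).
Implicit Types (P Q : probability T R) (f : T -> R).

Definition has_density P f Q : Prop := [/\ measurable_fun setT f,
  (forall x, 0 <= f x) &
  forall A, measurable A -> Q A = (\int[P]_(x in A) (f x)%:E)%E].

Lemma dominates_density P Q : Q `<< P -> exists f, has_density P f Q.
Proof.
move=> QP; pose q := Radon_Nikodym_SigmaFinite.f Q P.
have q0 x : (0 <= q x)%E by exact: Radon_Nikodym_SigmaFinite.f_ge0.
have qfin x : q x \is a fin_num by exact: Radon_Nikodym_SigmaFinite.f_fin_num.
have mq : measurable_fun setT q.
  exact: measurable_int (Radon_Nikodym_SigmaFinite.f_integrable QP).
exists (fun x => fine (q x)); split.
- by apply/measurable_EFinP; rewrite (_ : _ \o _ = q)//; apply/funext => x /=; rewrite fineK.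
- by move=> x; rewrite fine_ge0.
- move=> A mA; under eq_integral do rewrite fineK//.
  exact: Radon_Nikodym_SigmaFinite.f_integral.
Qed.

Lemma has_density_dominates P f Q : has_density P f Q -> Q `<< P.
Proof. by case=> mf f0 Qf; exact: density_dominates mf Qf. Qed.

Lemma has_density_integral P f Q (F : T -> \bar R) : has_density P f Q ->
  measurable_fun setT F -> (forall x, 0 <= F x)%E ->
  (\int[Q]_x F x = \int[P]_x ((f x)%:E * F x))%E.
Proof. by case=> mf f0 Qf mF F0; exact: (ge0_integral_density mf f0 Qf). Qed.

Lemma density_pos_ae P f Q : has_density P f Q -> {ae Q, forall x, 0 < f x}.
Proof.
move=> [mf f0 Qf]; have mN : measurable [set x | f x <= 0].
  by rewrite -[X in measurable X]setTI; exact: measurable_fun_le.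
exists [set x | f x <= 0]; split => //; last by move=> x /= /negP; rewrite -leNgt.
rewrite Qf// integral0_eq// => x /= fx; apply/eqP.
by rewrite eqe eq_le fx f0.
Qed.

Lemma measurable_lne f : measurable_fun setT f ->
  measurable_fun setT (fun x => lne (f x)%:E).
Proof.
move=> mf; rewrite (_ : (fun x => _) =
  (fun x => if f x <= 0 then -oo%E else (ln (f x))%:E)); last first.
  apply/funext => x; case: leP => h; first by rewrite le0_lneNy// lee_fin.
  by rewrite lne_EFin.
apply: measurable_fun_ifT => //.
  exact: measurable_fun_ler.
by apply/measurable_EFinP; exact: measurableT_comp.
Qed.

Lemma dKL_density P f Q : has_density P f Q ->
  dKL Q P = (\int[Q]_x (ln (f x))%:E)%E.
Proof.
move=> hf; have QP := has_density_dominates hf; have [mf f0 Qf] := hf.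
rewrite /dKL; case: pselect => // QP'.
set q := Radon_Nikodym _ _.
have mq : measurable_fun setT q by apply: measurable_int; exact: Radon_Nikodym_integrable.
have qfin x : q x \is a fin_num by exact: Radon_Nikodym_fin_num.
have ml : measurable_fun setT (fun x => lne (q x)).
  rewrite (_ : (fun x => lne (q x)) = fun x => lne (fine (q x))%:E); last first.
    by apply/funext => x; rewrite fineK.
  apply: measurable_lne; apply/measurable_EFinP.
  by rewrite (_ : _ \o _ = q)//; apply/funext => x /=; rewrite fineK.
apply: ae_eq_integral => //.
- by apply/measurable_EFinP; exact: measurableT_comp.
- have : ae_eq Q setT q (EFin \o f).
    apply: (null_dominates_ae_eq measurableT QP).
    apply: integral_ae_eq => //.
    + exact: Radon_Nikodym_integrable.
    + exact/measurable_EFinP.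
    + move=> E _ mE; rewrite -Radon_Nikodym_integral//; exact: Qf.
  move: (density_pos_ae hf); apply: filterS2 => x fx qf _.
  by rewrite (qf I) -[(EFin \o f) x]/((f x)%:E) lne_EFin.
Qed.

(** Since [- t ln t <= 1], the negative part of the entropy integrand is always
    integrable; hence a finite divergence makes the log-density integrable. *)
Lemma density_neg_log P f Q : has_density P f Q ->
  (\int[Q]_x (Num.max (- ln (f x)) 0)%:E <= 1)%E.
Proof.
move=> hf; have [mf f0 Qf] := hf.
have mm : measurable_fun setT (fun x => Num.max (- ln (f x)) 0).
  by apply: measurable_maxr => //; apply: measurableT_comp => //; exact: measurableT_comp.
rewrite (has_density_integral hf)//; last 2 first.
- exact/measurable_EFinP.
- by move=> x; rewrite lee_fin le_max lexx orbT.
rewrite -[leRHS](@probability_setT _ _ _ P) -[leRHS]mul1e -integral_cst//.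
apply: ge0_le_integral => //=.
- by move=> x _; rewrite -EFinM lee_fin mulr_ge0// le_max lexx orbT.
- by apply: emeasurable_funM; apply/measurable_EFinP.
move=> x _; rewrite -EFinM lee_fin.
have := f0 x; rewrite le_eqVlt => /predU1P[<-|fx]; first by rewrite mul0r.
rewrite maxEle; case: ifP => _; first by rewrite mulr0.
rewrite -lnV// (le_trans (ler_wpM2l (ltW fx) (ltW (ln_sublinear _))))//.
  by rewrite invr_gt0.
by rewrite mulfV ?gt_eqF.
Qed.

(** The case of equality in Gibbs' inequality: [exp t - 1 - t] is non-negative and
    vanishes at [0] only, and its integral under [Q] at [t = psi - ln f] is at most
    [0], so that [f = exp psi] almost everywhere under [Q]. Then [Q <= Q'], with
    equality as both have mass [1]. *)
Lemma entropy_le0_eq P f Q psi Q' : has_density P f Q -> bmeas psi ->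
  has_density P (fun x => expR (psi x)) Q' ->
  Q.-integrable setT (fun x => (ln (f x))%:E) ->
  \int[Q]_x ln (f x) <= Ex Q psi ->
  forall A, measurable A -> Q A = Q' A.
Proof.
move=> hf bpsi hf' intlf le A mA.
have [mf f0 Qf] := hf; have [me _ Q'e] := hf'.
pose h x := expR (psi x - ln (f x)).
have mh : measurable_fun setT h.
  apply: measurableT_comp => //; apply: measurable_funB; first exact: (proj1 bpsi).
  exact: measurableT_comp.
have h0 x : 0 <= h x by exact: expR_ge0.
have Ih : (\int[Q]_x (h x)%:E <= 1)%E.
  have mhE : measurable_fun setT (fun x => (h x)%:E) by exact/measurable_EFinP.
  have h0E x : (0 <= (h x)%:E)%E by rewrite lee_fin.
  rewrite (has_density_integral hf mhE h0E).
  rewrite -[leRHS](@probability_setT _ _ _ Q') Q'e//.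
  apply: ge0_le_integral => //=.
  - by move=> x _; rewrite -EFinM lee_fin mulr_ge0.
  - by apply: emeasurable_funM; apply/measurable_EFinP.
  - exact/measurable_EFinP.
  move=> x _; rewrite -EFinM lee_fin /h.
  have := f0 x; rewrite le_eqVlt => /predU1P[<-|fx]; first by rewrite mul0r expR_ge0.
  by rewrite expRB lnK ?posrE// mulrCA mulfV ?mulr1// gt_eqF.
have inth : Q.-integrable setT (EFin \o h).
  apply/integrableP; split; first exact/measurable_EFinP.
  under eq_integral do rewrite /= ger0_norm//.
  by rewrite (le_lt_trans Ih)// ltry.
have intpsi := bmeas_integrable Q bpsi.
pose G x := h x - 1 + (ln (f x) - psi x).
have int1 : Q.-integrable setT (EFin \o (fun=> 1 : R)) := bmeas_integrable Q (bmeas_cst _ _).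
have inth1 : Q.-integrable setT (EFin \o (fun x => h x - 1)).
  exact: (integrableB measurableT inth int1).
have intlp : Q.-integrable setT (EFin \o (fun x => ln (f x) - psi x)).
  exact: (integrableB measurableT intlf intpsi).
have intG : Q.-integrable setT (EFin \o G) by exact: (integrableD measurableT inth1 intlp).
have G0 : {ae Q, forall x, 0 <= G x /\ (G x = 0 -> f x = expR (psi x))}.
  apply: filterS (density_pos_ae hf) => x fx.
  have GE : G x = expR (psi x - ln (f x)) - (1 + (psi x - ln (f x))).
    by rewrite /G /h; ring.
  split; first by rewrite GE subr_ge0 expR_ge1Dx.
  have [l0 _|l0] := eqVneq (psi x - ln (f x)) 0; last first.
    by have := expR_gt1Dx l0; rewrite -subr_gt0 -GE => /gt_eqF/eqP.
  by move/eqP: l0; rewrite subr_eq0 => /eqP ->; rewrite lnK ?posrE.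
have IG : \int[Q]_x G x <= 0.
  rewrite /G RintegralD// RintegralB// RintegralB// Rintegral_cst//=.
  rewrite probability_setT/= mulr1.
  have : \int[Q]_x h x <= 1.
    rewrite -lee_fin /Rintegral fineK; first exact: Ih.
    exact: integrable_fin_num inth.
  by move: le; rewrite /Ex; lra.
have G0ae : ae_eq Q setT (EFin \o G) (cst 0%E).
  apply/ae_eq_integral_abs => //; first exact: measurable_int intG.
  apply/eqP; rewrite eq_le; apply/andP; split; last exact: integral_ge0.
  rewrite (_ : (\int[Q]_x _)%E = (\int[Q]_x (G x)%:E)%E); last first.
    apply: ae_eq_integral => //.
    - by apply: measurableT_comp => //; exact: measurable_int intG.
    - exact: measurable_int intG.
    - by apply: filterS G0 => x [Gx _] _; rewrite /= ger0_norm.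
  by rewrite -[leLHS]fineK ?lee_fin//; exact: integrable_fin_num intG.
have [N [mN N0 subN]] : {ae Q, forall x, f x = expR (psi x)}.
  apply: filterS2 G0 G0ae => x [_ Gf] Gx; apply: Gf.
  by have := Gx I => /= -[].
have Qle B : measurable B -> (Q B <= Q' B)%E.
  move=> mB; have mBN : measurable (B `\` N) by exact: measurableD.
  apply: (@le_trans _ _ (Q (B `\` N))).
    rewrite -[leRHS]adde0 -N0 (le_trans _ (measureU2 _ _ _))//.
    apply: le_measure; rewrite ?inE//; first exact: measurableU.
    by move=> x Bx; have [Nx|Nx] := pselect (N x); [right|left].
  have -> : Q (B `\` N) = Q' (B `\` N).
    rewrite Qf// Q'e//; apply: eq_integral => x; rewrite inE => -[_ Nx].
    by congr EFin; apply: contrapT => fx; exact/Nx/subN.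
  by apply: le_measure; rewrite ?inE// => x [].
have fQ : Q A = (fine (Q A))%:E by rewrite fineK// fin_num_measure.
have fQ' : Q' A = (fine (Q' A))%:E by rewrite fineK// fin_num_measure.
have := Qle _ (measurableC mA); have := Qle _ mA.
rewrite !probability_setC// fQ fQ' -!EFinB !lee_fin => h1 h2.
by congr EFin; apply/eqP; rewrite eq_le h1/=; lra.
Qed.

End relative_entropy.

(** * Integrability and entropy under product laws *)
Section integrable_functions.
Context d (T : measurableType d) (R : realType) (P : probability T R).
Implicit Types f g : T -> R.

(** Log-densities and the entries of the design are unbounded, so their expectations
    carry a genuine integrability condition. *)
Definition Pint f : Prop := P.-integrable setT (EFin \o f).

Lemma Pint_bmeas f : bmeas f -> Pint f.
Proof. exact: bmeas_integrable. Qed.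

Lemma Pint_measurable f : Pint f -> measurable_fun setT f.
Proof. by move=> /measurable_int /measurable_EFinP. Qed.

Lemma Pint_cst (c : R) : Pint (fun=> c).
Proof. exact/Pint_bmeas/bmeas_cst. Qed.

Lemma PintD f g : Pint f -> Pint g -> Pint (fun x => f x + g x).
Proof. exact: integrableD. Qed.

Lemma PintB f g : Pint f -> Pint g -> Pint (fun x => f x - g x).
Proof. exact: integrableB. Qed.

Lemma PintZ c f : Pint f -> Pint (fun x => c * f x).
Proof. exact: integrableZl. Qed.

Lemma Pint_sum (I : Type) (s : seq I) (F : I -> T -> R) :
  (forall i, Pint (F i)) -> Pint (fun x => \sum_(i <- s) F i x).
Proof.
move=> bF; elim: s => [|i s IH].
  by under eq_fun do rewrite big_nil; exact: Pint_cst.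
by under eq_fun do rewrite big_cons; exact: PintD.
Qed.

Lemma Pint_le f g : measurable_fun setT f -> (forall x, `|f x| <= g x) ->
  Pint g -> Pint f.
Proof.
move=> mf fg ig; apply: (le_integrable _ _ _ ig) => //; first exact/measurable_EFinP.
by move=> x _ /=; rewrite lee_fin (le_trans (fg x)) ?ler_norm.
Qed.

Lemma Pint_norm f : Pint f -> Pint (fun x => `|f x|).
Proof. exact: integrable_norm. Qed.

Lemma Pint_ge0 f : measurable_fun setT f -> (forall x, 0 <= f x) ->
  (\int[P]_x (f x)%:E < +oo)%E -> Pint f.
Proof.
move=> mf f0 foo; apply/integrableP; split; first exact/measurable_EFinP.
by under eq_integral do rewrite /= ger0_norm//.
Qed.

Lemma Ex_addP f g : Pint f -> Pint g ->
  Ex P (fun x => f x + g x) = Ex P f + Ex P g.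
Proof. by move=> *; exact: RintegralD. Qed.

Lemma Ex_subP f g : Pint f -> Pint g ->
  Ex P (fun x => f x - g x) = Ex P f - Ex P g.
Proof. by move=> *; exact: RintegralB. Qed.

Lemma Ex_scaleP c f : Pint f -> Ex P (fun x => c * f x) = c * Ex P f.
Proof. by move=> *; exact: RintegralZl. Qed.

Lemma Ex_sumP (I : Type) (s : seq I) (F : I -> T -> R) : (forall i, Pint (F i)) ->
  Ex P (fun x => \sum_(i <- s) F i x) = \sum_(i <- s) Ex P (F i).
Proof.
move=> bF; elim: s => [|i s IH].
  by under eq_fun do rewrite big_nil; rewrite Ex_cst big_nil.
under eq_fun do rewrite big_cons.
by rewrite big_cons Ex_addP// ?IH//; exact: Pint_sum.
Qed.

Lemma le_ExP f g : Pint f -> Pint g -> (forall x, f x <= g x) -> Ex P f <= Ex P g.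
Proof. by move=> *; exact: le_Rintegral. Qed.

Lemma EFin_ExP f : Pint f -> (Ex P f)%:E = (\int[P]_x (f x)%:E)%E.
Proof. by move=> jf; rewrite /Ex /Rintegral fineK//; exact: (integrable_fin_num _ jf). Qed.

End integrable_functions.

Section product_integrals.
Context d (T : measurableType d) (R : realType) (p : nat).
Variable Q : 'I_p -> probability T R.
Implicit Types (i : 'I_p).

Lemma integral_prod_coord i (F : T -> \bar R) : measurable_fun setT F ->
  (\int[prod_prob Q]_b F (tnth b i) = \int[Q i]_x F x)%E.
Proof.
move=> mF.
have hp := prod_prob_coord Q i (measurable_funepos mF) (fun x => funepos_ge0 F x).
have hn := prod_prob_coord Q i (measurable_funeneg mF) (fun x => funeneg_ge0 F x).
rewrite integralE [RHS]integralE -hp -hn; congr (_ - _)%E.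
- by apply: eq_integral => b _; rewrite !funeposE.
- by apply: eq_integral => b _; rewrite !funenegE.
Qed.

Lemma Pint_prod_coord i (f : T -> R) : measurable_fun setT f ->
  Pint (prod_prob Q) (fun b => f (tnth b i)) <-> Pint (Q i) f.
Proof.
move=> mf; have mfE : measurable_fun setT (fun x => `|(f x)%:E|%E).
  by apply: measurableT_comp => //; exact/measurable_EFinP.
have E : (\int[prod_prob Q]_b `|(f (tnth b i))%:E| = \int[Q i]_x `|(f x)%:E|)%E.
  exact: (@prod_prob_coord _ _ _ _ Q i (fun x => `|(f x)%:E|%E)).
split=> /integrableP[m h]; apply/integrableP; split.
- exact/measurable_EFinP.
- by rewrite /= -E.
- apply/measurable_EFinP; apply: measurableT_comp => //; exact: measurable_tnth.
- by rewrite /= E.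
Qed.

Lemma Ex_prod_coordP i (f : T -> R) : measurable_fun setT f ->
  Ex (prod_prob Q) (fun b => f (tnth b i)) = Ex (Q i) f.
Proof.
move=> mf; rewrite /Ex /Rintegral (@integral_prod_coord i (EFin \o f))//.
exact/measurable_EFinP.
Qed.

End product_integrals.

Section product_entropy.
Context d (T : measurableType d) (R : realType) (p : nat).
Variables (mu : probability T R) (H : p.-tuple T -> R) (P : probability (p.-tuple T) R).
Hypothesis bH : bmeas H.
Hypothesis PH : forall B, measurable B ->
  P B = (\int[iid_prob p mu]_(b in B) (expR (H b))%:E)%E.
Implicit Type Q : 'I_p -> probability T R.

Let hP : has_density (iid_prob p mu) (fun b => expR (H b)) P.
Proof. by split => //; exact: (proj1 (bmeas_expR bH)). Qed.

Let prod_probE Q j A : measurable A -> prod_prob Q (tcoord j @^-1` A) = Q j A.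
Proof. exact: (@marginal_prod_prob _ _ _ p Q j A). Qed.

Lemma prod_dominates_coord Q j : prod_prob Q `<< P -> Q j `<< mu.
Proof.
move=> QP; apply/null_content_dominatesP => A mA muA.
have mB : measurable (tcoord j @^-1` A).
  by rewrite -[X in measurable X]setTI; exact: measurable_tnth.
have /null_content_dominatesP PQ := null_dominates_trans QP (has_density_dominates hP).
rewrite -(prod_probE Q)//; apply: PQ => //.
by rewrite -[RHS]muA; exact: (prod_probE (fun _ : 'I_p => mu)).
Qed.

Section densities.
Variables (Q : 'I_p -> probability T R) (f : 'I_p -> T -> R).
Hypothesis Qf : forall j, has_density mu (f j) (Q j).

Let mf j : measurable_fun setT (f j). Proof. by case: (Qf j). Qed.
Let f0 j x : 0 <= f j x. Proof. by case: (Qf j). Qed.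
Let mt j : measurable_fun setT (fun b : p.-tuple T => tnth b j).
Proof. exact: measurable_tnth. Qed.

(** The Gibbs weight is positive, so densities with respect to the product prior and
    with respect to [P] differ by the factor [exp (- H)]. *)
Lemma prod_has_density : has_density P
  (fun b => (\prod_(j < p) f j (tnth b j)) * expR (- H b)) (prod_prob Q).
Proof.
have mp : measurable_fun setT (fun b : p.-tuple T => \prod_(j < p) f j (tnth b j)).
  apply: measurable_prod => j _; exact: measurableT_comp.
have me : measurable_fun setT (fun b => expR (- H b)).
  exact: (proj1 (bmeas_expR (bmeasN bH))).
have p0 b : 0 <= (\prod_(j < p) f j (tnth b j)) * expR (- H b).
  by rewrite mulr_ge0 ?expR_ge0// prodr_ge0.
split => //; first exact: measurable_funM.
move=> A mA.
have mi : measurable_fun setT (fun b : p.-tuple T => (\1_A b : R)%:E).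
  by apply/measurable_EFinP; exact: measurable_indic.
transitivity (\int[prod_prob Q]_b (\1_A b)%:E)%E; first by rewrite integral_indic// setIT.
rewrite (@prod_prob_density _ _ _ _ Q (fun=> mu) f mf f0 _ _ mi); last 2 first.
- by move=> i F mF F0; exact: has_density_integral (Qf i) mF F0.
- by move=> b; rewrite lee_fin.
rewrite [RHS]integral_mkcond (has_density_integral hP); last 2 first.
- apply/(measurable_restrictT _ _).1 => //.
  by apply/measurable_EFinP/measurable_funTS; exact: measurable_funM.
- by apply: erestrict_ge0 => b _; rewrite lee_fin.
apply: eq_integral => b _; rewrite patchE indicE.
case: (b \in A); last by rewrite !mule0.
rewrite -!EFinM; congr EFin; rewrite mulr1 mulrCA -expRD subrr expR0 mulr1//.
Qed.

Let n j x := Num.max (- ln (f j x)) 0.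
Let lf j x := ln (f j x).
Let mlf j : measurable_fun setT (lf j).
Proof. exact: measurableT_comp. Qed.
Let N (b : p.-tuple T) := \sum_j n j (tnth b j).

Let mn j : measurable_fun setT (n j).
Proof. by apply: measurable_maxr => //; apply: measurableT_comp => //; exact: mlf. Qed.

Let n0 j x : 0 <= n j x. Proof. by rewrite le_max lexx orbT. Qed.

Let intN : Pint (prod_prob Q) N.
Proof.
apply: Pint_sum => j; apply/(Pint_prod_coord Q j (mn j))/Pint_ge0 => //.
by rewrite (le_lt_trans (density_neg_log (Qf j)))// ltry.
Qed.

Let W b := \sum_j lf j (tnth b j) - H b.

Let mW : measurable_fun setT W.
Proof.
apply: measurable_funB; last exact: (proj1 bH).
by apply: measurable_sum => j; exact: measurableT_comp.
Qed.

Lemma dKL_prodE : dKL (prod_prob Q) P =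
  (\int[prod_prob Q]_b (\sum_j ln (f j (tnth b j)) - H b)%:E)%E.
Proof.
rewrite (dKL_density prod_has_density); apply: ae_eq_integral => //.
- apply/measurable_EFinP; apply: measurableT_comp => //.
  by case: prod_has_density.
- exact/measurable_EFinP.
apply: filterS (density_pos_ae prod_has_density) => b Fb _; congr EFin.
have Pb : 0 < \prod_(j < p) f j (tnth b j).
  by move: Fb; rewrite pmulr_lgt0 ?expR_gt0.
have fb j : 0 < f j (tnth b j).
  rewrite lt_neqAle f0 andbT; apply/eqP => fj.
  by move: Pb; rewrite (bigD1 j)//= -fj mul0r ltxx.
rewrite lnM ?posrE ?expR_gt0// expRK; congr (_ - _).
rewrite (eq_bigr (fun j => expR (ln (f j (tnth b j))))) -?expR_sum ?expRK// => j _.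
by rewrite lnK ?posrE.
Qed.

(** The negative parts of the log-densities are integrable by [density_neg_log]. If
    the divergence is finite, so is the integral of the positive part of the sum [W];
    each log-density then lies between two integrable functions. *)
Lemma dKL_finite_log_density : (dKL (prod_prob Q) P < +oo)%E ->
  forall j, Pint (Q j) (fun x => ln (f j x)).
Proof.
rewrite dKL_prodE => Wfin j; have [_ [C HC]] := bH.
have C0 : 0 <= `|C| by [].
have nx k b : - n k (tnth b k) <= lf k (tnth b k) by rewrite lerNl le_max lexx.
have N0 b : 0 <= N b by apply: sumr_ge0.
have nN k b : n k (tnth b k) <= N b.
  by rewrite /N (bigD1 k)//= lerDl sumr_ge0.
have HC' b : `|H b| <= `|C| by rewrite (le_trans (HC b)) ?ler_norm.
have WN b : - (N b + `|C|) <= W b.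
  rewrite /W opprD lerD//; last by rewrite lerN2 (le_trans (ler_norm _)).
  by rewrite /N -sumrN ler_sum.
have intNC : Pint (prod_prob Q) (fun b => N b + `|C|) by apply: PintD => //; exact: Pint_cst.
pose Wp b := W b + (N b + `|C|).
have intW : Pint (prod_prob Q) W.
  have mWE : measurable_fun setT (EFin \o W) by exact/measurable_EFinP.
  have Wneg : (\int[prod_prob Q]_b (EFin \o W)^\- b < +oo)%E.
    apply: (@le_lt_trans _ _ (\int[prod_prob Q]_b (N b + `|C|)%:E)%E); last first.
      by rewrite -(EFin_ExP intNC) ltry.
    apply: ge0_le_integral => //.
    - exact: measurable_funeneg.
    - by apply/measurable_EFinP; exact: (Pint_measurable intNC).
    move=> b _; rewrite funenegE /= -EFin_max lee_fin ge_max addr_ge0// andbT.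
    by rewrite lerNl.
  apply/integrableP; split => //.
  rewrite (_ : (fun b => _) = (fun b => (EFin \o W)^\+ b + (EFin \o W)^\- b)%E); last first.
    by apply/funext => b; rewrite -/((abse \o (EFin \o W)) b) fune_abse.
  rewrite ge0_integralD//; [|exact: measurable_funepos|exact: measurable_funeneg].
  rewrite lte_add_pinfty//.
  have Wneg_fin : (\int[prod_prob Q]_b (EFin \o W)^\- b \is a fin_num)%E.
    by rewrite ge0_fin_numE// integral_ge0.
  rewrite ltNge leye_eq; apply/eqP => Wpos.
  by move: Wfin; rewrite (integralE _ _ (EFin \o W)) Wpos -(fineK Wneg_fin).
have mlj := mlf j.
apply/(Pint_prod_coord Q j mlj); apply: (@Pint_le _ _ _ _ _
  (fun b => `|W b| + `|C| + (N b + N b))).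
- exact: measurableT_comp.
- move=> b.
  have S_le : `|\sum_k lf k (tnth b k)| <= `|W b| + `|C|.
    rewrite (_ : \sum_k _ = W b + H b); last by rewrite /W subrK.
    by rewrite (le_trans (ler_normD _ _))// lerD2l.
  have rest_le : - N b <= \sum_(k | k != j) lf k (tnth b k).
    rewrite /N (bigD1 j)//= opprD -[leRHS]add0r lerD//.
      by rewrite oppr_le0.
    by rewrite -sumrN ler_sum.
  have Nb0 := N0 b; have W0 := normr_ge0 (W b); have CC := normr_ge0 C.
  have := nx j b; have := nN j b; move: S_le rest_le.
  rewrite (bigD1 j)//=; set x := lf j _; set S := \sum_(k | k != j) _.
  rewrite ler_norml => /andP[_ S_le] rest_le n_le x_ge.
  by rewrite ler_norml; apply/andP; split; lra.
- apply: PintD; last exact: PintD.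
  by apply: PintD; [exact: Pint_norm|exact: Pint_cst].
Qed.

Lemma dKL_prod_fin : (forall j, Pint (Q j) (fun x => ln (f j x))) ->
  dKL (prod_prob Q) P =
  (\sum_j Ex (Q j) (fun x => ln (f j x)) - Ex (prod_prob Q) H)%:E.
Proof.
move=> ilf.
have ic j : Pint (prod_prob Q) (fun b => lf j (tnth b j)).
  by apply/Pint_prod_coord => //; exact: mlf.
have iS : Pint (prod_prob Q) (fun b => \sum_j lf j (tnth b j)) by exact: Pint_sum.
rewrite dKL_prodE -EFin_ExP; last by apply: PintB => //; exact: Pint_bmeas.
rewrite Ex_subP//; last exact: Pint_bmeas.
rewrite Ex_sumP//; congr (_ - _)%:E; apply: eq_bigr => j _.
exact: (Ex_prod_coordP Q j (mlf j)).
Qed.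

End densities.
End product_entropy.

Lemma eq_law_Ex d (T : measurableType d) (R : realType) (P Q : probability T R)
    (f : T -> R) : (forall A, measurable A -> P A = Q A) -> Ex P f = Ex Q f.
Proof.
move=> PQ; rewrite /Ex /Rintegral; congr fine.
by apply: eq_measure_integral => A mA _; exact: PQ.
Qed.

(** * Stationarity of the minimizers *)
Section mean_field_stationarity.
Context d (T : measurableType d) (R : realType) (p : nat).
Variables (mu : probability T R) (A : 'M[R]_p) (kap : T -> R).
Variables (phi : 'I_p -> T -> R) (h0 : R) (P : probability (p.-tuple T) R).
Hypotheses (bkap : bmeas kap) (kap1 : forall x, `|kap x| <= 1).
Hypothesis bphi : forall i, bmeas (phi i).
Hypotheses (symA : A^T = A) (diagA : forall i, A i i = 0).
Local Notation H := (hamiltonian A kap phi h0).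
Hypothesis PH : forall B, measurable B ->
  P B = (\int[iid_prob p mu]_(b in B) (expR (H b))%:E)%E.
Variables (Q : 'I_p -> probability T R) (i : 'I_p).
Let s := \sum_j A i j * Ex (Q j) kap.
Let z := Ex mu (fun x => expR (s * kap x + phi i x)).

Definition site_update (tau : probability T R) j := if j == i then tau else Q j.

Definition site_log_density x := s * kap x + phi i x - ln z.

Let z0 : 0 < z. Proof. exact: Ex_weight_gt0. Qed.

Let bpsi : bmeas site_log_density.
Proof.
apply: bmeasB; last exact: bmeas_cst.
by apply: bmeasD => //; apply: bmeasM => //; exact: bmeas_cst.
Qed.

Let expR_psi x : expR (site_log_density x) = expR (s * kap x + phi i x) / z.
Proof. by rewrite expRB lnK. Qed.

(* The field at [i] does not involve coordinate [i] and has mean [s] under every law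
   that agrees with [prod_prob Q] off [i]. *)
Let energy (Q' : 'I_p -> probability T R) : (forall j, j != i -> Q' j = Q j) ->
  Ex (prod_prob Q') H = Ex (Q' i) (fun x => s * kap x + phi i x) +
  Ex (prod_prob Q) (rest_energy A kap phi h0 i).
Proof.
move=> Q'Q; have bH := @bmeas_hamiltonian _ _ _ _ A _ _ h0 bkap bphi.
rewrite (Ex_resample Q'Q bH).
have bm : bmeas (lfield A kap i) by exact: bmeas_lfield.
have br : bmeas (rest_energy A kap phi h0 i).
  apply: bmeasB; last exact: bmeas_tnth.
  by apply: bmeasB => //; apply: bmeasM => //; exact: bmeas_tnth.
rewrite (_ : (fun b => Ex (Q' i) _) = (fun b => Ex (Q' i) kap * lfield A kap i b +
   Ex (Q' i) (phi i) + rest_energy A kap phi h0 i b)); last first.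
  apply/funext => b.
  rewrite (_ : (fun x => H (upd b i x)) =
    (fun x => lfield A kap i b * kap x + phi i x + rest_energy A kap phi h0 i b)).
    rewrite ExD ?Ex_cst; [|by apply: bmeasD => //; apply: bmeasM => //; exact: bmeas_cst
                          |exact: bmeas_cst].
    by rewrite ExD ?ExZ// 1?mulrC//; apply: bmeasM => //; exact: bmeas_cst.
  by apply/funext => x; rewrite hamiltonian_upd.
have bc (c : R) := @bmeas_cst _ (p.-tuple T) R c.
have bc' (c : R) := @bmeas_cst _ T R c.
rewrite ExD//; last by apply: bmeasD => //; exact: bmeasM.
congr (_ + _); rewrite ExD//; last exact: bmeasM.
rewrite Ex_cst ExZ// [RHS]ExD//; last exact: bmeasM.
rewrite [in RHS]ExZ//; congr (_ + _); rewrite mulrC; congr (_ * _).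
rewrite /lfield Ex_sum; last first.
  by move=> j; apply: bmeasM => //; exact: bmeas_tnth.
by apply: eq_bigr => j _; rewrite ExZ ?Ex_prod_coord//; exact: bmeas_tnth.
Qed.

(** When the factor [Q i] alone varies, the divergence is the relative entropy of
    [Q i] with respect to the law of log-density [site_log_density], up to a constant.
    Comparison with that law therefore gives the hypothesis of [entropy_le0_eq].
    It is the one competitor considered, so that a constraint on the supports of the
    factors only has to be checked for it. *)
Lemma mean_field_stationary :
  (dKL (prod_prob Q) P < +oo)%E ->
  (forall tau, has_density mu (fun x => expR (site_log_density x)) tau ->
     (dKL (prod_prob Q) P <= dKL (prod_prob (site_update tau)) P)%E) ->
  forall f, bmeas f -> Ex (Q i) f = tilt mu kap (phi i) s f.
Proof.
move=> Qfin Qmin f bf.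
have bH := @bmeas_hamiltonian _ _ _ _ A _ _ h0 bkap bphi.
have [tau htau] : exists tau : probability T R,
    has_density mu (fun x => expR (site_log_density x)) tau.
  have bw : bmeas (fun x => s * kap x + phi i x).
    by apply: bmeasD => //; apply: bmeasM => //; exact: bmeas_cst.
  have [tau tauE] := tilted_law_exists mu bw; exists tau; split.
  - exact: (proj1 (bmeas_expR bpsi)).
  - by move=> x; exact: expR_ge0.
  - move=> B mB; rewrite tauE//; apply: eq_integral => x _.
    by rewrite expR_psi.
have QP : prod_prob Q `<< P.
  by move: Qfin; rewrite /dKL; case: pselect.
have /choice[g hg] : forall j, exists g, has_density mu g (Q j).
  by move=> j; apply: dominates_density; exact: (prod_dominates_coord bH PH).
have ig := dKL_finite_log_density bH PH hg Qfin.
pose g' j := if j == i then (fun x => expR (site_log_density x)) else g j.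
have hg' j : has_density mu (g' j) (site_update tau j).
  by rewrite /g' /site_update; case: eqP.
have ig' j : Pint (site_update tau j) (fun x => ln (g' j x)).
  rewrite /g' /site_update; case: eqP => // _.
  by under eq_fun do rewrite expRK; exact: Pint_bmeas.
have := Qmin _ htau.
rewrite (dKL_prod_fin bH PH hg ig) (dKL_prod_fin bH PH hg' ig') lee_fin.
rewrite (@energy Q)// (@energy (site_update tau)); last first.
  by move=> j /negbTE ji; rewrite /site_update ji.
have psiE (Q' : probability T R) : Ex Q' site_log_density =
    Ex Q' (fun x => s * kap x + phi i x) - ln z.
  rewrite /site_log_density ExB ?Ex_cst//; last exact: bmeas_cst.
  by apply: bmeasD => //; apply: bmeasM => //; exact: bmeas_cst.
have -> : \sum_j Ex (site_update tau j) (fun x => ln (g' j x)) =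
    Ex tau site_log_density + \sum_(j | j != i) Ex (Q j) (fun x => ln (g j x)).
  rewrite (bigD1 i)//= {1}/site_update {1}/g' eqxx; congr (_ + _).
    by congr Ex; apply/funext => x; rewrite expRK.
  by apply: eq_bigr => j /negbTE ji; rewrite /site_update /g' ji.
rewrite (bigD1 i)//= /site_update eqxx psiE => ineq.
have lQ : \int[Q i]_x ln (g i x) <= Ex (Q i) site_log_density.
  by rewrite psiE; move: ineq; rewrite /Ex; lra.
rewrite (eq_law_Ex _ (entropy_le0_eq (hg i) bpsi htau (ig i) lQ)).
have [me e0 tauE] := htau.
rewrite (Ex_density (bmeas_expR bpsi) e0 tauE)// /tilt -/z.
rewrite (_ : (fun x => _) = (fun x => z^-1 * (f x * expR (s * kap x + phi i x)))).
  by rewrite ExZ 1?mulrC//; apply: bmeasM => //; exact: bmeas_weight.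
by apply/funext => x; rewrite expR_psi; ring.
Qed.

End mean_field_stationarity.

(** * Moments under product laws *)
Section all_moments.
Context d (T : measurableType d) (R : realType) (P : probability T R).
Implicit Types f g : T -> R.

(** This class is closed under sums and products, hence contains the polynomials in
    the entries of a design with sub-Gaussian entries. *)
Definition all_moments f : Prop := measurable_fun setT f /\
  forall k : nat, Pint P (fun x => `|f x| ^+ k).

Lemma all_moments_Pint f : all_moments f -> Pint P f.
Proof.
move=> [mf /(_ 1%N) h]; apply: (Pint_le mf) h => x; by rewrite expr1.
Qed.

Lemma all_moments_bmeas f : bmeas f -> all_moments f.
Proof.
move=> bf; split; first exact: (proj1 bf).
by move=> k; apply/Pint_bmeas/bmeasX/bmeas_norm.
Qed.

Lemma all_moments_cst (c : R) : all_moments (fun=> c).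
Proof. exact/all_moments_bmeas/bmeas_cst. Qed.

Let mX f k : measurable_fun setT f -> measurable_fun setT (fun x => `|f x| ^+ k).
Proof. by move=> mf; apply: measurable_funX; exact: measurableT_comp. Qed.

Lemma all_momentsM f g : all_moments f -> all_moments g ->
  all_moments (fun x => f x * g x).
Proof.
move=> [mf hf] [mg hg]; split; first exact: measurable_funM.
move=> k; apply: (@Pint_le _ _ _ _ _ (fun x => `|f x| ^+ (k * 2) + `|g x| ^+ (k * 2))).
- exact/mX/measurable_funM.
- move=> x; rewrite ger0_norm ?exprn_ge0// normrM exprMn !exprM.
  by have := sqr_ge0 (`|f x| ^+ k - `|g x| ^+ k);
     have := sqr_ge0 (`|f x| ^+ k + `|g x| ^+ k); nra.
- exact: PintD.
Qed.

Lemma all_momentsD f g : all_moments f -> all_moments g ->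
  all_moments (fun x => f x + g x).
Proof.
move=> [mf hf] [mg hg]; split; first exact: measurable_funD.
move=> k; apply: (@Pint_le _ _ _ _ _ (fun x => 2 ^+ k * (`|f x| ^+ k + `|g x| ^+ k))).
- exact/mX/measurable_funD.
- move=> x; rewrite ger0_norm ?exprn_ge0//.
  wlog fg : f g mf hf mg hg / `|f x| <= `|g x|.
    move=> h; have [fg|/ltW gf] := leP `|f x| `|g x|; first exact: h.
    by rewrite addrC [_ ^+ k + _]addrC; exact: h.
  apply: (@le_trans _ _ ((2 * `|g x|) ^+ k)).
    rewrite lerXn2r ?nnegrE ?mulr_ge0// (le_trans (ler_normD _ _))//.
    by rewrite mulr2n mulrDl !mul1r lerD.
  by rewrite exprMn ler_wpM2l ?exprn_ge0// lerDr exprn_ge0.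
- by apply: PintZ; exact: PintD.
Qed.

Lemma all_momentsZ c f : all_moments f -> all_moments (fun x => c * f x).
Proof. by move=> hf; apply: all_momentsM => //; exact: all_moments_cst. Qed.

Lemma all_momentsX f k : all_moments f -> all_moments (fun x => f x ^+ k).
Proof.
move=> hf; elim: k => [|k IH].
  by under eq_fun do rewrite expr0; exact: all_moments_cst.
by under eq_fun do rewrite exprS; exact: all_momentsM.
Qed.

Lemma all_moments_sum (I : Type) (s : seq I) (C : pred I) (F : I -> T -> R) :
  (forall i, all_moments (F i)) -> all_moments (fun x => \sum_(i <- s | C i) F i x).
Proof.
move=> bF; elim: s => [|i s IH].
  by under eq_fun do rewrite big_nil; exact: all_moments_cst.
under eq_fun do rewrite big_cons.
by case: (C i) => //; exact: all_momentsD.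
Qed.

End all_moments.

Section independence.
Context d (T : measurableType d) (R : realType) (p : nat).
Variable Q : 'I_p -> probability T R.
Local Notation PQ := (prod_prob Q).

Lemma all_moments_coord i (f : T -> R) : all_moments (Q i) f ->
  all_moments PQ (fun b => f (tnth b i)).
Proof.
move=> [mf hf]; split; first by apply: measurableT_comp => //; exact: measurable_tnth.
move=> k; apply/(@Pint_prod_coord _ _ _ _ Q i (fun x => `|f x| ^+ k)) => //.
by apply: measurable_funX; exact: measurableT_comp.
Qed.

Let ge0_coord_mul i (f : T -> R) (g : p.-tuple T -> R) :
  measurable_fun setT f -> measurable_fun setT g -> (forall x, 0 <= f x) ->
  (forall b, 0 <= g b) -> off_coord i g ->
  (\int[PQ]_b (f (tnth b i) * g b)%:E =
   (\int[Q i]_x (f x)%:E) * \int[PQ]_b (g b)%:E)%E.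
Proof.
move=> mf mg f0 g0 goff.
have mfg : measurable_fun setT (fun b => (f (tnth b i) * g b)%:E).
  apply/measurable_EFinP; apply: measurable_funM => //.
  by apply: measurableT_comp => //; exact: measurable_tnth.
rewrite (@ge0_resample _ _ _ _ Q Q i)//; last by move=> b; rewrite lee_fin mulr_ge0.
transitivity (\int[PQ]_b ((\int[Q i]_x (f x)%:E) * (g b)%:E))%E.
  apply: eq_integral => b _; under eq_integral do rewrite tnth_upd eqxx goff EFinM.
  rewrite ge0_integralZr ?lee_fin//; [exact/measurable_EFinP|by move=> x _; rewrite lee_fin].
rewrite ge0_integralZl//; [exact/measurable_EFinP|by move=> b _; rewrite lee_fin|].
by apply: integral_ge0 => x _; rewrite lee_fin.
Qed.

Lemma Pint_coord_mul i (f : T -> R) (g : p.-tuple T -> R) :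
  off_coord i g -> Pint (Q i) f -> Pint PQ g ->
  Pint PQ (fun b => f (tnth b i) * g b).
Proof.
move=> goff jf jg; have mf := Pint_measurable jf; have mg := Pint_measurable jg.
have mft : measurable_fun setT (fun b : p.-tuple T => f (tnth b i)).
  by apply: measurableT_comp => //; exact: measurable_tnth.
apply/integrableP; split; first by apply/measurable_EFinP; exact: measurable_funM.
under eq_integral do rewrite /= normrM.
rewrite (ge0_coord_mul (f := fun x => `|f x|) (g := fun b => `|g b|))//; last 3 first.
- exact: measurableT_comp.
- exact: measurableT_comp.
- by move=> b x; rewrite goff.
by rewrite -!EFin_ExP ?ltry//; exact: Pint_norm.
Qed.

(** Independence for integrable factors of any sign, from the non-negative case by
    splitting both into positive and negative parts. *)
Lemma Ex_coord_mul i (f : T -> R) (g : p.-tuple T -> R) :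
  off_coord i g -> Pint (Q i) f -> Pint PQ g ->
  Ex PQ (fun b => f (tnth b i) * g b) = Ex (Q i) f * Ex PQ g.
Proof.
move=> goff jf jg; have mf := Pint_measurable jf; have mg := Pint_measurable jg.
pose pos (U : Type) (h : U -> R) x := Num.max (h x) 0.
pose neg (U : Type) (h : U -> R) x := Num.max (- h x) 0.
have posneg U (h : U -> R) x : h x = pos U h x - neg U h x.
  by rewrite /pos /neg !maxEle oppr_le0; case: leP => h1; case: leP => h2; lra.
have le_pos U (h : U -> R) x : `|pos U h x| <= `|h x|.
  rewrite /pos maxEle; case: ifP => _; rewrite ?normr0//.
have le_neg U (h : U -> R) x : `|neg U h x| <= `|h x|.
  rewrite /neg maxEle; case: ifP => _; rewrite ?normr0// normrN//.
have pos0 U (h : U -> R) x : 0 <= pos U h x by rewrite le_max lexx orbT.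
have neg0 U (h : U -> R) x : 0 <= neg U h x by rewrite le_max lexx orbT.
have ipos d' (U : measurableType d') (m : probability U R) (h : U -> R) :
    Pint m h -> Pint m (pos U h).
  move=> jh; apply: (Pint_le _ (le_pos U h) (Pint_norm jh)).
  by apply: measurable_maxr => //; exact: Pint_measurable jh.
have ineg d' (U : measurableType d') (m : probability U R) (h : U -> R) :
    Pint m h -> Pint m (neg U h).
  move=> jh; apply: (Pint_le _ (le_neg U h) (Pint_norm jh)).
  apply: measurable_maxr => //; apply: measurableT_comp => //.
  exact: Pint_measurable jh.
have ge0 f' g' : Pint (Q i) f' -> Pint PQ g' -> (forall x, 0 <= f' x) ->
    (forall b, 0 <= g' b) -> off_coord i g' ->
    Ex PQ (fun b => f' (tnth b i) * g' b) = Ex (Q i) f' * Ex PQ g'.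
  move=> jf' jg' f0 g0 g'off; apply: EFin_inj.
  have jfg := Pint_coord_mul g'off jf' jg'.
  rewrite EFinM (EFin_ExP jfg) (EFin_ExP jf') (EFin_ExP jg').
  by rewrite ge0_coord_mul//; [exact: Pint_measurable jf'|exact: Pint_measurable jg'].
have poff : off_coord i (pos _ g) by move=> b x; rewrite /pos goff.
have noff : off_coord i (neg _ g) by move=> b x; rewrite /neg goff.
rewrite (_ : (fun b => _) = (fun b =>
   (pos _ f (tnth b i) * pos _ g b - neg _ f (tnth b i) * pos _ g b) -
   (pos _ f (tnth b i) * neg _ g b - neg _ f (tnth b i) * neg _ g b))); last first.
  by apply/funext => b; rewrite {1}(posneg _ f) {1}(posneg _ g); ring.
have fE : Ex (Q i) f = Ex (Q i) (pos _ f) - Ex (Q i) (neg _ f).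
  by rewrite -Ex_subP; [congr Ex; apply/funext => x; exact: posneg|exact: ipos|exact: ineg].
have gE : Ex PQ g = Ex PQ (pos _ g) - Ex PQ (neg _ g).
  by rewrite -Ex_subP; [congr Ex; apply/funext => x; exact: posneg|exact: ipos|exact: ineg].
rewrite fE gE.
have i1 := ipos _ _ _ _ jf; have i2 := ineg _ _ _ _ jf.
have i3 := ipos _ _ _ _ jg; have i4 := ineg _ _ _ _ jg.
rewrite Ex_subP; [|by apply: PintB; exact: Pint_coord_mul..].
rewrite !Ex_subP; [|exact: Pint_coord_mul..].
rewrite !ge0//; ring.
Qed.

End independence.

(** * The Gram matrix of a random design *)
Definition offdiag_prod (R : realType) p (x : p.-tuple R) (i j : 'I_p) : R :=
  if i == j then 0 else tnth x i * tnth x j.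

Lemma offdiag_prodC (R : realType) p (x : p.-tuple R) i j :
  offdiag_prod x i j = offdiag_prod x j i.
Proof. by rewrite /offdiag_prod eq_sym mulrC. Qed.

Definition offdiag_square (R : realType) p (i j : 'I_p) (x : p.-tuple R) : R :=
  \sum_l offdiag_prod x i l * offdiag_prod x l j.

Section row_moments.
Context (R : realType) (p : nat) (rho : probability R R) (v w : R).
Hypotheses (mom : all_moments rho idfun) (v0 : 0 <= v).
Hypotheses (mean0 : Ex rho idfun = 0) (mean2 : Ex rho (fun z => z ^+ 2) = v).
Hypothesis mean8 : Ex rho (fun z => z ^+ 8) <= w.
Local Notation pi := (prod_prob (fun _ : 'I_p => rho)).
Local Notation y i j := (fun x : p.-tuple R => offdiag_prod x i j).

Let momc i : all_moments pi (fun x : p.-tuple R => tnth x i).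
Proof. exact: (all_moments_coord (Q := fun=> rho) (i := i) mom). Qed.

Lemma offdiag_moments i j : all_moments pi (y i j).
Proof.
rewrite /offdiag_prod; case: eqP => _; first exact: all_moments_cst.
exact: all_momentsM.
Qed.

Let momX k : all_moments rho (fun z => z ^+ k).
Proof. exact: (all_momentsX k mom). Qed.

Let off_tnth i j : j != i -> off_coord i (fun x : p.-tuple R => tnth x j).
Proof. by move=> /negbTE ji b x; rewrite tnth_upd ji. Qed.

Let indep i (g : p.-tuple R -> R) : off_coord i g -> all_moments pi g ->
  Ex pi (fun x => tnth x i * g x) = 0.
Proof.
move=> goff mg; rewrite (@Ex_coord_mul _ _ _ _ (fun=> rho) i idfun)//.
- by rewrite mean0 mul0r.
- exact: all_moments_Pint.
- exact: all_moments_Pint.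
Qed.

Lemma offdiag_mean0 i j : Ex pi (y i j) = 0.
Proof.
rewrite /offdiag_prod; case: eqVneq => [_|ij]; first exact: Ex_cst.
by apply: indep => //; apply: off_tnth; rewrite eq_sym.
Qed.

Lemma offdiag_sqr_mean i j : i != j -> Ex pi (fun x => y i j x ^+ 2) = v ^+ 2.
Proof.
move=> ij; rewrite /offdiag_prod (negbTE ij).
rewrite (_ : (fun x => _) = (fun x : p.-tuple R => tnth x i ^+ 2 * tnth x j ^+ 2)); last first.
  by apply/funext => x; rewrite exprMn.
rewrite (@Ex_coord_mul _ _ _ _ (fun=> rho) i (fun z => z ^+ 2)).
- have e := @Ex_prod_coordP _ _ _ _ (fun=> rho) j (fun z => z ^+ 2) (proj1 (momX 2)).
  by rewrite [X in _ * X = _]e mean2 expr2.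
- by move=> b x; rewrite off_tnth// eq_sym.
- exact: (all_moments_Pint (momX 2)).
- exact: (all_moments_Pint (all_momentsX 2 (momc j))).
Qed.

Local Notation C := (@offdiag_square R p).

Lemma offdiag_square_moments i j : all_moments pi (C i j).
Proof. by apply: all_moments_sum => l; apply: all_momentsM; exact: offdiag_moments. Qed.

(** For [i != j] every monomial of the entry has a centered factor of degree one. *)
Lemma offdiag_square_off i j : i != j -> Ex pi (C i j) = 0.
Proof.
move=> ij; rewrite /offdiag_square Ex_sumP; last first.
  by move=> l; apply: all_moments_Pint; apply: all_momentsM; exact: offdiag_moments.
rewrite big1// => l _; rewrite /offdiag_prod.
case: (eqVneq i l) => [_|il] /=; first by rewrite -[RHS](Ex_cst pi); congr Ex; apply/funext => x; rewrite mul0r.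
case: (eqVneq l j) => [_|lj] /=; first by rewrite -[RHS](Ex_cst pi); congr Ex; apply/funext => x; rewrite mulr0.
rewrite (_ : (fun x => _) = (fun x : p.-tuple R => tnth x i * (tnth x l ^+ 2 * tnth x j))); last first.
  by apply/funext => x; ring.
apply: indep; last by apply: all_momentsM => //; exact: all_momentsX.
by move=> b x; rewrite !off_tnth// eq_sym.
Qed.

Lemma offdiag_square_diag i : 0 <= Ex pi (C i i) <= p%:R * v ^+ 2.
Proof.
have CE x : C i i x = \sum_l offdiag_prod x i l ^+ 2.
  by apply: eq_bigr => l _; rewrite (offdiag_prodC x l).
apply/andP; split.
  by apply: Ex_ge0 => x; rewrite CE sumr_ge0// => l _; exact: sqr_ge0.
rewrite (_ : C i i = fun x => \sum_l y i l x ^+ 2); last by apply/funext => x; rewrite CE.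
rewrite Ex_sumP; last by move=> l; apply: all_moments_Pint; apply: all_momentsX; exact: offdiag_moments.
rewrite mulr_natl -[X in _ *+ X](card_ord p) -sumr_const ler_sum// => l _.
have [<-|il] := eqVneq i l; last by rewrite offdiag_sqr_mean.
rewrite (_ : (fun x => _) = fun=> 0); last first.
  by apply/funext => x; rewrite /offdiag_prod eqxx expr0n.
by rewrite Ex_cst sqr_ge0.
Qed.

Let sum_sqr_le (a : 'I_p -> R) : (\sum_i a i) ^+ 2 <= p%:R * \sum_i a i ^+ 2.
Proof.
have := cauchy_schwarz_sum (fun _ : 'I_p => 1) a.
rewrite (eq_bigr a); last by move=> i _; rewrite mul1r.
by rewrite expr1n sumr_const card_ord.
Qed.

(** Cauchy-Schwarz bounds the entry [C i j] by [|x i| |x j| |x|^2], hence the left side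
    by [|x|^8]; then compare power means. *)
Lemma offdiag_square_frobenius x :
  \sum_i \sum_j C i j x ^+ 2 <= p%:R ^+ 3 * \sum_i tnth x i ^+ 8.
Proof.
pose N := \sum_i tnth x i ^+ 2.
have N0 : 0 <= N by apply: sumr_ge0 => i _; exact: sqr_ge0.
have yrow i : \sum_l offdiag_prod x i l ^+ 2 <= tnth x i ^+ 2 * N.
  rewrite /N mulr_sumr ler_sum// => l _; rewrite /offdiag_prod.
  case: eqP => _; last by rewrite exprMn.
  by rewrite expr0n mulr_ge0// sqr_ge0.
have h1 : \sum_i \sum_j C i j x ^+ 2 <= N ^+ 4.
  apply: (@le_trans _ _ (\sum_i \sum_j (tnth x i ^+ 2 * N) * (tnth x j ^+ 2 * N))).
    apply: ler_sum => i _; apply: ler_sum => j _.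
    rewrite (le_trans (cauchy_schwarz_sum _ _))// ler_pM//.
    - by apply: sumr_ge0 => l _; exact: sqr_ge0.
    - by apply: sumr_ge0 => l _; exact: sqr_ge0.
    - by rewrite (eq_bigr (fun l => offdiag_prod x j l ^+ 2))// => l _; rewrite offdiag_prodC.
  under eq_bigr do rewrite -mulr_sumr.
  rewrite -mulr_suml -!mulr_suml -/N.
  by rewrite le_eqVlt; apply/orP; left; apply/eqP; ring.
have h2 : N ^+ 2 <= p%:R * \sum_i tnth x i ^+ 4.
  rewrite (le_trans (sum_sqr_le _))//.
  by under eq_bigr do rewrite -exprM.
have h3 : (\sum_i tnth x i ^+ 4) ^+ 2 <= p%:R * \sum_i tnth x i ^+ 8.
  rewrite (le_trans (sum_sqr_le _))//.
  by under eq_bigr do rewrite -exprM.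
rewrite (le_trans h1)// (_ : N ^+ 4 = (N ^+ 2) ^+ 2); last by rewrite -exprM.
apply: (@le_trans _ _ ((p%:R * \sum_i tnth x i ^+ 4) ^+ 2)).
  rewrite lerXn2r// nnegrE ?exprn_ge0// mulr_ge0// sumr_ge0// => i _.
  by rewrite (_ : 4 = 2 * 2)%N// exprM sqr_ge0.
by rewrite exprMn [p%:R ^+ 3]exprSr -mulrA ler_wpM2l// exprn_ge0.
Qed.

Lemma offdiag_square_frobenius_mean :
  Ex pi (fun x => \sum_i \sum_j C i j x ^+ 2) <= p%:R ^+ 4 * w.
Proof.
have m8 i : all_moments pi (fun x : p.-tuple R => tnth x i ^+ 8) by exact: all_momentsX.
have mS : all_moments pi (fun x : p.-tuple R => \sum_i tnth x i ^+ 8) by exact: all_moments_sum.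
apply: le_trans (le_ExP _ _ offdiag_square_frobenius) _.
- apply: all_moments_Pint; apply: all_moments_sum => i; apply: all_moments_sum => j.
  exact/all_momentsX/offdiag_square_moments.
- by apply: all_moments_Pint; exact: all_momentsZ.
rewrite Ex_scaleP; last exact: all_moments_Pint.
rewrite Ex_sumP; last by move=> i; exact: all_moments_Pint.
rewrite [p%:R ^+ 4]exprSr -mulrA ler_wpM2l ?exprn_ge0//.
rewrite mulr_natl -[X in _ *+ X](card_ord p) -sumr_const ler_sum// => i _.
have e := @Ex_prod_coordP _ _ _ _ (fun=> rho) i (fun z => z ^+ 8) (proj1 (momX 8)).
by rewrite [leLHS]e.
Qed.

End row_moments.

Section gram_matrix.
Context (R : realType) (n p : nat) (rho : probability R R) (v w : R).
Hypotheses (mom : all_moments rho idfun) (v0 : 0 <= v).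
Hypotheses (mean0 : Ex rho idfun = 0) (mean2 : Ex rho (fun z => z ^+ 2) = v).
Hypothesis mean8 : Ex rho (fun z => z ^+ 8) <= w.
Local Notation design := (n.-tuple (p.-tuple R)).
Local Notation row_law := (prod_prob (fun _ : 'I_p => rho)).
Local Notation D := (prod_prob (fun _ : 'I_n => row_law)).

(** Truncation to the first [m] rows lets the moments be computed by induction on
    [m]; the whole matrix is the case [m = n]. *)
Definition gram_part (m : nat) (i j : 'I_p) (X : design) : R :=
  \sum_(k < n | (k < m)%N) offdiag_prod (tnth X k) i j.

Definition gram_square m i j (X : design) : R :=
  \sum_l gram_part m i l X * gram_part m l j X.

(** The squared Frobenius norm of [W^2], for [W] the matrix [gram_part m]. It
    dominates the fourth power of the operator norm of [W] and the sum of the fourth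
    powers of the norms of its rows; unlike the Frobenius norm of [W], it is small in
    mean as soon as [p^3 << n^2]. *)
Definition gram_frobenius m (X : design) : R :=
  \sum_i \sum_j gram_square m i j X ^+ 2.

Lemma gram_partC m i j X : gram_part m i j X = gram_part m j i X.
Proof. by apply: eq_bigr => k _; rewrite offdiag_prodC. Qed.

Lemma gram_partS (k : 'I_n) i j X :
  gram_part k.+1 i j X = gram_part k i j X + offdiag_prod (tnth X k) i j.
Proof.
rewrite /gram_part (bigD1 k)//= addrC; congr (_ + _); apply: eq_bigl => l.
by rewrite ltnS [(l < k)%N]ltn_neqAle andbC -val_eqE.
Qed.

Lemma gram_part_off (k : 'I_n) i j : off_coord k (gram_part k i j).
Proof.
move=> X x; apply: eq_bigr => l lk; rewrite tnth_upd.
by case: eqP lk => // ->; rewrite ltnn.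
Qed.

Let rmom (k : 'I_n) i j : all_moments D (fun X => offdiag_prod (tnth X k) i j).
Proof.
exact: (all_moments_coord (Q := fun=> row_law) (i := k) (offdiag_moments mom i j)).
Qed.

Lemma gram_part_moments m i j : all_moments D (gram_part m i j).
Proof. by apply: all_moments_sum => k; exact: rmom. Qed.

Let gmom := gram_part_moments.

Lemma gram_square_moments m i j : all_moments D (gram_square m i j).
Proof. by apply: all_moments_sum => l; apply: all_momentsM; exact: gmom. Qed.

Let indep (k : 'I_n) (F : p.-tuple R -> R) (G : design -> R) :
  all_moments row_law F -> all_moments D G -> off_coord k G ->
  Ex D (fun X => F (tnth X k) * G X) = Ex row_law F * Ex D G.
Proof.
move=> mF mG Goff; apply: (@Ex_coord_mul _ _ _ _ (fun=> row_law)) => //.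
- exact: all_moments_Pint.
- exact: all_moments_Pint.
Qed.

Lemma gram_part_mean0 m i j : Ex D (gram_part m i j) = 0.
Proof.
rewrite /gram_part (_ : (fun X => _) = (fun X => \sum_(k < n)
   (if (k < m)%N then offdiag_prod (tnth X k) i j else 0))); last first.
  by apply/funext => X; rewrite -big_mkcond.
rewrite Ex_sumP.
  rewrite big1// => k _; case: (k < m)%N; last exact: Ex_cst.
  rewrite (@Ex_prod_coordP _ _ _ _ (fun=> row_law) k (fun x => offdiag_prod x i j)).
    exact: (offdiag_mean0 mom mean0).
  exact: (proj1 (offdiag_moments mom i j)).
move=> k; case: (k < m)%N; last exact: Pint_cst.
exact: all_moments_Pint.
Qed.

Lemma gram_part_mean2 m i j : (m <= n)%N ->
  Ex D (fun X => gram_part m i j X ^+ 2) <= m%:R * v ^+ 2.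
Proof.
elim: m => [|m IH] mn.
  rewrite (_ : (fun X => _) = fun=> 0) ?Ex_cst ?mul0r//.
  by apply/funext => X; rewrite /gram_part big_pred0_eq expr0n.
pose k := Ordinal mn.
rewrite (_ : (fun X => _) = (fun X => gram_part k i j X ^+ 2 +
  (2 * (offdiag_prod (tnth X k) i j * gram_part k i j X) +
   offdiag_prod (tnth X k) i j ^+ 2))); last first.
  by apply/funext => X; rewrite (gram_partS k); ring.
have m1 : all_moments D (fun X => offdiag_prod (tnth X k) i j * gram_part k i j X).
  exact: all_momentsM.
have m2 : all_moments D (fun X => offdiag_prod (tnth X k) i j ^+ 2).
  exact: all_momentsX.
have m3 : all_moments D (fun X => gram_part k i j X ^+ 2) by exact: all_momentsX.
rewrite Ex_addP; [|exact: all_moments_Pint|]; last first.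
  by apply: all_moments_Pint; apply: all_momentsD => //; exact: all_momentsZ.
rewrite Ex_addP; [|by apply: all_moments_Pint; exact: all_momentsZ|exact: all_moments_Pint].
rewrite Ex_scaleP; last exact: all_moments_Pint.
rewrite (@indep k (fun x => offdiag_prod x i j)); last exact: gram_part_off.
- rewrite (offdiag_mean0 mom mean0) mul0r mulr0 add0r -natr1 mulrDl mul1r lerD//.
    exact/IH/ltnW.
  have e := @Ex_prod_coordP _ _ _ _ (fun=> row_law) k (fun x => offdiag_prod x i j ^+ 2)
     (proj1 (all_momentsX 2 (offdiag_moments mom i j))).
  rewrite [leLHS]e; case: (eqVneq i j) => [<-|ij]; last first.
    by rewrite (offdiag_sqr_mean mom mean2).
  rewrite (_ : (fun x => _) = fun=> 0) ?Ex_cst ?sqr_ge0//.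
  by apply/funext => x; rewrite /offdiag_prod eqxx expr0n.
- exact: offdiag_moments.
- exact: gmom.
Qed.

Local Notation C := (@offdiag_square R p).

Let CC i j x : C i j x = C j i x.
Proof. by apply: eq_bigr => l _; rewrite mulrC !(offdiag_prodC x l). Qed.

Let mC i j : all_moments row_law (C i j).
Proof. exact: offdiag_square_moments. Qed.

(** A new row changes [W] into [W + Y], with [Y] independent of [W], and [W^2] into
    [W^2 + (W Y + Y W) + Y^2]. In the expansion of the squared norm, the products of
    [W Y] with [W^2] and with [Y^2] have mean zero, being linear in one of the centered
    matrices [Y] and [W]. The product of [W^2] with [Y^2] and the square of [W Y] are
    of order [p^3 k v^4] because the mean of [Y^2] is diagonal, with entries at most
    [p v^2]; and the squared norm of [Y^2] is bounded by the eighth moments. *)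
Lemma gram_frobenius_step (k : 'I_n) :
  Ex D (gram_frobenius k.+1) <= Ex D (gram_frobenius k) +
    (6 * p%:R ^+ 3 * k%:R * v ^+ 4 + p%:R ^+ 4 * w).
Proof.
pose W i j := gram_part k i j.
pose Y i j (X : design) := offdiag_prod (tnth X k) i j.
pose B i j := gram_square k i j.
pose U i j X := \sum_l W i l X * Y l j X.
pose CX i j (X : design) := C i j (tnth X k).
have WS i j X : W i j X = W j i X by exact: gram_partC.
have YS i j X : Y i j X = Y j i X by exact: offdiag_prodC.
have mW i j : all_moments D (W i j) by exact: gmom.
have mY i j : all_moments D (Y i j) by exact: rmom.
have mB i j : all_moments D (B i j) by exact: gram_square_moments.
have mU i j : all_moments D (U i j) by apply: all_moments_sum => l; exact: all_momentsM.
have mCX i j : all_moments D (CX i j) by apply: all_moments_sum => l; exact: all_momentsM.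
have Woff i j : off_coord k (W i j) by exact: gram_part_off.
have Boff i j : off_coord k (B i j).
  by move=> X x; apply: eq_bigr => l _; rewrite !gram_part_off.
have sqE i j X : gram_square k.+1 i j X = B i j X + (U i j X + U j i X) + CX i j X.
  rewrite /B /U /CX /offdiag_square /gram_square -!big_split/=; apply: eq_bigr => l _.
  rewrite !(gram_partS k) -/(W i l X) -/(W l j X) -/(Y i l X) -/(Y l j X).
  by rewrite (WS j l) (YS l i); ring.
have crossBU i j : Ex D (fun X => B i j X * U i j X) = 0.
  rewrite (_ : (fun X => _) = (fun X => \sum_l Y l j X * (B i j X * W i l X))); last first.
    by apply/funext => X; rewrite /U mulr_sumr; apply: eq_bigr => l _; ring.
  rewrite Ex_sumP; last by move=> l; apply: all_moments_Pint; do 2 apply: all_momentsM => //.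
  rewrite big1// => l _; rewrite (@indep k (fun x => offdiag_prod x l j)).
  - by rewrite (offdiag_mean0 mom mean0) mul0r.
  - exact: offdiag_moments.
  - exact: all_momentsM.
  - by move=> X x; rewrite Boff Woff.
have crossUC i j : Ex D (fun X => U i j X * CX i j X) = 0.
  rewrite (_ : (fun X => _) = (fun X => \sum_l (Y l j X * CX i j X) * W i l X)); last first.
    by apply/funext => X; rewrite /U mulr_suml; apply: eq_bigr => l _; ring.
  rewrite Ex_sumP; last by move=> l; apply: all_moments_Pint; do 2 apply: all_momentsM => //.
  rewrite big1// => l _; rewrite (@indep k (fun x => offdiag_prod x l j * C i j x)).
  - by rewrite gram_part_mean0 mulr0.
  - by apply: all_momentsM; [exact: offdiag_moments|exact: mC].
  - exact: mW.
  - exact: Woff.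
have EBC i j : Ex D (fun X => CX i j X * B i j X) = Ex row_law (C i j) * Ex D (B i j).
  by apply: (@indep k (C i j)) => //; exact: mC.
have W2 i j : Ex D (fun X => W i j X ^+ 2) <= k%:R * v ^+ 2.
  by apply: gram_part_mean2; exact: ltnW.
have W20 i j : 0 <= Ex D (fun X => W i j X ^+ 2) by apply: Ex_ge0 => X; exact: sqr_ge0.
have sumW2 i : \sum_l Ex D (fun X => W i l X ^+ 2) <= p%:R * (k%:R * v ^+ 2).
  rewrite mulr_natl -[X in _ *+ X](card_ord p) -sumr_const ler_sum// => l _.
have BE i X : B i i X = \sum_l W i l X ^+ 2.
  by apply: eq_bigr => l _; rewrite -/(W i l X) -/(W l i X) (WS l i) expr2.
have vv : v ^+ 4 = v ^+ 2 * v ^+ 2 by rewrite -exprD.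
have Cii i : 0 <= Ex row_law (C i i) <= p%:R * v ^+ 2.
  exact: (offdiag_square_diag mom mean2).
have EW2 i : Ex D (B i i) = \sum_l Ex D (fun X => W i l X ^+ 2).
  rewrite -Ex_sumP; first by congr Ex; apply/funext => X; exact: BE.
  by move=> l; apply: all_moments_Pint; exact: all_momentsX.
have mprod q1 q2 : 0 <= q1 <= p%:R * v ^+ 2 -> 0 <= q2 <= p%:R * (k%:R * v ^+ 2) ->
    q1 * q2 <= p%:R ^+ 2 * k%:R * v ^+ 4.
  move=> /andP[q10 q1l] /andP[q20 q2l]; rewrite (le_trans (ler_pM q10 q20 q1l q2l))//.
  by rewrite vv le_eqVlt; apply/orP; left; apply/eqP; ring.
have sumB : \sum_i \sum_j Ex D (fun X => CX i j X * B i j X) <=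
    p%:R ^+ 3 * k%:R * v ^+ 4.
  apply: (@le_trans _ _ (\sum_(i < p) p%:R ^+ 2 * k%:R * v ^+ 4)); last first.
    rewrite sumr_const card_ord -mulr_natl le_eqVlt; apply/orP; left; apply/eqP; ring.
  apply: ler_sum => i _; rewrite (bigD1 i)//= big1 ?addr0; last first.
    move=> j ji; rewrite EBC (offdiag_square_off mom mean0) ?mul0r//.
    by rewrite eq_sym.
  rewrite EBC mprod ?Cii// EW2 sumW2 andbT sumr_ge0//.
have UU i X : \sum_j U i j X ^+ 2 =
    \sum_l \sum_l' CX l l' X * (W i l X * W i l' X).
  transitivity (\sum_j \sum_l \sum_l' (Y l j X * Y j l' X) * (W i l X * W i l' X)).
    apply: eq_bigr => j _; rewrite expr2 {1}/U mulr_suml; apply: eq_bigr => l _.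
    rewrite mulr_sumr; apply: eq_bigr => l' _; rewrite (YS j l'); ring.
  rewrite exchange_big/=; apply: eq_bigr => l _.
  rewrite exchange_big/=; apply: eq_bigr => l' _.
  by rewrite -mulr_suml.
have sumU : \sum_i \sum_j Ex D (fun X => U i j X ^+ 2) <= p%:R ^+ 3 * k%:R * v ^+ 4.
  apply: (@le_trans _ _ (\sum_(i < p) p%:R ^+ 2 * k%:R * v ^+ 4)); last first.
    rewrite sumr_const card_ord -mulr_natl le_eqVlt; apply/orP; left; apply/eqP; ring.
  apply: ler_sum => i _.
  rewrite -Ex_sumP; last by move=> j; apply: all_moments_Pint; exact: all_momentsX.
  rewrite (_ : (fun X => _) = (fun X => \sum_l \sum_l' CX l l' X * (W i l X * W i l' X))); last first.
    by apply/funext => X; exact: UU.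
  have mCWW l l' : all_moments D (fun X => CX l l' X * (W i l X * W i l' X)).
    by apply: all_momentsM => //; exact: all_momentsM.
  rewrite Ex_sumP; last by move=> l; apply: all_moments_Pint; exact: all_moments_sum.
  have Eterm l l' : Ex D (fun X => CX l l' X * (W i l X * W i l' X)) =
      Ex row_law (C l l') * Ex D (fun X => W i l X * W i l' X).
    apply: (@indep k (C l l')); [exact: mC|exact: all_momentsM|].
    by move=> X x; rewrite !Woff.
  apply: (@le_trans _ _ (\sum_l p%:R * v ^+ 2 * Ex D (fun X => W i l X ^+ 2))).
    apply: ler_sum => l _; rewrite Ex_sumP; last by move=> l'; exact: all_moments_Pint.
    rewrite (bigD1 l)//= big1 ?addr0; last first.
      move=> l' ll'; rewrite Eterm (offdiag_square_off mom mean0) ?mul0r//.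
      by rewrite eq_sym.
    by rewrite Eterm; have /andP[_ h] := Cii l; exact: ler_wpM2r (W20 i l) _ _ h.
  rewrite -mulr_sumr (le_trans (ler_wpM2l _ (sumW2 i))) ?mulr_ge0 ?sqr_ge0//.
  by rewrite vv le_eqVlt; apply/orP; left; apply/eqP; ring.
have sumC : \sum_i \sum_j Ex D (fun X => CX i j X ^+ 2) <= p%:R ^+ 4 * w.
  have h := offdiag_square_frobenius_mean p mom mean8.
  apply: le_trans h; rewrite Ex_sumP; last first.
    by move=> i; apply: all_moments_Pint; apply: all_moments_sum => j; exact/all_momentsX/mC.
  apply: ler_sum => i _; rewrite Ex_sumP; last first.
    by move=> j; apply: all_moments_Pint; exact/all_momentsX/mC.
  apply: ler_sum => j _.
  have mC2 := proj1 (all_momentsX 2 (mC i j)).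
  by have e := @Ex_prod_coordP _ _ _ _ (fun=> row_law) k _ mC2; rewrite [leLHS]e.
(* termwise bound, using (U + U^T)^2 <= 2 U^2 + 2 (U^T)^2 *)
have Eij i j : Ex D (fun X => gram_square k.+1 i j X ^+ 2) <=
    Ex D (fun X => B i j X ^+ 2) + (2 * Ex D (fun X => U i j X ^+ 2) +
    2 * Ex D (fun X => U j i X ^+ 2)) + Ex D (fun X => CX i j X ^+ 2) +
    2 * Ex D (fun X => CX i j X * B i j X).
  have P2 F : all_moments D F -> Pint D (fun X => F X ^+ 2).
    by move=> mF; apply: all_moments_Pint; exact: all_momentsX.
  have PM F G : all_moments D F -> all_moments D G -> Pint D (fun X => F X * G X).
    by move=> mF mG; apply: all_moments_Pint; exact: all_momentsM.
  have BS X : B i j X = B j i X.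
    by apply: eq_bigr => l _; rewrite mulrC !(gram_partC k l).
  have CS X : CX i j X = CX j i X by exact: CC.
  have zero : Ex D (fun X => 2 * (B i j X * U i j X) + 2 * (B j i X * U j i X) +
      (2 * (U i j X * CX i j X) + 2 * (U j i X * CX j i X))) = 0.
    rewrite Ex_addP; [|apply: PintD; apply: PintZ; exact: PM|apply: PintD; apply: PintZ; exact: PM].
    rewrite !Ex_addP; [|apply: PintZ; exact: PM..].
    rewrite !Ex_scaleP; [|exact: PM..].
    by rewrite !crossBU !crossUC !mulr0 !addr0.
  rewrite -[leRHS]addr0 -zero.
  rewrite -!Ex_scaleP; [|exact: PM|exact: P2|exact: P2].
  have i1 : Pint D (fun X => 2 * U i j X ^+ 2 + 2 * U j i X ^+ 2).
    by apply: PintD; apply: PintZ; exact: P2.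
  have i2 : Pint D (fun X => B i j X ^+ 2 + (2 * U i j X ^+ 2 + 2 * U j i X ^+ 2)).
    by apply: PintD => //; exact: P2.
  have i3 : Pint D (fun X => B i j X ^+ 2 + (2 * U i j X ^+ 2 + 2 * U j i X ^+ 2) + CX i j X ^+ 2).
    by apply: PintD => //; exact: P2.
  have i4 : Pint D (fun X => 2 * (CX i j X * B i j X)) by apply: PintZ; exact: PM.
  have i5 : Pint D (fun X => 2 * (B i j X * U i j X) + 2 * (B j i X * U j i X) +
      (2 * (U i j X * CX i j X) + 2 * (U j i X * CX j i X))).
    by apply: PintD; apply: PintD; apply: PintZ; exact: PM.
  rewrite -(Ex_addP (PintZ 2 (P2 _ (mU i j))) (PintZ 2 (P2 _ (mU j i)))).
  rewrite -(Ex_addP (P2 _ (mB i j)) i1) -(Ex_addP i2 (P2 _ (mCX i j))).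
  rewrite -(Ex_addP i3 i4) -(Ex_addP (PintD i3 i4) i5).
  apply: le_ExP; [exact/P2/gram_square_moments|exact: PintD (PintD i3 i4) i5|].
  move=> X; rewrite sqE -(BS X) -(CS X).
  by have := sqr_ge0 (U i j X - U j i X); nra.
rewrite /gram_frobenius Ex_sumP; last first.
  by move=> i; apply: all_moments_Pint; apply: all_moments_sum => j; exact/all_momentsX/gram_square_moments.
rewrite [X in _ <= X + _]Ex_sumP; last first.
  by move=> i; apply: all_moments_Pint; apply: all_moments_sum => j; exact/all_momentsX.
have Esq i m : Ex D (fun X => \sum_j gram_square m i j X ^+ 2) =
    \sum_j Ex D (fun X => gram_square m i j X ^+ 2).
  apply: Ex_sumP => j; apply: all_moments_Pint; exact/all_momentsX/gram_square_moments.
under eq_bigr do rewrite Esq.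
under [X in _ <= X + _]eq_bigr do rewrite Esq.
apply: (@le_trans _ _ (\sum_i \sum_j (Ex D (fun X => B i j X ^+ 2) +
    (2 * Ex D (fun X => U i j X ^+ 2) + 2 * Ex D (fun X => U j i X ^+ 2)) +
    Ex D (fun X => CX i j X ^+ 2) + 2 * Ex D (fun X => CX i j X * B i j X)))).
  by apply: ler_sum => i _; exact: ler_sum.
have split4 : \sum_i \sum_j (Ex D (fun X => B i j X ^+ 2) +
    (2 * Ex D (fun X => U i j X ^+ 2) + 2 * Ex D (fun X => U j i X ^+ 2)) +
    Ex D (fun X => CX i j X ^+ 2) + 2 * Ex D (fun X => CX i j X * B i j X)) =
  \sum_i \sum_j Ex D (fun X => B i j X ^+ 2) +
  4 * (\sum_i \sum_j Ex D (fun X => U i j X ^+ 2)) +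
  \sum_i \sum_j Ex D (fun X => CX i j X ^+ 2) +
  2 * \sum_i \sum_j Ex D (fun X => CX i j X * B i j X).
  under eq_bigr do rewrite !big_split/= -!mulr_sumr.
  rewrite !big_split/= -!mulr_sumr [X in _ + (_ + 2 * X) + _ + _]exchange_big/=; ring.
rewrite split4; move: sumB sumU sumC.
set b1 := \sum_i \sum_j Ex D (fun X => CX i j X * B i j X).
set b2 := \sum_i \sum_j Ex D (fun X => U i j X ^+ 2).
set b3 := \sum_i \sum_j Ex D (fun X => CX i j X ^+ 2).
rewrite -/B; set b4 := \sum_i _; lra.
Qed.

Lemma gram_frobenius_mean :
  Ex D (gram_frobenius n) <= n%:R * (6 * p%:R ^+ 3 * n%:R * v ^+ 4 + p%:R ^+ 4 * w).
Proof.
suff H m : (m <= n)%N -> Ex D (gram_frobenius m) <=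
    m%:R * (6 * p%:R ^+ 3 * n%:R * v ^+ 4 + p%:R ^+ 4 * w) by exact: H.
elim: m => [|m IH] mn.
  rewrite (_ : gram_frobenius 0 = fun=> 0) ?Ex_cst ?mul0r//.
  apply/funext => X; rewrite /gram_frobenius big1// => i _; rewrite big1// => j _.
  rewrite /gram_square big1 ?expr0n// => l _.
  by rewrite /gram_part big_pred0_eq mul0r.
apply: le_trans (gram_frobenius_step (Ordinal mn)) _.
have -> K : m.+1%:R * K = m%:R * K + K :> R by rewrite -natr1; ring.
rewrite lerD ?IH 1?ltnW//= lerD2r.
by rewrite ler_wpM2r ?exprn_ge0// ler_wpM2l ?mulr_ge0 ?exprn_ge0// ler_nat ltnW.
Qed.

End gram_matrix.

(** * Moments of a sub-Gaussian design *)
Section subgaussian_moments.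
Context (R : realType) (Z : probability R R) (C : R).
Hypothesis meanZ : ('E_Z[@idfun R] = 0)%E.
Hypothesis subZ : (subgaussian_norm Z <= C%:E)%E.

Let B : R := expR ((C + 1) ^+ 2 / 2).

(** The infimum defining the sub-Gaussian norm need not be attained, hence the
    constant [C + 1]. *)
Lemma subgaussian_exp (t : R) : t ^+ 2 = 1 -> (\int[Z]_z (expR (t * z))%:E <= B%:E)%E.
Proof.
move=> t1; have : (subgaussian_norm Z < (C + 1)%:E)%E.
  by rewrite (le_lt_trans subZ)// lte_fin ltrDl.
move=> /ereal_inf_lt[_ [K [K0 hK]] <-]; rewrite lte_fin => KC.
move: (hK t); rewrite meanZ unlock /=; under eq_integral do rewrite subr0.
move=> /le_trans; apply; rewrite lee_fin /B ler_expR t1 mulr1.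
by rewrite ler_wpM2r ?invr_ge0// lerXn2r ?nnegrE ?(le_trans K0)// ltW.
Qed.

Lemma pow_le_exp (k : nat) (x : R) : 0 <= x -> x ^+ k <= k%:R ^+ k * expR x.
Proof.
case: k => [|k] x0; first by rewrite !expr0 mul1r -[leLHS]expR0 ler_expR.
set y := x / k.+1%:R.
have xE : x = k.+1%:R * y by rewrite mulrC divfK.
have y0 : 0 <= y by rewrite divr_ge0.
rewrite [in leLHS]xE exprMn ler_wpM2l ?exprn_ge0//.
rewrite xE expRM_natl lerXn2r ?nnegrE ?expR_ge0//.
by rewrite (le_trans _ (expR_ge1Dx y))// lerDr.
Qed.

Let G (z : R) := expR (1 * z) + expR (-1 * z).

Let mexp (t : R) : measurable_fun setT (fun z : R => expR (t * z)).
Proof. by apply: measurableT_comp => //; exact: measurable_funM. Qed.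

Let iexp t : t ^+ 2 = 1 -> Pint Z (fun z => expR (t * z)).
Proof.
move=> t1; apply: Pint_ge0 => [//|z|]; first exact: expR_ge0.
by apply: le_lt_trans (subgaussian_exp t1) _; exact: ltry.
Qed.

Let sq1 : (1 : R) ^+ 2 = 1. Proof. by rewrite expr1n. Qed.
Let sqN1 : (-1 : R) ^+ 2 = 1. Proof. by rewrite sqrrN expr1n. Qed.

Let iG : Pint Z G. Proof. by apply: PintD; exact: iexp. Qed.

Let GE : Ex Z G <= 2 * B.
Proof.
rewrite /G Ex_addP; [|exact: iexp..].
rewrite mulr2n mulrDl !mul1r -lee_fin !EFinD; apply: leeD.
  by rewrite EFin_ExP; [exact: subgaussian_exp|exact: iexp].
by rewrite EFin_ExP; [exact: subgaussian_exp|exact: iexp].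
Qed.

Let pow_le k z : `|z| ^+ k <= k%:R ^+ k * G z.
Proof.
rewrite (le_trans (pow_le_exp _ _))// ler_wpM2l ?exprn_ge0// /G mul1r mulN1r.
by case: (ger0P z) => _; rewrite ?lerDl ?lerDr expR_ge0.
Qed.

Lemma subgaussian_all_moments : all_moments Z idfun.
Proof.
split; first exact: measurable_id.
move=> k; apply: (@Pint_le _ _ _ Z (fun z => `|z| ^+ k) (fun z => k%:R ^+ k * G z)).
- apply: measurable_funX; exact: normr_measurable.
- by move=> z; rewrite ger0_norm ?exprn_ge0//; exact: pow_le.
- exact: PintZ.
Qed.

Lemma subgaussian_moment8 : Ex Z (fun z => z ^+ 8) <= 8%:R ^+ 8 * (2 * B).
Proof.
apply: (@le_trans _ _ (Ex Z (fun z => 8%:R ^+ 8 * G z))); last first.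
  by rewrite Ex_scaleP// ler_wpM2l// exprn_ge0.
apply: le_ExP.
- exact: (all_moments_Pint (all_momentsX 8 subgaussian_all_moments)).
- exact: PintZ.
- move=> z; rewrite (le_trans _ (pow_le 8 z))// -normrX ler_norm//.
Qed.

End subgaussian_moments.

Section scaled_moments.
Context (R : realType) (Z : probability R R) (n : nat).
Hypotheses (mom : all_moments Z idfun) (n0 : (0 < n)%N).
Hypotheses (meanZ : ('E_Z[@idfun R] = 0)%E) (varZ : ('V_Z[@idfun R] = 1)%E).

Let a : R := (Num.sqrt n%:R)^-1.
Let a2 : a ^+ 2 = n%:R^-1. Proof. by rewrite exprVn sqr_sqrtr. Qed.

Let scaled_pow k : Pint Z (fun z => rescale n z ^+ k).
Proof.
rewrite (_ : (fun z => _) = (fun z => a ^+ k * z ^+ k)); last first.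
  by apply/funext => z; rewrite /rescale exprMn.
exact/PintZ/(all_moments_Pint (all_momentsX k mom)).
Qed.

Let Ex_scaled k : Ex (scaled_law n Z) (fun z => z ^+ k) = a ^+ k * Ex Z (fun z => z ^+ k).
Proof.
rewrite -Ex_scaleP; last exact: (all_moments_Pint (all_momentsX k mom)).
rewrite /Ex /Rintegral; congr fine.
rewrite (@integral_pushforward _ _ _ _ _ _ (measurable_funPT (rescale n)))//.
- by apply: eq_integral => z _ /=; rewrite /rescale exprMn.
- by apply/measurable_EFinP; exact: (proj1 (all_momentsX k mom)).
- exact: scaled_pow.
Qed.

Lemma scaled_all_moments : all_moments (scaled_law n Z) idfun.
Proof.
split; first exact: measurable_id.
move=> k; apply: integrable_pushforward => //.
- apply/measurable_EFinP; apply: measurable_funX; exact: normr_measurable.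
- rewrite [X in _.-integrable _ X](_ : _ = EFin \o (fun z => `|rescale n z ^+ k|)).
    exact: Pint_norm.
  by apply/funext => z /=; rewrite normrX.
Qed.

Lemma scaled_mean : Ex (scaled_law n Z) idfun = 0.
Proof.
have := Ex_scaled 1; have -> : Ex Z (fun z => z ^+ 1) = 0.
  transitivity (fine ('E_Z[@idfun R])%E); last by rewrite meanZ.
  by rewrite unlock.
by rewrite mulr0.
Qed.

Lemma scaled_mean2 : Ex (scaled_law n Z) (fun z => z ^+ 2) = n%:R^-1.
Proof.
rewrite Ex_scaled a2 (_ : Ex Z _ = 1) ?mulr1//.
transitivity (fine ('V_Z[@idfun R])%E); last by rewrite varZ.
rewrite /variance unlock meanZ unlock; congr fine; apply: eq_integral => z _ /=.
by transitivity (((z - 0) * (z - 0))%:E) => //; rewrite !subr0 expr2.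
Qed.

Lemma scaled_mean8 c : Ex Z (fun z => z ^+ 8) <= c ->
  Ex (scaled_law n Z) (fun z => z ^+ 8) <= n%:R ^- 4 * c.
Proof.
move=> Zc; rewrite Ex_scaled (_ : a ^+ 8 = n%:R ^- 4).
  by rewrite ler_wpM2l// invr_ge0 exprn_ge0.
by rewrite (_ : 8 = 2 * 4)%N// exprM a2 exprVn.
Qed.

End scaled_moments.

Lemma measurable_superlevel d (T : measurableType d) (R : realType) (F : T -> R) (t : R) :
  measurable_fun setT F -> measurable [set x | t < F x].
Proof.
move=> mF; rewrite (_ : [set x | _] = ~` [set x | F x <= t]); last first.
  by apply/seteqP; split=> x /=; rewrite ltNge => /negP.
by apply: measurableC; rewrite -[X in measurable X]setTI; exact: measurable_fun_le.
Qed.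

Lemma markov_Ex d (T : measurableType d) (R : realType) (P : probability T R)
    (F : T -> R) (t : R) : Pint P F -> (forall x, 0 <= F x) -> 0 < t ->
  (P [set x | (t < F x)%R] <= (Ex P F / t)%:E)%E.
Proof.
move=> jF F0 t0; have mF := Pint_measurable jF.
have mB : measurable [set x | t < F x].
  exact: measurable_superlevel.
have -> : P [set x | t < F x] = (Ex P (\1_[set x | t < F x] : T -> R))%:E.
  by rewrite Ex_indic// fineK// fin_num_measure.
rewrite lee_fin ler_pdivlMr// mulrC -Ex_scaleP; last exact/Pint_bmeas/bmeas_indic.
apply: le_ExP => //; first exact/PintZ/Pint_bmeas/bmeas_indic.
move=> x; rewrite indicE; case: (boolP (x \in _)) => [|_]; last by rewrite mulr0.
by rewrite inE /= mulr1 => /ltW.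
Qed.

Section design_event.
Context (R : realType) (n p : nat) (Z : probability R R) (c : R).
Hypotheses (mom : all_moments Z idfun) (n0 : (0 < n)%N).
Hypotheses (meanZ : ('E_Z[@idfun R] = 0)%E) (varZ : ('V_Z[@idfun R] = 1)%E).
Hypothesis mom8 : Ex Z (fun z => z ^+ 8) <= c.
Local Notation D := (iid_prob n (iid_prob p (scaled_law n Z))).

Definition gram_row (i : 'I_p) (X : n.-tuple (p.-tuple R)) : R :=
  \sum_j gram_part n i j X ^+ 2.

Lemma gram_row_moments i : all_moments D (gram_row i).
Proof.
apply: all_moments_sum => j; apply: all_momentsX.
exact: (gram_part_moments n (scaled_all_moments n mom)).
Qed.

Lemma gram_frobenius_moments : all_moments D (@gram_frobenius R n p n).
Proof.
apply: all_moments_sum => i; apply: all_moments_sum => j; apply: all_momentsX.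
exact: (gram_square_moments n (scaled_all_moments n mom)).
Qed.

(** Markov's inequality for the two non-negative statistics of the design. *)
Lemma design_event (i : 'I_p) (delta r : R) : 0 < delta -> 0 < r ->
  let E := [set X | @gram_frobenius R n p n X <= delta /\ gram_row i X <= r] in
  measurable E /\
  ((1 - ((6 * p%:R ^+ 3 / n%:R ^+ 2 + p%:R ^+ 4 / n%:R ^+ 3 * c) / delta +
         (p%:R / n%:R) / r))%:E <= D E)%E.
Proof.
move=> d0 r0 E.
have nP : 0 < n%:R :> R by rewrite ltr0n.
have mrho := scaled_all_moments n mom.
have m0 := scaled_mean n mom meanZ; have m2 := scaled_mean2 n mom meanZ varZ.
have m8 := scaled_mean8 n mom mom8.
have v0 : 0 <= n%:R^-1 :> R by rewrite invr_ge0.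
have jS := all_moments_Pint gram_frobenius_moments.
have jr := all_moments_Pint (gram_row_moments i).
have S0 X : 0 <= @gram_frobenius R n p n X.
  by apply: sumr_ge0 => k _; apply: sumr_ge0 => j _; exact: sqr_ge0.
have R0 X : 0 <= gram_row i X by apply: sumr_ge0 => j _; exact: sqr_ge0.
have ES : Ex D (@gram_frobenius R n p n) <=
    6 * p%:R ^+ 3 / n%:R ^+ 2 + p%:R ^+ 4 / n%:R ^+ 3 * c.
  rewrite (le_trans (gram_frobenius_mean n p mrho v0 m0 m2 m8))//.
  by rewrite le_eqVlt; apply/orP; left; apply/eqP; field; rewrite gt_eqF.
have ER : Ex D (gram_row i) <= p%:R / n%:R.
  rewrite /gram_row Ex_sumP; last first.
    by move=> j; apply: all_moments_Pint; exact/all_momentsX/(gram_part_moments n mrho).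
  apply: (@le_trans _ _ (\sum_(j < p) n%:R^-1)); last first.
    by rewrite sumr_const card_ord mulr_natl.
  apply: ler_sum => j _.
  rewrite (le_trans (gram_part_mean2 mrho m0 m2 i j (leqnn n)))//.
  by rewrite le_eqVlt; apply/orP; left; apply/eqP; field; rewrite gt_eqF.
have mS : measurable [set X | delta < @gram_frobenius R n p n X].
  by apply: measurable_superlevel; exact: Pint_measurable jS.
have mR : measurable [set X | r < gram_row i X].
  by apply: measurable_superlevel; exact: Pint_measurable jr.
have EE : E = ~` ([set X | delta < @gram_frobenius R n p n X] `|` [set X | r < gram_row i X]).
  rewrite setCU; apply/seteqP; split=> X /=.
    by move=> [h1 h2]; split; apply/negP; rewrite -leNgt.
  by move=> [/negP h1 /negP h2]; split; rewrite leNgt.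
have mU := measurableU _ _ mS mR.
split; first by rewrite EE; exact: measurableC.
rewrite EE probability_setC// EFinB leeB//.
rewrite (le_trans (measureU2 _ mS mR))// EFinD leeD//.
  rewrite (le_trans (markov_Ex jS S0 d0))// lee_fin ler_wpM2r// invr_ge0 ltW//.
by rewrite (le_trans (markov_Ex jr R0 r0))// lee_fin ler_wpM2r// invr_ge0 ltW.
Qed.

End design_event.

(** * Dependence on the parameter of the prior *)
Lemma le_law_Ex d (T : measurableType d) (R : realType) (mu mu' : probability T R)
    (c : R) (g : T -> R) :
  (forall A, measurable A -> (mu A <= (expR c)%:E * mu' A)%E) ->
  bmeas g -> (forall x, 0 <= g x) -> Ex mu g <= expR c * Ex mu' g.
Proof.
move=> h bg g0; rewrite -lee_fin EFinM !EFin_Ex//.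
pose k : {nonneg R} := NngNum (expR_ge0 c).
have mg : measurable_fun setT (EFin \o g) by apply/measurable_EFinP; exact: (proj1 bg).
apply: (@le_trans _ _ (\int[mscale k mu']_x (g x)%:E)%E).
  by apply: ge0_le_measure_integral => // x; rewrite lee_fin.
by rewrite ge0_integral_mscale// => x _; rewrite lee_fin.
Qed.

(** The numerator and the denominator of a tilt change by a factor at most [exp c]
    each, provided the integrand is non-negative, whence the passage to [f + 1]. *)
Lemma tilt_compare d (T : measurableType d) (R : realType) (mu mu' : probability T R)
    (c : R) (kap phi : T -> R) (m : R) (f : T -> R) :
  0 <= c ->
  (forall A, measurable A -> (mu A <= (expR c)%:E * mu' A)%E) ->
  (forall A, measurable A -> (mu' A <= (expR c)%:E * mu A)%E) ->
  bmeas kap -> bmeas phi -> bmeas f -> (forall x, `|f x| <= 1) ->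
  `|tilt mu kap phi m f - tilt mu' kap phi m f| <= 8 * c.
Proof.
wlog suff: mu mu' / forall c0 : 0 <= c,
  (forall A, measurable A -> (mu A <= (expR c)%:E * mu' A)%E) ->
  (forall A, measurable A -> (mu' A <= (expR c)%:E * mu A)%E) ->
  bmeas kap -> bmeas phi -> bmeas f -> (forall x, `|f x| <= 1) ->
  tilt mu kap phi m f - tilt mu' kap phi m f <= 8 * c.
  move=> suff c0 h1 h2 bkap bphi bf f1; rewrite ler_norml suff// andbT lerNl opprB.
  exact: suff.
move=> c0 h1 h2 bkap bphi bf f1.
have t1 : `|tilt mu kap phi m f| <= 1 by exact: tilt_norm_le.
have t1' : `|tilt mu' kap phi m f| <= 1 by exact: tilt_norm_le.
move: t1 t1'; rewrite !ler_norml => /andP[t1 t2] /andP[t3 t4].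
have [csmall|cbig] := leP c (1 / 4); last by lra.
pose g x := f x + 1.
have b1 := @bmeas_cst _ T R 1.
have bg : bmeas g by exact: bmeasD.
have g0 x : 0 <= g x by rewrite /g; have := f1 x; rewrite ler_norml => /andP[]; lra.
pose wt x := expR (m * kap x + phi x).
have bw : bmeas wt by exact: bmeas_weight.
have bgw : bmeas (fun x => g x * wt x) by exact: bmeasM.
have gw0 x : 0 <= g x * wt x by rewrite mulr_ge0// expR_ge0.
have e1 := le_law_Ex h1 bgw gw0.
have e2 := le_law_Ex h2 bw (fun x => expR_ge0 _).
have tg (nu : probability T R) : tilt nu kap phi m g = tilt nu kap phi m f + 1.
  by rewrite tiltD// tilt_cst.
have w0 (nu : probability T R) : 0 < Ex nu wt by exact: Ex_weight_gt0.
have ratio : tilt mu kap phi m g <= expR (2 * c) * tilt mu' kap phi m g.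
  rewrite /tilt -/wt ler_pdivrMr//.
  set q := Ex mu' _ / _.
  have q0 : 0 <= q by apply: divr_ge0; [exact: Ex_ge0|exact: ltW (w0 mu')].
  have aE : Ex mu' (fun x => g x * wt x) = q * Ex mu' wt by rewrite divfK// lt0r_neq0.
  rewrite (le_trans e1)// aE (_ : expR (2 * c) * q * Ex mu wt =
    expR c * (q * (expR c * Ex mu wt))); last first.
    by rewrite mulr_natl mulr2n expRD; ring.
  by rewrite !ler_wpM2l// expR_ge0.
have e4 : expR (2 * c) - 1 <= 4 * c.
  have hc : `|2 * c| <= 1 / 2 by rewrite ger0_norm ?mulr_ge0//; lra.
  have := expRB1_le hc; rewrite (ger0_norm (mulr_ge0 _ c0))// => h.
  by rewrite (le_trans (ler_norm _))// (le_trans h)//; lra.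
rewrite !tg in ratio.
have q : (expR (2 * c) - 1) * (tilt mu' kap phi m f + 1) <= 4 * c * 2.
  by rewrite ler_pM//; [rewrite subr_ge0 -[leLHS]expR0 ler_expR mulr_ge0|lra|lra].
by lra.
Qed.

Section prior_facts.
Context (R : realType) (k : nat) (Theta : set 'rV[R]_k) (theta0 : 'rV[R]_k).
Variables (nu : {measure set R -> \bar R}) (S : set R).
Variables (l : 'rV[R]_k -> R -> R) (mu : 'rV[R]_k -> probability R R).
Hypothesis prior : prior_family Theta theta0 nu S l mu.
Hypothesis bounded : bounded_support Theta S l.

Lemma msupport_closed (P : probability R R) : closed (msupport P).
Proof.
move=> x clx U oU Ux.
have [z [Pz Uz]] := clx U (open_nbhs_nbhs (conj oU Ux)).
exact: Pz.
Qed.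

Lemma theta0_Theta : Theta theta0.
Proof. exact: (interior_subset (theta0_interior prior)). Qed.

Lemma measurable_support : measurable S.
Proof.
have <- : msupport (mu theta0) = S by exact: (prior_support prior theta0_Theta).
by apply: closed_measurable; exact: msupport_closed.
Qed.

Lemma prior_support1 t : Theta t -> mu t S = 1%E.
Proof.
move=> Tt; rewrite -(@probability_setT _ _ _ (mu t)) !(prior_density prior)//.
  by rewrite setIid setTI.
exact: measurable_support.
Qed.

Lemma support_in_ball : exists M : R, 0 < M /\ forall b, S b -> `|b| <= M.
Proof.
have [M0 [_ h]] := support_bounded bounded.
exists (`|M0| + 1); split; first by rewrite ltr_wpDl.
by move=> b Sb; apply: h => //; rewrite (le_lt_trans (ler_norm M0))// ltrDl.
Qed.

Lemma measurable_log_density t : Theta t -> measurable_fun S (l t).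
Proof.
move=> Tt; apply: subspace_continuous_measurable_fun; first exact: measurable_support.
apply/subspace_continuousP => b Sb.
have /subspace_continuousP/(_ (t, b)) /= := l_continuous bounded.
move=> /(_ (conj Tt Sb)) h.
apply: cvg_trans h => W /=; rewrite /nbhs/= /within/= => -[[U V]] /= [nU nV] UV.
apply: filterS nV => b' Vb' Sb'.
by apply: (UV (t, b')) => //; split => //; exact: nbhs_singleton nU.
Qed.

End prior_facts.

Section l2norm_facts.
Context (R : realType).

Lemma l2norm_coord_le m n (A : 'M[R]_(m, n)) i j : `|A i j| <= l2norm A.
Proof.
rewrite -(sqrtr_sqr (A i j)) /l2norm ler_sqrt; last first.
  by apply: sumr_ge0 => a _; apply: sumr_ge0 => b _; exact: sqr_ge0.
rewrite (bigD1 i)//= (bigD1 j)//= -addrA lerDl addr_ge0// ?sumr_ge0// => [b _|a _].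
  exact: sqr_ge0.
by apply: sumr_ge0 => b _; exact: sqr_ge0.
Qed.

Lemma l2norm_ge0 m n (A : 'M[R]_(m, n)) : 0 <= l2norm A.
Proof. exact: sqrtr_ge0. Qed.

End l2norm_facts.

Section gradient.
Context (R : realType) (k : nat) (f : 'rV[R]_k -> R) (x v : 'rV[R]_k) (C : R).

Let h (s : R) := f (s *: v + x).

Lemma line_shift (s : R) :
  (fun e : R => e^-1 *: (h (e *: 1 + s) - h s)) =
  (fun e : R => e^-1 *: (f (e *: v + (s *: v + x)) - f (s *: v + x))).
Proof.
apply/funext => e; rewrite /h; congr (_ *: (f _ - _)).
by rewrite -[e *: 1]/(e * 1) mulr1 scalerDl addrA.
Qed.

Lemma is_derive_line (s : R) : differentiable f (s *: v + x) ->
  is_derive s 1 h ('D_v f (s *: v + x)).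
Proof.
move=> df; apply: DeriveDef.
  rewrite /derivable /= (_ : (fun e : R => _) =
    (fun e : R => e^-1 *: (f (e *: v + (s *: v + x)) - f (s *: v + x)))).
    exact: diff_derivable.
  exact: line_shift.
by rewrite /derive /= -line_shift.
Qed.

Lemma derive_coord_le (z : 'rV[R]_k) : differentiable f z ->
  (forall i, `|partial i f z| <= C) -> `|'D_v f z| <= C * k%:R * l2norm v.
Proof.
move=> df pC; rewrite deriveE// {1}(row_sum_delta v) linear_sum/=.
rewrite (le_trans (ler_norm_sum _ _ _))//.
apply: (@le_trans _ _ (\sum_(i < k) C * l2norm v)).
  apply: ler_sum => i _; rewrite linearZ/= normrM mulrC ler_pM//.
    by rewrite -deriveE//; exact: pC.
  exact: l2norm_coord_le.
have -> : \sum_(i < k) C * l2norm v = C * l2norm v * k%:R.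
  by rewrite sumr_const card_ord mulr_natr.
by rewrite mulrAC.
Qed.

End gradient.

Section prior_lipschitz.
Context (R : realType) (k : nat) (Theta : set 'rV[R]_k) (theta0 : 'rV[R]_k).
Variables (nu : {measure set R -> \bar R}) (S : set R).
Variables (l : 'rV[R]_k -> R -> R) (mu : 'rV[R]_k -> probability R R).
Hypothesis prior : prior_family Theta theta0 nu S l mu.
Hypothesis bounded : bounded_support Theta S l.

(** Near the interior point [theta0] the segments from [theta0] stay in [Theta], where
    the gradient of the log-density is bounded: this is the mean value theorem. *)
Lemma log_density_lipschitz : exists r C : R, [/\ 0 < r, 0 <= C &
  forall t b, S b -> l2norm (t - theta0) < r ->
    `|l t b - l theta0 b| <= C * l2norm (t - theta0)].
Proof.
have /nbhs_ballP[r /= r0 rT] := theta0_interior prior.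
have [C0 hC0] := l_derivatives_bounded bounded.
pose C := `|C0|.
have C_ge0 : 0 <= C by exact: normr_ge0.
exists r, (C * k%:R); split => [//||]; first by rewrite mulr_ge0.
move=> t b Sb tr; pose v := t - theta0.
have seg s : s \in `[0, 1] -> Theta (s *: v + theta0).
  rewrite in_itv/= => /andP[s0 s1]; apply: rT; split => // i j.
  rewrite /ball/= !mxE opprD addrCA subrr addr0 normrN normrM (ger0_norm s0).
  rewrite -[_ - _](_ : v i j = _); last by rewrite !mxE.
  by rewrite (le_lt_trans _ tr)// (le_trans _ (l2norm_coord_le v i j))// ler_piMl.
have dseg s : s \in `[0, 1] -> differentiable (l^~ b) (s *: v + theta0).
  by move=> /seg Ts; have [] := nbhs_singleton (l_smooth prior Ts Sb).
pose h s := l (s *: v + theta0) b.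
have [c cI hE] : exists2 c, c \in `[0, 1] & h 1 - h 0 = 'D_v (l^~ b) (c *: v + theta0) * (1 - 0).
  apply: MVT_segment => //.
    move=> s sI; apply: (is_derive_line (f := l^~ b)); apply: dseg.
    exact: subset_itv_oo_cc sI.
  apply: derivable_within_continuous => s sI.
  by have [] := is_derive_line (dseg _ sI).
move: hE; rewrite /h scale1r scale0r add0r subrK subr0 mulr1 => ->.
apply: derive_coord_le; first exact: dseg.
move=> i; rewrite (le_trans _ (ler_norm C0))//.
by have [] := hC0 _ _ (seg _ cI) Sb i i i.
Qed.

Lemma density_compare t c : Theta t -> 0 <= c ->
  (forall b, S b -> `|l t b - l theta0 b| <= c) ->
  (forall A, measurable A -> (mu t A <= (expR c)%:E * mu theta0 A)%E) /\
  (forall A, measurable A -> (mu theta0 A <= (expR c)%:E * mu t A)%E).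
Proof.
move=> Tt c0 lc; have T0 := theta0_Theta prior.
have mS := measurable_support prior.
have half t1 t2 : Theta t1 -> Theta t2 -> (forall b, S b -> l t1 b <= c + l t2 b) ->
    forall A, measurable A -> (mu t1 A <= (expR c)%:E * mu t2 A)%E.
  move=> T1 T2 l12 A mA; rewrite !(prior_density prior)//.
  have mAS : measurable (A `&` S) by exact: measurableI.
  have me t' : Theta t' -> measurable_fun (A `&` S) (fun b => (expR (l t' b))%:E).
    move=> T'; apply/measurable_EFinP; apply: measurableT_comp => //.
    apply: (measurable_funS mS); first exact: subIsetr.
    exact: (measurable_log_density prior bounded).
  have e0 t' b : (0 <= (expR (l t' b))%:E)%E by rewrite lee_fin expR_ge0.
  have <- : (\int[nu]_(b in A `&` S) ((expR c)%:E * (expR (l t2 b))%:E) =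
      (expR c)%:E * \int[nu]_(b in A `&` S) (expR (l t2 b))%:E)%E.
    by apply: ge0_integralZl => //; rewrite ?lee_fin ?expR_ge0//; exact: (me _ T2).
  apply: ge0_le_integral => //.
  - exact: (me _ T1).
  - by apply: emeasurable_funM => //; exact: (me _ T2).
  by move=> b [_ Sb]; rewrite -EFinM lee_fin -expRD ler_expR l12.
split; apply: half => // b Sb; have := lc b Sb; rewrite ler_norml => /andP[]; lra.
Qed.

(** [Theta] need not be convex, so that the mean value theorem only covers a ball
    around [theta0]; outside of it the trivial bound [2] is at most [2 / r] times the
    distance. *)
Lemma prior_tilt_lipschitz : exists L : R, 0 <= L /\
  forall t, Theta t -> forall (kap phi : R -> R) (m : R) (f : R -> R),
    bmeas kap -> bmeas phi -> bmeas f -> (forall x, `|f x| <= 1) ->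
    `|tilt (mu t) kap phi m f - tilt (mu theta0) kap phi m f| <=
    L * l2norm (t - theta0).
Proof.
have [r [C [r0 C0 lip]]] := log_density_lipschitz.
exists (8 * C + 2 / r); split; first by apply: addr_ge0; [exact: mulr_ge0|apply: divr_ge0 => //; exact: ltW].
move=> t Tt kap phi m f bkap bphi bf f1; have n0 := l2norm_ge0 (t - theta0).
rewrite mulrDl; have [tr|tr] := ltP (l2norm (t - theta0)) r.
  have [h1 h2] := density_compare Tt (mulr_ge0 C0 n0) (fun b Sb => lip t b Sb tr).
  rewrite (le_trans (tilt_compare m _ h1 h2 bkap bphi bf f1)) ?mulr_ge0//.
  by rewrite mulrA lerDl mulr_ge0// divr_ge0// ltW.
apply: (@le_trans _ _ (1 + 1)).
  by rewrite (le_trans (ler_normB _ _))// lerD//; exact: tilt_norm_le.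
apply: ler_wpDl; first by rewrite !mulr_ge0.
by rewrite mulrAC ler_pdivlMr// ler_wpM2l.
Qed.

End prior_lipschitz.

(** * The posterior as a Gibbs measure *)
Section gram_operator.
Context (R : realType) (n p : nat) (X : n.-tuple (p.-tuple R)) (a : R).

(** The interaction coming from the likelihood, without its diagonal, which is a
    one-body term. *)
Definition coupling : 'M[R]_p := \matrix_(i, j) (- a * gram_part n i j X).

Lemma coupling_sym : coupling^T = coupling.
Proof. by apply/matrixP => i j; rewrite !mxE gram_partC. Qed.

Lemma coupling_diag i : coupling i i = 0.
Proof.
rewrite mxE /gram_part big1 ?mulr0// => k _.
by rewrite /offdiag_prod eqxx.
Qed.

Lemma coupling_row i : row_norm2 coupling i = a ^+ 2 * gram_row i X.
Proof.
rewrite /row_norm2 /gram_row mulr_sumr; apply: eq_bigr => j _.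
by rewrite mxE exprMn sqrrN.
Qed.

(** [|W x|^2] is the quadratic form of [W^2] at [x], at most [|x|^2] times the
    Frobenius norm of [W^2]. *)
Lemma coupling_opnorm kappa : 0 <= kappa -> gram_frobenius n X <= kappa ^+ 2 ->
  opnorm2_le coupling (a ^+ 2 * kappa).
Proof.
move=> k0 Sk x; pose N := \sum_j x j ^+ 2.
have N0 : 0 <= N by apply: sumr_ge0 => j _; exact: sqr_ge0.
pose W i j := gram_part n i j X.
have -> : \sum_i (\sum_j coupling i j * x j) ^+ 2 =
    a ^+ 2 * \sum_i (\sum_j W i j * x j) ^+ 2.
  rewrite mulr_sumr; apply: eq_bigr => i _; rewrite -exprMn mulr_sumr -sqrrN -sumrN.
  by congr (_ ^+ _); apply: eq_bigr => j _; rewrite mxE -/(W i j); ring.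
rewrite -mulrA ler_wpM2l ?sqr_ge0// -/N.
have quad : \sum_i (\sum_j W i j * x j) ^+ 2 =
    \sum_(jl : 'I_p * 'I_p) (x jl.1 * x jl.2) * gram_square n jl.1 jl.2 X.
  rewrite -(pair_bigA _ (fun j l => (x j * x l) * gram_square n j l X))/=.
  transitivity (\sum_i \sum_j \sum_l (x j * x l) * (W j i * W i l)).
    apply: eq_bigr => i _; rewrite expr2 mulr_suml; apply: eq_bigr => j _.
    by rewrite mulr_sumr; apply: eq_bigr => l _; rewrite /W (gram_partC n j i); ring.
  rewrite exchange_big/=; apply: eq_bigr => j _; rewrite exchange_big/=.
  by apply: eq_bigr => l _; rewrite mulr_sumr.
rewrite -(ler_pXn2r (ltn0Sn 1)) ?nnegrE ?mulr_ge0//; last first.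
  by apply: sumr_ge0 => i _; exact: sqr_ge0.
rewrite quad (le_trans (cauchy_schwarz_sum _ _))//.
rewrite -(pair_bigA _ (fun j l => (x j * x l) ^+ 2))/=.
rewrite -(pair_bigA _ (fun j l => gram_square n j l X ^+ 2))/=.
rewrite exprMn mulrC ler_pM//.
- by apply: sumr_ge0 => i _; apply: sumr_ge0 => j _; exact: sqr_ge0.
- by apply: sumr_ge0 => i _; apply: sumr_ge0 => j _; exact: sqr_ge0.
rewrite expr2 /N mulr_suml ler_sum// => i _.
by rewrite mulr_sumr ler_sum// => j _; rewrite exprMn.
Qed.

Lemma coupling_rows_sum : \sum_i row_norm2 coupling i ^+ 2 <= a ^+ 4 * gram_frobenius n X.
Proof.
rewrite /gram_frobenius mulr_sumr ler_sum// => i _.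
rewrite coupling_row exprMn -exprM ler_wpM2l//.
  by rewrite exprM sqr_ge0.
rewrite (bigD1 i)//= (_ : gram_square n i i X = gram_row i X) ?lerDl ?sumr_ge0// => [j _|].
  exact: sqr_ge0.
by apply: eq_bigr => l _; rewrite (gram_partC n l i) expr2.
Qed.

End gram_operator.

Section likelihood.
Context (R : realType) (n p : nat) (sigma M : R).
Variables (y : n.-tuple R) (X : n.-tuple (p.-tuple R)).
Hypothesis M0 : 0 < M.
Hypothesis sigma0 : 0 < sigma.

(** Clipping at [M] makes the rescaled coordinate bounded on the whole line; on the
    support it changes nothing. *)
Definition spin (x : R) : R := Num.max (- M) (Num.min M x) / M.

Lemma spin_le1 x : `|spin x| <= 1.
Proof.
rewrite /spin normrM normfV (gtr0_norm M0) ler_pdivrMr// mul1r ler_norml.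
rewrite le_max lexx/= ge_max ge_min lexx/= andbT.
by rewrite (le_trans _ (ltW M0))// oppr_le0 ltW.
Qed.

Lemma spinK x : `|x| <= M -> M * spin x = x.
Proof.
rewrite ler_norml => /andP[h1 h2].
by rewrite /spin mulrC divfK ?gt_eqF// (min_idPr h2) (max_idPr h1).
Qed.

Lemma bmeas_spin : bmeas spin.
Proof.
split; last by exists 1; exact: spin_le1.
apply: measurable_funM => //; apply: measurable_maxr => //.
by apply: measurable_minr => //; exact: measurable_id.
Qed.

Definition coupling_cst : R := M ^+ 2 / sigma ^+ 2.

Definition site_energy (i : 'I_p) (x : R) : R :=
  (M / sigma ^+ 2 * \sum_(k < n) tnth y k * tnth (tnth X k) i) * spin x -
  (coupling_cst / 2 * \sum_(k < n) tnth (tnth X k) i ^+ 2) * spin x ^+ 2.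

Lemma bmeas_site_energy i : bmeas (site_energy i).
Proof.
have bs := bmeas_spin.
apply: bmeasB; apply: bmeasM; [exact: bmeas_cst|exact: bs|exact: bmeas_cst|exact: bmeasX].
Qed.

Definition energy_cst : R := - (2 * sigma ^+ 2)^-1 * \sum_(k < n) tnth y k ^+ 2.

Local Notation A := (coupling X coupling_cst).

Lemma likelihood_hamiltonian (b : p.-tuple R) : (forall i, `|tnth b i| <= M) ->
  likelihood sigma y X b = expR (hamiltonian A spin site_energy energy_cst b).
Proof.
move=> bM; rewrite /likelihood; congr expR.
have s2 : sigma ^+ 2 != 0 by rewrite sqrf_eq0 gt_eqF.
pose s i := spin (tnth b i).
have bs i : tnth b i = M * s i by rewrite spinK.
rewrite /l2norm sqr_sqrtr; last first.
  by apply: sumr_ge0 => k _; apply: sumr_ge0 => j _; exact: sqr_ge0.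
have rowk (k : 'I_n) : \sum_(j < 1)
    (tuple_col y - design_mx X *m tuple_col b) k j ^+ 2 =
    tnth y k ^+ 2 - 2 * \sum_i (tnth y k * tnth (tnth X k) i) * (M * s i) +
    M ^+ 2 * \sum_i \sum_j (tnth (tnth X k) i * tnth (tnth X k) j) * (s i * s j).
  rewrite big_ord1 !mxE.
  rewrite (eq_bigr (fun i => tnth (tnth X k) i * (M * s i))); last first.
    by move=> i _; rewrite !mxE bs.
  set T := \sum_i tnth (tnth X k) i * (M * s i).
  have e1 : \sum_i (tnth y k * tnth (tnth X k) i) * (M * s i) = tnth y k * T.
    by rewrite /T mulr_sumr; apply: eq_bigr => i _; ring.
  have e2 : M ^+ 2 * (\sum_i \sum_j (tnth (tnth X k) i * tnth (tnth X k) j) * (s i * s j)) =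
      T ^+ 2.
    rewrite [T ^+ 2]expr2 {1}/T mulr_suml mulr_sumr; apply: eq_bigr => i _.
    by rewrite /T !mulr_sumr; apply: eq_bigr => j _; ring.
  by rewrite e1 e2; ring.
pose L := \sum_i (\sum_(k < n) tnth y k * tnth (tnth X k) i) * s i.
pose Dg := \sum_i (\sum_(k < n) tnth (tnth X k) i ^+ 2) * s i ^+ 2.
pose O := \sum_i \sum_j gram_part n i j X * (s i * s j).
have LE : \sum_(k < n) \sum_i (tnth y k * tnth (tnth X k) i) * (M * s i) = M * L.
  rewrite exchange_big/= /L mulr_sumr; apply: eq_bigr => i _.
  by rewrite -mulr_suml; ring.
have QE : \sum_(k < n) \sum_i \sum_j
    (tnth (tnth X k) i * tnth (tnth X k) j) * (s i * s j) = Dg + O.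
  rewrite exchange_big/= /Dg /O -big_split/=; apply: eq_bigr => i _.
  rewrite exchange_big/= (bigD1 i)//= [in RHS](bigD1 i)//=.
  rewrite (_ : gram_part n i i X = 0) ?mul0r ?add0r; last first.
    by rewrite /gram_part big1// => k _; rewrite /offdiag_prod eqxx.
  congr (_ + _); first by rewrite mulr_suml; apply: eq_bigr => k _; ring.
  apply: eq_bigr => j ji; rewrite -mulr_suml; congr (_ * _).
  rewrite /gram_part [RHS]big_mkcond/=; apply: eq_bigr => k _.
  by rewrite ltn_ord /offdiag_prod eq_sym (negbTE ji).
under eq_bigr do rewrite rowk.
rewrite big_split sumrB/= -!mulr_sumr LE QE.
rewrite /hamiltonian /energy_cst.
have -> : \sum_i site_energy i (tnth b i) =
    M / sigma ^+ 2 * L - coupling_cst / 2 * Dg.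
  rewrite /site_energy sumrB /L /Dg !mulr_sumr; congr (_ - _).
    by apply: eq_bigr => i _; rewrite /s; ring.
  by apply: eq_bigr => i _; rewrite /s; ring.
have -> : \sum_i \sum_j A i j * (spin (tnth b i) * spin (tnth b j)) = - coupling_cst * O.
  rewrite /O mulr_sumr; apply: eq_bigr => i _; rewrite mulr_sumr.
  by apply: eq_bigr => j _; rewrite mxE /s; ring.
by rewrite /coupling_cst; field; rewrite gt_eqF.
Qed.

End likelihood.

Section posterior_gibbs.
Context (R : realType) (n p : nat) (sigma M : R).
Variables (y : n.-tuple R) (X : n.-tuple (p.-tuple R)).
Variables (mu : probability R R) (S : set R).
Hypotheses (M0 : 0 < M) (sigma0 : 0 < sigma).
Hypotheses (mS : measurable S) (muS : mu S = 1%E) (SM : forall b, S b -> `|b| <= M).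
Local Notation A := (coupling X (coupling_cst sigma M)).
Local Notation phi := (site_energy sigma M y X).

Lemma ae_support : {ae iid_prob p mu, forall b, forall i, S (tnth b i)}.
Proof.
apply: filter_forall => i.
have mB : measurable (tcoord i @^-1` (~` S) : set (p.-tuple R)).
  by rewrite -[X in measurable X]setTI; apply: measurable_tnth => //; exact: measurableC.
exists (tcoord i @^-1` (~` S)); split => //.
have -> : iid_prob p mu (tcoord i @^-1` (~` S)) = mu (~` S).
  exact: (@marginal_prod_prob _ _ _ p (fun=> mu) i _ (measurableC mS)).
by rewrite probability_setC// muS subee.
Qed.

(** The prior charges only points of the support, where the likelihood is a Gibbs
    weight; the constant [h0] contains the normalization. *)
Lemma posterior_gibbs : exists h0 : R, forall B, measurable B ->
  posterior sigma y X mu B =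
  (\int[iid_prob p mu]_(b in B) (expR (hamiltonian A (spin M) phi h0 b))%:E)%E.
Proof.
pose H := hamiltonian A (spin M) phi (energy_cst sigma y).
have bspin := bmeas_spin M0; have bphi i := bmeas_site_energy sigma y X M0 i.
have bH : bmeas H by exact: bmeas_hamiltonian.
have beH := bmeas_expR bH.
have lH : {ae iid_prob p mu, forall b, likelihood sigma y X b = expR (H b)}.
  apply: filterS ae_support => b bS; apply: likelihood_hamiltonian => // i.
  exact/SM/bS.
have mL := measurable_likelihood sigma y X.
pose z := Ex (iid_prob p mu) (fun b => expR (H b)).
have z0 : 0 < z.
  have [_ [C HC]] := bH; apply: (@Ex_gt0 _ _ _ _ _ (expR (- C))); rewrite ?expR_gt0//.
  by move=> b; rewrite ler_expR lerNnormlW.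
have eqL B : measurable B ->
    (\int[iid_prob p mu]_(b in B) (likelihood sigma y X b)%:E =
     \int[iid_prob p mu]_(b in B) (expR (H b))%:E)%E.
  move=> mB; apply: ge0_ae_eq_integral => //; [| |move=> b _; exact: expR_ge0|].
  - by apply/measurable_EFinP; exact: measurable_funTS.
  - by apply/measurable_EFinP; apply: measurable_funTS; exact: (proj1 beH).
  - by apply: filterS lH => b /= -> .
exists (energy_cst sigma y - ln z) => B mB; rewrite /posterior.
apply: (eq_trans (@mnormalize_density _ _ _ _ (iid_prob p mu) (iid_prob p mu)
  (fun b => expR (H b)) (proj1 beH) (fun b => expR_ge0 _) _ z z0 _ B mB)).
- by move=> C mC; rewrite -eqL.
- by rewrite /= /weighted_prior eqL// -EFin_Ex.
- apply: eq_integral => b _; congr EFin.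
  rewrite (_ : hamiltonian _ _ _ (_ - _) b = H b - ln z).
    by rewrite expRB lnK.
  by rewrite /H /hamiltonian; ring.
Qed.

End posterior_gibbs.

(** A density between two positive constants preserves the null open sets. Hence the
    tilts of the prior are admissible factors. *)
Lemma msupport_density (R : realType) (mu tau : probability R R) (psi : R -> R) :
  bmeas psi -> has_density mu (fun x => expR (psi x)) tau ->
  msupport tau = msupport mu.
Proof.
move=> bpsi [me _ tauE]; have [_ [C HC]] := bpsi.
have null U : open U -> tau U = 0%E <-> mu U = 0%E.
  move=> oU; have mU := open_measurable oU; split=> [|U0]; last first.
    rewrite tauE//; apply: null_set_integral => //.
    by apply/measurable_EFinP; exact: measurable_funTS.
  rewrite tauE// => tU0; apply/eqP; rewrite eq_le measure_ge0 andbT.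
  have : ((expR (- C))%:E * mu U <= 0)%E.
    rewrite -tU0 -integral_cst//; apply: ge0_le_integral => //.
    - by move=> x _; rewrite lee_fin expR_ge0.
    - by apply/measurable_EFinP; exact: measurable_funTS.
    - by move=> x _; rewrite lee_fin ler_expR lerNnormlW.
  by rewrite pmule_rle0// lte_fin expR_gt0.
apply/seteqP; split=> x Px U oU Ux; have := Px U oU Ux;
  rewrite !lt0e !measure_ge0 !andbT; apply: contraNN => /eqP/(null _ oU) -> //.
Qed.

(** * Minimizers against the posterior *)
Section mean_field_posterior.
Context (R : realType) (n p : nat) (sigma M : R).
Variables (y : n.-tuple R) (X : n.-tuple (p.-tuple R)) (S : set R).
Hypotheses (M0 : 0 < M) (sigma0 : 0 < sigma).
Hypotheses (mS : measurable S) (SM : forall b, S b -> `|b| <= M).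
Local Notation A := (coupling X (coupling_cst sigma M)).
Local Notation phi := (site_energy sigma M y X).
Local Notation kap := (spin M).

Let bkap : bmeas kap. Proof. exact: bmeas_spin. Qed.
Let kap1 x : `|kap x| <= 1. Proof. exact: spin_le1. Qed.
Let bphi i : bmeas (phi i). Proof. exact: bmeas_site_energy. Qed.

(** The prior is an admissible competitor of finite divergence, so the divergence of a
    minimizer is finite; the competitor of [mean_field_stationary] is admissible by
    [msupport_density]. *)
Lemma mf_argmin_stationary (mu : probability R R) Q : mu S = 1%E ->
  mf_argmin sigma y X mu Q -> forall i f, bmeas f ->
  Ex (Q i) f = tilt mu kap (phi i) (\sum_j A i j * Ex (Q j) kap) f.
Proof.
move=> muS [Qadm Qmin] i f bf.
have [h0 PH] := posterior_gibbs y X M0 sigma0 mS muS SM.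
have bH := @bmeas_hamiltonian _ _ _ _ A _ _ h0 bkap bphi.
apply: (@mean_field_stationary _ _ _ _ _ _ _ _ h0 (posterior sigma y X mu)) => //.
- exact: coupling_sym.
- exact: coupling_diag.
- apply: (le_lt_trans (Qmin (fun=> mu) (fun=> erefl))).
  have hd (j : 'I_p) : has_density mu (fun=> 1) mu.
    split; [exact: measurable_cst|by []|].
    by move=> B mB; rewrite integral_cst// mul1e.
  rewrite (dKL_prod_fin bH PH (Q := fun=> mu) (f := fun _ _ => 1) hd); first exact: ltry.
  by move=> j; rewrite ln1; exact: Pint_cst.
- move=> tau htau; apply: Qmin => j; rewrite /site_update; case: eqP => // _.
  apply: msupport_density htau; apply: bmeasB; last exact: bmeas_cst.
  by apply: bmeasD => //; apply: bmeasM => //; exact: bmeas_cst.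
Qed.

Lemma mf_argmin_support (mu : probability R R) Q : mu S = 1%E ->
  mf_argmin sigma y X mu Q -> forall i, Q i S = 1%E.
Proof.
move=> muS QM i; suff : Ex (Q i) (\1_(~` S) : R -> R) = 0.
  rewrite Ex_indic; last exact: measurableC.
  have fQ : Q i S = (fine (Q i S))%:E by rewrite fineK// fin_num_measure.
  rewrite probability_setC// fQ /= => h.
  by congr EFin; lra.
rewrite (mf_argmin_stationary muS QM); last by apply: bmeas_indic; exact: measurableC.
set s := \sum_j _; have [mw [C wC]] := bmeas_weight bkap (bphi i) s.
have mSC := measurableC mS; have bi := @bmeas_indic _ _ R _ mSC.
have bw := bmeas_weight bkap (bphi i) s.
rewrite /tilt [X in X / _](_ : _ = 0) ?mul0r//.
apply/eqP; rewrite eq_le; apply/andP; split; last first.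
  by apply: Ex_ge0 => x; rewrite mulr_ge0 ?expR_ge0.
apply: (@le_trans _ _ (Ex mu (fun x => C * (\1_(~` S) x : R)))).
  apply: le_Ex; [exact: bmeasM|by apply: bmeasM => //; exact: bmeas_cst|].
  by move=> x; rewrite mulrC ler_wpM2r// (le_trans (ler_norm _)).
rewrite ExZ// Ex_indic// [mu _]probability_setC// muS subee//= mulr0//.
Qed.

(** The posterior has prior [mu] and the minimizer prior [mu']. The means of the
    minimizer solve the fixed-point equation of [mu'] exactly, hence that of [mu] with
    a defect at most [eps]; the last [eps] compares the two tilts at the same field. *)
Lemma posterior_mean_field (mu mu' : probability R R) Q (i : 'I_p) (e eps : R) :
  mu S = 1%E -> mu' S = 1%E ->
  0 <= e -> 5 * (2 * 540) * e <= 1 -> opnorm2_le A e ->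
  \sum_j row_norm2 A j ^+ 2 <= 1 -> 0 <= eps ->
  (forall kp ph m f, bmeas kp -> bmeas ph -> bmeas f -> (forall x, `|f x| <= 1) ->
    `|tilt mu kp ph m f - tilt mu' kp ph m f| <= eps) ->
  mf_argmin sigma y X mu' Q ->
  forall f, bmeas f -> (forall x, `|f x| <= 1) ->
  `|Ex (posterior sigma y X mu) (fun b => f (tnth b i)) - Ex (Q i) f| <=
  8 * mean_field_cst R * Num.sqrt (row_norm2 A i) * (1 + Num.sqrt p%:R * eps) + eps.
Proof.
move=> muS mu'S e0 e1 opA rowA eps0 close QM f bf f1.
have [h0 PH] := posterior_gibbs y X M0 sigma0 mS muS SM.
have stat := mf_argmin_stationary mu'S QM.
have fix_u j : `|tilt mu kap (phi j) (\sum_k A j k * Ex (Q k) kap) kap - Ex (Q j) kap| <= eps.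
  by rewrite (stat j)//; exact: close.
have h := mean_field_approx bkap kap1 bphi (coupling_sym X _) (coupling_diag X _)
  PH e0 e1 opA rowA eps0 fix_u i bf f1.
rewrite -[_ - _](subrKA (tilt mu kap (phi i) (\sum_k A i k * Ex (Q k) kap) f)).
rewrite (le_trans (ler_normD _ _))// lerD// (stat i)//; exact: close.
Qed.

End mean_field_posterior.

Section posterior_quantities.
Context (R : realType) (p : nat) (M : R) (S : set R) (i : 'I_p).
Hypotheses (M0 : 0 < M) (mS : measurable S) (SM : forall b, S b -> `|b| <= M).
Local Notation kap := (spin M).

Let bkap : bmeas kap. Proof. exact: bmeas_spin. Qed.
Let kap1 x : `|kap x| <= 1. Proof. exact: spin_le1. Qed.

Section one_law.
Variable P : probability (p.-tuple R) R.
Hypothesis PS : P (tcoord i @^-1` (~` S)) = 0%E.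

Let k1 := Ex P (fun b => kap (tnth b i)).
Let k2 := Ex P (fun b => kap (tnth b i) ^+ 2).
Let bk : bmeas (fun b : p.-tuple R => kap (tnth b i)). Proof. exact: bmeas_tnth. Qed.
Let mt : measurable_fun setT (fun b : p.-tuple R => tnth b i).
Proof. exact: measurable_tnth. Qed.

Let coord_ae : {ae P, forall b : p.-tuple R, tnth b i = M * kap (tnth b i)}.
Proof.
exists (tcoord i @^-1` (~` S)); split => //.
  by rewrite -[X in measurable X]setTI; apply: mt => //; exact: measurableC.
move=> b /= h Sb; apply: h; rewrite spinK//; exact: SM.
Qed.

Lemma coord_meanE : coord_mean P i = M * k1.
Proof.
rewrite /k1 -ExZ// /coord_mean /Ex /Rintegral unlock; congr fine.
apply: ae_eq_integral => //.
- exact/measurable_EFinP.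
- by apply/measurable_EFinP; apply: measurable_funM => //; exact: (proj1 bk).
- by apply: filterS coord_ae => b e _; congr EFin.
Qed.

Lemma coord_varE : coord_var P i = M ^+ 2 * (k2 - k1 ^+ 2).
Proof.
have bk2 : bmeas (fun b : p.-tuple R => kap (tnth b i) ^+ 2) by exact: bmeasX.
have bc (c : R) := @bmeas_cst _ (p.-tuple R) R c.
have bz (c : R) (f : p.-tuple R -> R) : bmeas f -> bmeas (fun b => c * f b).
  by move=> bf; exact: bmeasM.
have -> : M ^+ 2 * (k2 - k1 ^+ 2) =
    Ex P (fun b => (M * kap (tnth b i) - M * k1) * (M * kap (tnth b i) - M * k1)).
  rewrite (_ : (fun b => _) = (fun b => M ^+ 2 * (kap (tnth b i) ^+ 2 -
     (2 * k1) * kap (tnth b i)) + M ^+ 2 * k1 ^+ 2)); last first.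
    by apply/funext => b; ring.
  have b1 : bmeas (fun b : p.-tuple R => kap (tnth b i) ^+ 2 - (2 * k1) * kap (tnth b i)).
    by apply: bmeasB => //; exact: bz.
  rewrite ExD//; last exact: bz.
  rewrite ExZ// ExB//; last exact: bz.
  by rewrite ExZ// Ex_cst -/k1 -/k2; ring.
rewrite -coord_meanE.
transitivity (fine (\int[P]_b ((tnth b i - coord_mean P i) *
    (tnth b i - coord_mean P i))%:E)%E); first by rewrite /coord_var /coord_mean /variance !unlock.
rewrite /Ex /Rintegral; congr fine.
have mc (c : R) : measurable_fun setT (fun=> c : R) by exact: measurable_cst.
apply: ae_eq_integral => //.
- by apply/measurable_EFinP; apply: measurable_funM; exact: measurable_funB.
- apply/measurable_EFinP; apply: measurable_funM; apply: measurable_funB => //.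
  + by apply: measurable_funM => //; exact: (proj1 bk).
  + by apply: measurable_funM => //; exact: (proj1 bk).
- by apply: filterS coord_ae => b e _; rewrite -e.
Qed.

End one_law.

Section two_laws.
Variables (P : probability (p.-tuple R) R) (Q : 'I_p -> probability R R) (B : R).
Hypotheses (PS : P (tcoord i @^-1` (~` S)) = 0%E) (QS : Q i S = 1%E).
Hypothesis PQ : forall f, bmeas f -> (forall x, `|f x| <= 1) ->
  `|Ex P (fun b => f (tnth b i)) - Ex (Q i) f| <= B.

Let QS' : prod_prob Q (tcoord i @^-1` (~` S)) = 0%E.
Proof.
have -> : prod_prob Q (tcoord i @^-1` (~` S)) = Q i (~` S).
  exact: (@marginal_prod_prob _ _ _ p Q i _ (measurableC mS)).
by rewrite probability_setC// QS subee.
Qed.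

Let QE f : bmeas f -> Ex (prod_prob Q) (fun b => f (tnth b i)) = Ex (Q i) f.
Proof. exact: Ex_prod_coord. Qed.

(** Indicators are test functions bounded by [1]; so are the rescaled coordinate and
    its square, which give the means and the variances below. *)
Lemma dTV_marginal_le : `|dTV (marginal P i) (marginal (prod_prob Q) i)| <= B.
Proof.
rewrite /dTV; set D := [set _ | _ in _].
have DB : ubound D B.
  move=> _ [E mE <-]; rewrite (marginal_prod_prob Q i mE).
  have mE' : measurable (tcoord i @^-1` E : set (p.-tuple R)).
    by rewrite -[X in measurable X]setTI; exact: measurable_tnth.
  have := PQ (@bmeas_indic _ _ R _ mE).
  rewrite (Ex_indic (Q i) mE) (_ : Ex P _ = fine (P (tcoord i @^-1` E))).
    by apply => x; rewrite indicE; case: (_ \in _); rewrite ?normr1 ?normr0.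
  by rewrite -(Ex_indic P mE').
have D0 : D 0.
  by exists set0 => //; rewrite !measure0 subrr normr0.
have supD : has_sup D by split; [exists 0|exists B].
rewrite ger0_norm; first by apply: ge_sup => //; exists 0.
exact: (ub_le_sup supD.2).
Qed.

Lemma coord_mean_le : `|coord_mean P i - coord_mean (prod_prob Q) i| <= M * B.
Proof.
rewrite (coord_meanE PS) (coord_meanE QS') QE// -mulrBr normrM (gtr0_norm M0).
by rewrite ler_wpM2l ?(ltW M0)//; exact: (PQ bkap kap1).
Qed.

Lemma coord_var_le : `|coord_var P i - coord_var (prod_prob Q) i| <= 3 * M ^+ 2 * B.
Proof.
have bk2 : bmeas (fun x => kap x ^+ 2) by exact: bmeasX.
have k2_1 x : `|kap x ^+ 2| <= 1 by rewrite normrX expr_le1.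
rewrite (coord_varE PS) (coord_varE QS') QE// (QE bk2) -mulrBr normrM.
rewrite ger0_norm ?sqr_ge0// (_ : 3 * M ^+ 2 * B = M ^+ 2 * (3 * B)); last by ring.
rewrite ler_wpM2l ?sqr_ge0//.
have h2 := PQ bk2 k2_1; have h1 := PQ bkap kap1.
have a1 : `|Ex P (fun b => kap (tnth b i))| <= 1.
  by apply: norm_Ex_le => //; exact: bmeas_tnth.
have a2 : `|Ex (Q i) kap| <= 1 by exact: norm_Ex_le.
set k2 := Ex P _ in h2 *; set q2 := Ex (Q i) _ in h2 *.
set k1 := Ex P _ in h1 a1 *; set q1 := Ex (Q i) _ in h1 a2 *.
have -> : k2 - k1 ^+ 2 - (q2 - q1 ^+ 2) = (k2 - q2) - (k1 - q1) * (k1 + q1) by ring.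
rewrite (le_trans (ler_normB _ _))// normrM.
have : `|k1 + q1| <= 2 by rewrite (le_trans (ler_normD _ _))//; lra.
have := normr_ge0 (k1 - q1); have := normr_ge0 (k1 + q1); nra.
Qed.

End two_laws.

End posterior_quantities.

Lemma posterior_coord_support (R : realType) (n p : nat) (sigma M : R)
    (y : n.-tuple R) (X : n.-tuple (p.-tuple R)) (mu : probability R R) (S : set R)
    (i : 'I_p) : 0 < M -> 0 < sigma -> measurable S -> mu S = 1%E ->
  (forall b, S b -> `|b| <= M) ->
  posterior sigma y X mu (tcoord i @^-1` (~` S)) = 0%E.
Proof.
move=> M0 s0 mS muS SM; have [h0 PH] := posterior_gibbs y X M0 s0 mS muS SM.
have mB : measurable (tcoord i @^-1` (~` S) : set (p.-tuple R)).
  by rewrite -[X in measurable X]setTI; apply: measurable_tnth => //; exact: measurableC.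
rewrite PH//; apply: null_set_integral => //.
  apply/measurable_EFinP; apply: measurable_funTS.
  apply: (proj1 (bmeas_expR (bmeas_hamiltonian _ _ _ _))); first exact: bmeas_spin.
  by move=> j; exact: bmeas_site_energy.
apply: (eq_trans (@marginal_prod_prob _ _ _ p (fun=> mu) i _ (measurableC mS))).
by rewrite probability_setC// muS subee.
Qed.

(** * Bounds uniform in the data and in the parameter *)
Section uniform_gap.
Context (R : realType) (k : nat) (Theta : set 'rV[R]_k) (theta0 : 'rV[R]_k).
Variables (nu : {measure set R -> \bar R}) (S : set R).
Variables (l : 'rV[R]_k -> R -> R) (mu : 'rV[R]_k -> probability R R) (sigma : R).
Hypothesis prior : prior_family Theta theta0 nu S l mu.
Hypothesis bounded : bounded_support Theta S l.
Hypothesis sigma0 : 0 < sigma.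

(** Off the event where the interaction is small, nothing better than the trivial bound
    is available. *)
Definition design_gap n p (kappa : R) (X : n.-tuple (p.-tuple R)) (i : 'I_p) (N : R) : R :=
  if gram_frobenius n X <= kappa ^+ 2
  then Num.sqrt (gram_row i X) * (1 + Num.sqrt p%:R * N) + N else 1.

(** The constants depend on the prior family and on [sigma] only: [kappa] makes the
    operator norm of the interaction small enough for [posterior_mean_field]. The two
    cases for [t] are those of a common parameter and of the oracle posterior. *)
Lemma uniform_gap : exists kappa C : R, [/\ 0 < kappa, 0 <= C &
  forall n p (y : n.-tuple R) (X : n.-tuple (p.-tuple R)) (i : 'I_p) t t' Q,
    Theta t -> Theta t' -> t = t' \/ t = theta0 ->
    mf_argmin sigma y X (mu t') Q ->
    let P := posterior sigma y X (mu t) in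
    let G := C * design_gap kappa X i (l2norm (t' - t)) in
    [/\ `|dTV (marginal P i) (marginal (prod_prob Q) i)| <= G,
        `|coord_mean P i - coord_mean (prod_prob Q) i| <= G &
        `|coord_var P i - coord_var (prod_prob Q) i| <= G]].
Proof.
have mS := measurable_support prior.
have [M [M0 SM]] := support_in_ball bounded.
have [L [L0 lip]] := prior_tilt_lipschitz prior bounded.
pose a := coupling_cst sigma M.
have a0 : 0 <= a by rewrite divr_ge0 ?sqr_ge0.
pose D : R := 5 * (2 * 540) * (a ^+ 2 + 1).
have D1 : 1 <= D.
  by rewrite /D; have := sqr_ge0 a; lra.
pose kappa := D^-1.
have D0 : 0 < D by lra.
have kappa0 : 0 < kappa by rewrite invr_gt0.
have ak : a ^+ 2 * kappa * (5 * (2 * 540)) <= 1.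
  rewrite /kappa mulrAC ler_pdivrMr// mul1r /D.
  by have := sqr_ge0 a; lra.
have m0 : 0 <= mean_field_cst R.
  have := stein_cst_ge0 R; rewrite /mean_field_cst => h.
  by rewrite !addr_ge0// ?mulr_ge0// exprn_ge0.
pose C1 := 8 * mean_field_cst R * a * (1 + L) + L.
have L1 : 0 <= 1 + L by lra.
have C10 : 0 <= C1.
  apply: addr_ge0; last exact: L0.
  apply: mulr_ge0; last exact: L1.
  by apply: mulr_ge0; [apply: mulr_ge0; [exact: ler0n|exact: m0]|exact: a0].
pose c0 := 1 + M + 3 * M ^+ 2.
have M20 := sqr_ge0 M.
have c00 : 0 <= c0 by rewrite /c0; lra.
exists kappa, (c0 * (C1 + 2)); split; [exact: kappa0|by apply: mulr_ge0 => //; apply: addr_ge0|].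
move=> n p y X i t t' Q Tt Tt' tt' QM P G.
have muS := prior_support1 prior Tt; have mu'S := prior_support1 prior Tt'.
pose N := l2norm (t' - t); have N0 : 0 <= N := l2norm_ge0 _.
pose B := (C1 + 2) * design_gap kappa X i N.
have g0 : 0 <= gram_row i X by apply: sumr_ge0 => j _; exact: sqr_ge0.
have gap0 : 0 <= design_gap kappa X i N.
  rewrite /design_gap; case: ifP => _ //.
  by rewrite addr_ge0// mulr_ge0 ?sqrtr_ge0// addr_ge0// mulr_ge0// sqrtr_ge0.
have B0 : 0 <= B by rewrite mulr_ge0// addr_ge0.
have PQ f : bmeas f -> (forall x, `|f x| <= 1) ->
    `|Ex P (fun b => f (tnth b i)) - Ex (Q i) f| <= B.
  move=> bf f1; rewrite /B /design_gap; case: ifP => [good|_]; last first.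
    rewrite (le_trans (ler_normB _ _))// mulr1 (_ : C1 + 2 = C1 + 1 + 1); last by ring.
    apply: lerD; last exact: norm_Ex_le.
    rewrite (@le_trans _ _ 1)//; last by rewrite lerDr.
    by apply: norm_Ex_le => //; exact: bmeas_tnth.
  pose A := coupling X a.
  have opA : opnorm2_le A (a ^+ 2 * kappa) by apply: coupling_opnorm => //; exact: (ltW kappa0).
  have e0 : 0 <= a ^+ 2 * kappa by apply: mulr_ge0; [exact: sqr_ge0|exact: ltW].
  have e1 : 5 * (2 * 540) * (a ^+ 2 * kappa) <= 1 by rewrite mulrC.
  have rowA : \sum_j row_norm2 A j ^+ 2 <= 1.
    rewrite (le_trans (coupling_rows_sum _ _))//.
    apply: (@le_trans _ _ (a ^+ 4 * kappa ^+ 2)).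
      by rewrite ler_wpM2l// exprn_ge0.
    rewrite (_ : a ^+ 4 * kappa ^+ 2 = (a ^+ 2 * kappa) ^+ 2); last by ring.
    rewrite expr_le1//; move: e1 e0; set e := a ^+ 2 * kappa; lra.
  have eps0 : 0 <= L * N by rewrite mulr_ge0.
  have close kp ph m f' : bmeas kp -> bmeas ph -> bmeas f' -> (forall x, `|f' x| <= 1) ->
      `|tilt (mu t) kp ph m f' - tilt (mu t') kp ph m f'| <= L * N.
    move=> bkp bph bf' f'1; case: tt' => [<-|tE]; first by rewrite subrr normr0.
    by rewrite distrC /N tE; exact: lip.
  have h := posterior_mean_field (y := y) (X := X) M0 sigma0 mS SM i muS mu'S e0 e1 opA rowA eps0 close
    QM bf f1.
  apply: (le_trans h); rewrite coupling_row sqrtrM ?sqr_ge0// sqrtr_sqr (ger0_norm a0).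
  rewrite /C1; set g := Num.sqrt (gram_row i X); set sp := Num.sqrt p%:R.
  have gg0 : 0 <= g by exact: sqrtr_ge0.
  have sp0 : 0 <= sp by exact: sqrtr_ge0.
  set mf := mean_field_cst R in m0 *.
  have x1 : 0 <= 8 * mf * a by apply: mulr_ge0 => //; exact: mulr_ge0.
  have x2 : 0 <= g * (sp * N) by apply: mulr_ge0 => //; exact: mulr_ge0.
  have x3 : 0 <= 8 * mf * a * (L * g) by apply: mulr_ge0 => //; exact: mulr_ge0.
  have x4 : 0 <= 8 * mf * a * (g * (sp * N)) by exact: mulr_ge0.
  have x5 : 0 <= 8 * mf * a * (1 + L) * N.
    by apply: mulr_ge0 => //; exact: mulr_ge0.
  have x6 : 0 <= (L + 2) * (g * (1 + sp * N)).
    apply: mulr_ge0; first by rewrite addr_ge0.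
    by apply: mulr_ge0 => //; apply: addr_ge0 => //; exact: mulr_ge0.
  by move: x2 x3 x4 x5 x6 N0; lra.
have PS : P (tcoord i @^-1` (~` S)) = 0%E.
  exact: posterior_coord_support M0 sigma0 mS muS SM.
have QS : Q i S = 1%E := mf_argmin_support M0 sigma0 mS SM mu'S QM i.
have GE : G = c0 * B by rewrite /G /B mulrA.
have MB : 0 <= M * B by rewrite mulr_ge0// ltW.
have M2B : 0 <= 3 * M ^+ 2 * B by apply: mulr_ge0 => //; exact: mulr_ge0.
rewrite GE /c0; split.
- rewrite (le_trans (dTV_marginal_le PQ))//; lra.
- rewrite (le_trans (coord_mean_le M0 mS SM PS QS PQ))//; lra.
- rewrite (le_trans (coord_var_le M0 mS SM PS QS PQ))//; lra.
Qed.

End uniform_gap.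


Section tightness.
Context (R : realType) (n : nat -> nat).
Context (d : nat -> measure_display) (Om : forall p, measurableType (d p)).
Variable Pr : forall p, probability (Om p) R.
Variable X : forall p, {RV (Pr p) >-> (n p).-tuple (p.-tuple R)}.
Variables (Z : nat -> probability R R) (kappa C : R).
Hypothesis kappa0 : 0 < kappa.
Hypothesis n_infty : n p @[p --> \oo] --> \oo.
Hypothesis p_small : (fun p => p%:R : R) =o_\oo (fun p => (n p)%:R `^ (2 / 3) : R).
Hypothesis design : random_design X Z.

Let q p : R := Num.sqrt (p%:R / (n p)%:R).

(** On the event of a small interaction, the ratio of the norm of row [i] of the Gram
    matrix to its typical size [q]; elsewhere, the factor that turns the rate into the
    trivial bound. *)
Definition gap_cst p (i : 'I_p) (X0 : (n p).-tuple (p.-tuple R)) : R :=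
  C * (if gram_frobenius (n p) X0 <= kappa ^+ 2
       then Num.sqrt (gram_row i X0) / q p + 1 else (q p)^-1).

Let n_pos : \forall p \near \oo, (0 < n p)%N.
Proof. exact: (n_infty (nbhs_infty_gt 0)). Qed.

Lemma design_gap_le p (i : 'I_p) X0 N : (0 < n p)%N -> 0 <= C -> 0 <= N ->
  C * design_gap kappa X0 i N <=
  gap_cst i X0 * (q p + (p%:R / Num.sqrt (n p)%:R + 1) * N).
Proof.
move=> n0 C0 N0; rewrite /gap_cst -mulrA ler_wpM2l// /design_gap.
have p0 : (0 < p)%N by apply: leq_ltn_trans (ltn_ord i).
have nR : 0 < (n p)%:R :> R by rewrite ltr0n.
have pR : 0 < p%:R :> R by rewrite ltr0n.
have q0 : 0 < q p by rewrite sqrtr_gt0 divr_gt0.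
have pn0 : 0 <= p%:R / Num.sqrt (n p)%:R :> R.
  by apply: mulr_ge0; [exact: ltW | rewrite invr_ge0 sqrtr_ge0].
have x0 : 0 <= (p%:R / Num.sqrt (n p)%:R + 1) * N.
  by apply: mulr_ge0 => //; exact: addr_ge0.
case: ifP => _; last first.
  by rewrite mulrDr mulVf ?gt_eqF// lerDl mulr_ge0// invr_ge0 ltW.
set g := Num.sqrt (gram_row i X0) / q p.
have g0 : 0 <= g by apply: mulr_ge0; [exact: sqrtr_ge0 | rewrite invr_ge0 ltW].
have -> : Num.sqrt (gram_row i X0) = g * q p by rewrite divfK ?gt_eqF.
have qp : q p * Num.sqrt p%:R = p%:R / Num.sqrt (n p)%:R.
  by rewrite /q sqrtrM// sqrtrV// mulrAC -expr2 sqr_sqrtr.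
set w := p%:R / Num.sqrt (n p)%:R in qp pn0 x0 *.
have -> : g * q p * (1 + Num.sqrt p%:R * N) + N = g * q p + g * (q p * Num.sqrt p%:R) * N + N.
  by ring.
rewrite qp.
have y1 : 0 <= g * N by rewrite mulr_ge0.
have y2 : 0 <= w * N by rewrite mulr_ge0.
by have := ltW q0; lra.
Qed.

(* [p << n^(2/3)] bounds [p^3 / n^2] by any [e], and then [p <= n] bounds
   [p^4 / n^3 = p^3 / n^2 * (p / n)]. *)
Let rate_small (e : R) : 0 < e -> \forall p \near \oo,
  p%:R ^+ 3 / (n p)%:R ^+ 2 <= e /\ p%:R ^+ 4 / (n p)%:R ^+ 3 <= e.
Proof.
move=> e0; pose eta := Num.min 1 e.
have eta0 : 0 < eta by rewrite lt_min ltr01.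
have eta1 : eta <= 1 by rewrite ge_min lexx.
have etae : eta <= e by rewrite ge_min lexx orbT.
have /eqoP/(_ _ eta0) small := p_small.
near=> p.
have n0 : (0 < n p)%N by near: p.
have nR : 0 < (n p)%:R :> R by rewrite ltr0n.
have n1 : 1 <= (n p)%:R :> R by rewrite ler1n.
have : `|p%:R : R| <= eta * `|(n p)%:R `^ (2 / 3) : R| by near: p.
rewrite !ger0_norm ?powR_ge0// => pn.
have cube : ((n p)%:R `^ (2 / 3)) ^+ 3 = (n p)%:R ^+ 2 :> R.
  rewrite -!powR_mulrn ?powR_ge0 ?ltW// -powRrM.
  by congr (_ `^ _); field.
have p3 : p%:R ^+ 3 <= eta * (n p)%:R ^+ 2.
  apply: (@le_trans _ _ ((eta * (n p)%:R `^ (2 / 3)) ^+ 3)).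
    by rewrite lerXn2r ?nnegrE// mulr_ge0 ?powR_ge0// ltW.
  rewrite exprMn cube ler_wpM2r ?exprn_ge0//.
  by rewrite exprSr -[leRHS]mul1r ler_wpM2r ?(ltW eta0)// expr_le1// ltW.
have pn1 : p%:R <= (n p)%:R :> R.
  have powle : (n p)%:R `^ (2 / 3) <= (n p)%:R :> R.
    rewrite -[leRHS](powRr1 (ltW nR)); apply: ler_powR => //; lra.
  apply: (le_trans pn); rewrite -[leRHS]mul1r.
  apply: ler_pM => //; exact: ltW.
split.
  by rewrite ler_pdivrMr ?exprn_gt0// (le_trans p3)// ler_wpM2r// exprn_ge0.
rewrite ler_pdivrMr ?exprn_gt0// exprSr [(n p)%:R ^+ 3]exprSr mulrA ler_pM ?exprn_ge0//.
by rewrite (le_trans p3)// ler_wpM2r// exprn_ge0.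
Unshelve. all: by end_near. Qed.

(** By [design_event], with [eta] and [r] such that each of the two bad events has
    probability at most [e / 2]. *)
Lemma gap_cst_tight : 0 <= C ->
  OP Pr (fun p i w => [set gap_cst i (X p w)]) (fun _ _ _ => 1).
Proof.
move=> C0 e e0; have [mean0 var1 [B subB] law] := design.
pose c8 : R := 8%:R ^+ 8 * (2 * expR ((B + 1) ^+ 2 / 2)).
have c80 : 0 <= c8 by rewrite mulr_ge0 ?exprn_ge0// mulr_ge0// expR_ge0.
have k20 : 0 < kappa ^+ 2 by rewrite exprn_gt0.
pose eta := e / 2 * kappa ^+ 2 / (6 + c8).
have eta0 : 0 < eta by rewrite divr_gt0 ?mulr_gt0 ?divr_gt0 ?ltr_wpDr.
exists (C * (Num.sqrt (2 / e) + 1)).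
near=> p => i.
have n0 : (0 < n p)%N by near: p.
have [r1 r2] : p%:R ^+ 3 / (n p)%:R ^+ 2 <= eta /\ p%:R ^+ 4 / (n p)%:R ^+ 3 <= eta.
  by near: p; exact: rate_small.
have nR : 0 < (n p)%:R :> R by rewrite ltr0n.
have pR : 0 < p%:R :> R by rewrite ltr0n; apply: leq_ltn_trans (ltn_ord i).
have q2 : q p ^+ 2 = p%:R / (n p)%:R by rewrite sqr_sqrtr// divr_ge0 ?ltW.
have q0 : 0 < q p by rewrite sqrtr_gt0 divr_gt0.
have mom := subgaussian_all_moments (mean0 p) (subB p).
have mom8 := subgaussian_moment8 (mean0 p) (subB p).
pose r := 2 / e * (p%:R / (n p)%:R).
have e20 : 0 < 2 / e by rewrite divr_gt0.
have rpos : 0 < r by rewrite mulr_gt0// divr_gt0.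
have [mE PE] := design_event mom n0 (mean0 p) (var1 p) mom8 i k20 rpos.
set E := [set _ | _] in mE PE.
exists (X p @^-1` E); split.
- by rewrite -[X in measurable X]setTI; exact: measurable_funPT.
- rewrite law//; apply: le_trans PE; rewrite lee_fin lerD2l lerN2.
  rewrite [leRHS](_ : e = e / 2 + e / 2); last by rewrite -splitr.
  apply: lerD.
    rewrite ler_pdivrMr//.
    apply: (@le_trans _ _ (6 * eta + eta * c8)).
      by rewrite -mulrA lerD// ?ler_wpM2l// ler_wpM2r.
    rewrite (_ : 6 * eta + eta * c8 = eta * (6 + c8)); last by ring.
    by rewrite /eta divfK// gt_eqF// ltr_wpDr.
  rewrite /r le_eqVlt; apply/orP; left; apply/eqP; field.
  by rewrite !gt_eqF.
- move=> w z [Ew1 Ew2] ->; rewrite mulr1 /gap_cst Ew1.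
  have g0 : 0 <= gram_row i (X p w) by apply: sumr_ge0 => j _; exact: sqr_ge0.
  rewrite ger0_norm; last first.
    by rewrite mulr_ge0// addr_ge0// divr_ge0 ?sqrtr_ge0// ltW.
  rewrite ler_wpM2l// lerD2r ler_pdivrMr//.
  have -> : Num.sqrt (2 / e) * q p = Num.sqrt r.
    by rewrite (sqrtrM _ (ltW e20)).
  exact: ler_wsqrtr.
Unshelve. all: by end_near. Qed.

Lemma OPX_OP (V : forall p, 'I_p -> Om p -> set R) (c : forall p, 'I_p -> Om p -> R) :
  (forall p i w, 0 <= c p i w) -> OPX X V c -> OP Pr V c.
Proof.
move=> c0 [K [tK bK]] e e0; have [M hM] := tK e e0; exists M.
near=> p.
have bKp : forall (i : 'I_p) w z, V p i w z -> `|z| <= K p i (X p w) * c p i w.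
  by near: p.
have tKp : forall i : 'I_p, exists A : set (Om p), [/\ measurable A,
    ((1 - e)%:E <= Pr p A)%E &
    forall w z, A w -> [set K p i (X p w)] z -> `|z| <= M * 1].
  by near: p.
move=> i; have [A [mA PA hA]] := tKp i.
exists A; split => // w z Aw Vz; apply: (le_trans (bKp _ _ _ Vz)).
apply: ler_wpM2r => //; apply: (le_trans (ler_norm _)).
by rewrite -[leRHS]mulr1; exact: (hA w).
Unshelve. all: by end_near. Qed.

End tightness.

(** * The theorem *)

Theorem theorem4p1 (R : realType) (n : nat -> nat)
  (d : nat -> measure_display) (Om : forall p, measurableType (d p))
  (Pr : forall p, probability (Om p) R)
  (X : forall p, {RV (Pr p) >-> (n p).-tuple (p.-tuple R)})
  (beta : forall p, {RV (Pr p) >-> p.-tuple R})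
  (y : forall p, {RV (Pr p) >-> (n p).-tuple R})
  (sigma : R) (Z : nat -> probability R R)
  (k : nat) (Theta : set 'rV[R]_k) (theta0 : 'rV[R]_k)
  (nu : {measure set R -> \bar R}) (S : set R)
  (l : 'rV[R]_k -> R -> R) (mu : 'rV[R]_k -> probability R R)
  (thetahat : forall p, (n p).-tuple R -> (n p).-tuple (p.-tuple R) -> 'rV[R]_k) :
  0 < sigma ->
  n p @[p --> \oo] --> \oo ->
  (fun p => p%:R : R) =o_\oo (fun p => (n p)%:R `^ (2 / 3) : R) ->
  prior_family Theta theta0 nu S l mu ->
  bounded_support Theta S l ->
  random_design X Z ->
  data_model X beta y (mu theta0) sigma ->
  (forall p y0 X0, Theta (thetahat p y0 X0)) ->
  let post p (t : 'rV[R]_k) w := posterior sigma (y p w) (X p w) (mu t) in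
  let VB p (t : 'rV[R]_k) w := mf_argmin sigma (y p w) (X p w) (mu t) in
  let That p w := thetahat p (y p w) (X p w) in
  let ra p (i : 'I_p) (w : Om p) : R := Num.sqrt (p%:R / (n p)%:R) in
  let rb p (i : 'I_p) (w : Om p) : R := Num.sqrt (p%:R / (n p)%:R) +
    (p%:R / Num.sqrt (n p)%:R + 1) * l2norm (That p w - theta0) in
  [/\
    [/\ OPX X (fun p i w =>
          [set dTV (marginal (post p theta0 w) i) (marginal (prod_prob Q) i)
          | Q in VB p theta0 w]) ra,
        OPX X (fun p i w =>
          [set coord_mean (post p theta0 w) i - coord_mean (prod_prob Q) i
          | Q in VB p theta0 w]) ra &
        OPX X (fun p i w =>
          [set coord_var (post p theta0 w) i - coord_var (prod_prob Q) i
          | Q in VB p theta0 w]) ra],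
    [/\ OPX X (fun p i w =>
          [set dTV (marginal (post p (That p w) w) i) (marginal (prod_prob Q) i)
          | Q in VB p (That p w) w]) ra,
        OPX X (fun p i w =>
          [set coord_mean (post p (That p w) w) i - coord_mean (prod_prob Q) i
          | Q in VB p (That p w) w]) ra &
        OPX X (fun p i w =>
          [set coord_var (post p (That p w) w) i - coord_var (prod_prob Q) i
          | Q in VB p (That p w) w]) ra] &
    [/\ OPX X (fun p i w =>
          [set dTV (marginal (post p theta0 w) i) (marginal (prod_prob Q) i)
          | Q in VB p (That p w) w]) rb,
        OP Pr (fun p i w =>
          [set coord_mean (post p theta0 w) i - coord_mean (prod_prob Q) i
          | Q in VB p (That p w) w]) rb &
        OP Pr (fun p i w =>
          [set coord_var (post p theta0 w) i - coord_var (prod_prob Q) i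
          | Q in VB p (That p w) w]) rb]].
Proof.
move=> sigma0 n_infty p_small prior bounded design _ TT post VB That ra rb.
have [kappa [C [kappa0 C0 gap]]] := uniform_gap prior bounded sigma0.
have T0 : Theta theta0 := theta0_Theta prior.
have n_pos : \forall p \near \oo, (0 < n p)%N by have := n_infty _ (nbhs_infty_gt 0).
have norm0 : l2norm (0 : 'rV[R]_k) = 0.
  rewrite /l2norm big1 ?sqrtr0// => j _.
  by rewrite big1// => m _; rewrite mxE expr0n.
have tight := gap_cst_tight kappa0 n_infty p_small design C0.
pose K p (i : 'I_p) (X0 : (n p).-tuple (p.-tuple R)) := gap_cst kappa C i X0.
have bound p (i : 'I_p) w t t' Q : (0 < n p)%N -> Theta t -> Theta t' ->
    t = t' \/ t = theta0 -> VB p t' w Q ->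
    let c := K p i (X p w) * (Num.sqrt (p%:R / (n p)%:R) +
      (p%:R / Num.sqrt (n p)%:R + 1) * l2norm (t' - t)) in
    [/\ `|dTV (marginal (post p t w) i) (marginal (prod_prob Q) i)| <= c,
        `|coord_mean (post p t w) i - coord_mean (prod_prob Q) i| <= c &
        `|coord_var (post p t w) i - coord_var (prod_prob Q) i| <= c].
  move=> n0 Tt Tt' tt' QM /=.
  have [g1 g2 g3] := gap _ _ _ _ i _ _ _ Tt Tt' tt' QM.
  have le := design_gap_le kappa i (X p w) n0 C0 (l2norm_ge0 (t' - t)).
  by split; [exact: le_trans g1 le | exact: le_trans g2 le | exact: le_trans g3 le].
have opx (V : forall p, 'I_p -> Om p -> set R) c :
    (\forall p \near \oo, forall (i : 'I_p) w z, V p i w z ->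
      `|z| <= K p i (X p w) * c p i w) -> OPX X V c.
  by move=> bV; exists K.
have same (tt : forall p, Om p -> 'rV[R]_k) : (forall p w, Theta (tt p w)) ->
  [/\ OPX X (fun p i w =>
        [set dTV (marginal (post p (tt p w) w) i) (marginal (prod_prob Q) i)
        | Q in VB p (tt p w) w]) ra,
      OPX X (fun p i w =>
        [set coord_mean (post p (tt p w) w) i - coord_mean (prod_prob Q) i
        | Q in VB p (tt p w) w]) ra &
      OPX X (fun p i w =>
        [set coord_var (post p (tt p w) w) i - coord_var (prod_prob Q) i
        | Q in VB p (tt p w) w]) ra].
  move=> Ttt; split; apply: opx; near=> p => i w z [Q QM <-];
    have n0 : (0 < n p)%N by [near: p];
    have := bound p i w _ _ Q n0 (Ttt p w) (Ttt p w) (or_introl erefl) QM;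
    by rewrite /= subrr norm0 mulr0 addr0 => -[].
have cross :
  [/\ OPX X (fun p i w =>
        [set dTV (marginal (post p theta0 w) i) (marginal (prod_prob Q) i)
        | Q in VB p (That p w) w]) rb,
      OPX X (fun p i w =>
        [set coord_mean (post p theta0 w) i - coord_mean (prod_prob Q) i
        | Q in VB p (That p w) w]) rb &
      OPX X (fun p i w =>
        [set coord_var (post p theta0 w) i - coord_var (prod_prob Q) i
        | Q in VB p (That p w) w]) rb].
  split; apply: opx; near=> p => i w z [Q QM <-];
    have n0 : (0 < n p)%N by [near: p];
    by have [] := bound p i w _ _ Q n0 T0 (TT p _ _) (or_intror erefl) QM.
have rb_ge0 p i w : 0 <= rb p i w.
  apply: addr_ge0; first exact: sqrtr_ge0.
  apply: mulr_ge0; last exact: l2norm_ge0.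
  by apply: addr_ge0 => //; apply: mulr_ge0 => //; rewrite invr_ge0 sqrtr_ge0.
have [cross1 cross2 cross3] := cross.
split.
- exact: (same (fun _ _ => theta0)).
- by apply: (same That) => p w; exact: TT.
- by split; [exact: cross1 | exact: OPX_OP cross2 | exact: OPX_OP cross3].
Unshelve. all: by end_near. Qed.
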